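(* Let $n\ge 2$ and let $\Omega\subset\mathbb{C}^n$ be a bounded, balanced, convex and homogeneous domain. Let $K$ be a nonempty compact subset of $\Omega$ such that $\Omega\setminus K$ is connected. Then for every $z\in\Omega\setminus K$, $$s^{\Omega}_{\Omega\setminus K}(z)=d_{c_\Omega}^{\partial K}(z)=d_{c_\Omega}^{K}(z).$$
   Context: A domain $\Omega\subset\mathbb{C}^n$ is balanced if $\lambda z\in\Omega$ whenever $z\in\Omega$, $\lambda\in\mathbb{C}$, $|\lambda|\le 1$; it is homogeneous if its group of holomorphic automorphisms acts transitively. Let $\mathbb{D}$ be the unit disk in $\mathbb{C}$ and $O(X,Y)$ the set of holomorphic maps from $X$ into $Y$. Carathéodory pseudodistance: $c_\Omega(z,w)=\sup\{\tanh^{-1}|\lambda| : f\in O(\Omega,\mathbb{D}),\ f(z)=0,\ f(w)=\lambda\}$. For a nonempty compact $S\subset\Omega$ and $z\in\Omega\setminus S$, put $d_{c_\Omega}^{S}(z)=\min_{w\in S}\tanh[c_\Omega(z,w)]$. Generalized squeezing function: let $\Omega\subset\mathbb{C}^n$ be bounded, balanced and convex with Minkowski function $\rho_\Omega(z)=\inf\{t>0: z/t\in\Omega\}$, so $\Omega=\{\rho_\Omega<1\}$. For a bounded domain $D\subset\mathbb{C}^n$ and $z\in D$, $$s_D^\Omega(z)=\sup\{r>0:\ \{w\in\mathbb{C}^n:\rho_\Omega(w)<r\}\subset f(D)\ \text{for some injective } f\in O(D,\Omega)\text{ with } f(z)=0\}.$$ *)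

(* Defs.v *)
From HB Require Import structures.
From mathcomp Require Import all_boot all_order all_algebra.
From mathcomp Require Import complex.
From mathcomp Require Import all_classical all_reals all_analysis.

Set Implicit Arguments.
Unset Strict Implicit.
Unset Printing Implicit Defensive.

Import Order.TTheory GRing.Theory Num.Theory.
Import numFieldNormedType.Exports.

Local Open Scope classical_set_scope.
Local Open Scope ring_scope.
Local Open Scope complex_scope.

(* R[i] packed as a numFieldType, so that its topology and norm are the ones
   the analysis library attaches to a numFieldType, and 'rV[Cplx R]_n is a
   normed module over it (with the sup norm of the coordinates).  The order of
   R[i] is partial: x <= y and x < y include that y - x is real. *)
Definition Cplx (R : realType) : numFieldType := R[i].

Section RealFunctions.
Variable R : realType.

Definition tanh (x : R) : R :=
  (expR x - expR (- x)) / (expR x + expR (- x)).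

Definition artanh (x : R) : R := ln ((1 + x) / (1 - x)) / 2.

Definition is_min (A : set R) (m : R) : Prop := A m /\ lbound A m.

End RealFunctions.

Definition boundary (T : topologicalType) (A : set T) : set T :=
  closure A `\` interior A.

Definition domain (T : topologicalType) (D : set T) : Prop :=
  [/\ D !=set0, open D & connected D].

Section SeveralComplexVariables.
Variables (R : realType) (n : nat).
Local Notation C := (Cplx R).
Local Notation Cn := 'rV[C]_n.

Definition balanced (Omega : set Cn) : Prop :=
  forall (lambda : C) (z : Cn), `|lambda| <= 1 -> Omega z ->
    Omega (lambda *: z).

(* The library's convexity quantifies over weights 0 <= t <= 1 in the scalar
   field; in the order of C these are exactly the real numbers of
   [0, 1], so this is the usual real convexity. *)
Definition convex (Omega : set Cn) : Prop :=
  convex_set (Omega : set (convex_lmodType Cn)).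

(* f belongs to O(X, Y), for X open.  Maps are total functions of which only the
   restriction to X matters; "differentiable" is over the scalar field C, that
   is, complex Frechet differentiability. *)
Definition holomorphic_map (W : normedModType C) (X : set Cn) (Y : set W)
    (f : Cn -> W) : Prop :=
  (forall z : Cn, X z -> differentiable f z) /\
  (forall z : Cn, X z -> Y (f z)).

Definition automorphism (Omega : set Cn) (f : Cn -> Cn) : Prop :=
  holomorphic_map Omega Omega f /\
  exists g : Cn -> Cn, [/\ holomorphic_map Omega Omega g,
    (forall z, Omega z -> g (f z) = z) & (forall z, Omega z -> f (g z) = z)].

Definition homogeneous (Omega : set Cn) : Prop :=
  forall z w, Omega z -> Omega w ->
    exists2 f, automorphism Omega f & f z = w.

Definition unit_disk : set C := [set lambda | `|lambda| < 1].

(* A real-valued supremum: on a domain the set is bounded above (and contains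
   0), so the convention of sup for unbounded sets plays no role. *)
Definition caratheodory (Omega : set Cn) (z w : Cn) : R :=
  sup [set x : R | exists f : Cn -> C, exists lambda : C,
    [/\ holomorphic_map Omega unit_disk f, f z = 0, f w = lambda
      & x = artanh (ComplexField.Normc.normc lambda)]].

(* "m is the minimum over w in S of tanh (c_Omega (z, w))"; the minimum is
   required to be attained. *)
Definition is_caratheodory_dist (Omega S : set Cn) (z : Cn) (m : R) : Prop :=
  is_min [set tanh (caratheodory Omega z w) | w in S] m.

Definition minkowski (Omega : set Cn) (z : Cn) : R :=
  inf [set t : R | 0 < t /\ Omega (((t^-1)%:C : C) *: z)].

Definition squeezing (Omega D : set Cn) (z : Cn) : R :=
  sup [set r : R | 0 < r /\ exists f : Cn -> Cn,
    [/\ holomorphic_map D Omega f, {in D &, injective f}, f z = 0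
      & [set w | minkowski Omega w < r] `<=` f @` D]].

End SeveralComplexVariables.

(* Main.v *)
(* By homogeneity one may move z to the origin by an automorphism phi; write rho for
   the Minkowski function.  The Schwarz lemma and linear functionals of norm one give
   tanh c(z, w) = rho (phi w), so with K' = phi(K) everything reduces to showing that
   the squeezing function at 0 of D' = Omega minus K' is m = min rho on K'.  The
   identity map gives ">=".  For "<=", let f be an injective holomorphic map of D' into
   Omega with f 0 = 0 whose image contains the ball {rho < r}, and let w0 in K' have
   rho w0 = m.  Hartogs' phenomenon (n >= 2) extends l o f, for a linear functional l,
   across K' with the same Schwarz estimate, so rho (f x) <= rho x on D'.  Then
   f (t w0), 0 < t < 1, has a cluster point p with rho p <= m as t -> 1.  If m < r, then
   p = f u with u in D'; as an injective holomorphic map is open, f takes the values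
   f (t w0), t close to 1, near u, which contradicts injectivity because w0 <> u. *)
Require Import Defs.
From HB Require Import structures.
From mathcomp Require Import all_boot all_order all_algebra.
From mathcomp Require Import complex.
From mathcomp Require Import all_classical all_reals all_analysis.
From mathcomp Require Import ring lra zify.
Import Order.TTheory GRing.Theory Num.Theory.
Import numFieldNormedType.Exports.
Local Open Scope classical_set_scope.
Local Open Scope ring_scope.
Local Open Scope complex_scope.

Set Implicit Arguments.
Unset Strict Implicit.
Unset Printing Implicit Defensive.

(** The disc through [0] and [x] may cross the hole, so the Schwarz estimate is applied to an
    extension [F] of [g = l o f]: a one-variable Cauchy integral over a circle of the complex line
    of [x] that lies in the shell between the maximum of [rho] on the hole and [1]. Dimension at
    least two makes [F = g] on the shell, and connectedness of the complement carries the equality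
    to the origin. Only holomorphy of [F] along complex lines is needed, so one complex variable
    suffices.

    Openness of an injective holomorphic map is obtained without knowing that its Jacobian is
    invertible everywhere: the Jacobian determinant is transported to the image, and a weak form of
    Rado's theorem is applied on a disc joining a regular value to a supposedly omitted one.

    Both parts rest on circle means, built as ultrafilter limits of dyadic sums; Goursat's bisection
    makes them independent of the radius.

    Minimality of [rho w0] has two uses: the segment [t w0], [t < 1], misses the hole, and [w0]
    corresponds to a boundary point of [K], so that [K] and its boundary give the same distance. *)

Section RealNorm.
Variable R : realType.
Local Notation C := (Cplx R).

(* The library's norm on a complex normed module is [C]-valued. *)
Definition nr (W : normedModType C) (x : W) : R := complex.Re (`|x| : R[i]).

(** * Epsilon-delta forms of topology, continuity and differentiability *)

Section Normed.
Variable W : normedModType C.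
Implicit Types x y : W.

Lemma normE_nr x : `|x| = (nr x)%:C :> C.
Proof. by rewrite /nr RRe_real // normr_real. Qed.

Lemma nr_ge0 x : 0 <= nr x.
Proof. by rewrite -lecR -normE_nr; exact: (normr_ge0 x). Qed.

Lemma nr0 : nr (0 : W) = 0.
Proof. by rewrite /nr normr0. Qed.

Lemma nr_eq0 x : (nr x == 0) = (x == 0).
Proof.
rewrite -(normr_eq0 x) normE_nr; apply/eqP/eqP => [->//|].
by move=> /complexI.
Qed.

Lemma nr_gt0 x : (0 < nr x) = (x != 0).
Proof. by rewrite lt_neqAle nr_ge0 andbT eq_sym nr_eq0. Qed.

Lemma nrD x y : nr (x + y) <= nr x + nr y.
Proof. by rewrite -lecR rmorphD /= -!normE_nr; exact: ler_normD. Qed.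

Lemma nrN x : nr (- x) = nr x.
Proof. by rewrite /nr normrN. Qed.

Lemma nr_distC x y : nr (x - y) = nr (y - x).
Proof. by rewrite -nrN opprB. Qed.

Lemma nrB x y : nr (x - y) <= nr x + nr y.
Proof. by rewrite -(nrN y); exact: nrD. Qed.

Lemma nr_dist_tri y x z : nr (x - z) <= nr (x - y) + nr (y - z).
Proof. by apply: le_trans (nrD _ _); rewrite addrA subrK. Qed.

Lemma nr_near x y z (d : R) : nr (y - x) < d - nr (x - z) -> nr (y - z) < d.
Proof. by rewrite ltrBrDr; apply: le_lt_trans; exact: nr_dist_tri. Qed.

Lemma nr_lb_dist x y : nr x - nr y <= nr (x - y).
Proof. by rewrite lerBlDr; apply: le_trans (nrD _ _); rewrite subrK. Qed.

Lemma nr_dist_dist x y : `|nr x - nr y| <= nr (x - y).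
Proof. by rewrite ler_norml -lerNl opprB {1}nr_distC !nr_lb_dist. Qed.

Lemma nrZ (k : C) x : nr (k *: x) = nr (k : C) * nr x.
Proof. by apply: complexI; rewrite rmorphM /= -!normE_nr normrZ. Qed.

Lemma nbhs_nr x (A : set W) :
  nbhs x A <-> exists2 e : R, 0 < e & forall y, nr (y - x) < e -> A y.
Proof.
split.
  move=> /nbhs_normP[e /= e0 eA].
  have er : e = (complex.Re (e : R[i]))%:C by rewrite RRe_real // gtr0_real.
  exists (complex.Re (e : R[i])); first by rewrite -ltcR -er.
  move=> y yx; apply: eA => /=.
  by rewrite /ball_ /= er normE_nr ltcR nr_distC.
move=> [e e0 eA]; apply/nbhs_normP; exists (e%:C); first by rewrite /= ltcR.
by move=> y /=; rewrite /ball_ /= normE_nr ltcR nr_distC => /eA.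
Qed.

Lemma open_nr (A : set W) :
  (forall x, A x -> exists2 e : R, 0 < e & forall y, nr (y - x) < e -> A y) ->
  open A.
Proof. by move=> h; rewrite openE => x /h/nbhs_nr. Qed.

Lemma nr_open (A : set W) x : open A -> A x ->
  exists2 e : R, 0 < e & forall y, nr (y - x) < e -> A y.
Proof. by move=> oA Ax; apply/nbhs_nr; exact: open_nbhs_nbhs. Qed.

Lemma closed_nr_ball x (r : R) : closed [set y | nr (y - x) <= r].
Proof.
rewrite -openC; apply: open_nr => y /= /negP; rewrite -ltNge => ry.
exists (nr (y - x) - r); first by rewrite subr_gt0.
move=> z zy /=; apply/negP; rewrite -ltNge.
have := nr_dist_tri z y x; rewrite (nr_distC y z) => h.
by move: zy h; move: (nr _) (nr _) (nr _) => *; lra.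
Qed.

Lemma nr_cont_real (f : W -> R) (A : set W) :
  {within A, continuous f} <->
  forall x, A x -> forall e : R, 0 < e -> exists2 d : R, 0 < d &
    forall y, A y -> nr (y - x) < d -> `|f y - f x| < e.
Proof.
split.
  move=> /subspace_continuousP h x Ax e e0.
  have /cvgrPdist_lt/(_ e e0) := h x Ax.
  rewrite /within /= => /nbhs_nr[d d0 hd]; exists d => // y Ay yx.
  by rewrite distrC; exact: hd.
move=> h; apply/subspace_continuousP => x Ax; apply/cvgrPdist_lt => e e0.
have [d d0 hd] := h x Ax e e0.
apply/nbhs_nr; exists d => // y yx Ay; rewrite distrC; exact: hd.
Qed.

End Normed.

Section Continuity.
Variables (V W : normedModType C).

Lemma nr_cvgP (T : Type) (F : set_system T) (FF : Filter F) (f : T -> W) (l : W) :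
  f @ F --> l <-> forall e : R, 0 < e -> F [set t | nr (f t - l) < e].
Proof.
split.
  move=> h e e0; have : nbhs l [set y | nr (y - l) < e].
    by apply/nbhs_nr; exists e.
  by move=> /h.
move=> h A /nbhs_nr[e e0 eA]; apply: filterS (h e e0) => t /=; exact: eA.
Qed.

Lemma nr_cont (f : V -> W) x : {for x, continuous f} <->
  forall e : R, 0 < e -> exists2 d : R, 0 < d &
    forall y, nr (y - x) < d -> nr (f y - f x) < e.
Proof.
split.
  by move=> /nr_cvgP h e /h /nbhs_nr.
by move=> h; apply/nr_cvgP => e /h; move/nbhs_nr.
Qed.

Lemma nr_within_cont (f : V -> W) (A : set V) :
  {within A, continuous f} <->
  forall x, A x -> forall e : R, 0 < e -> exists2 d : R, 0 < d &
    forall y, A y -> nr (y - x) < d -> nr (f y - f x) < e.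
Proof.
split.
  move=> /subspace_continuousP h x Ax e e0.
  have /nr_cvgP/(_ e e0) := h x Ax.
  by rewrite /within /= => /nbhs_nr[d d0 hd]; exists d => // y Ay yx; exact: hd.
move=> h; apply/subspace_continuousP => x Ax; apply/nr_cvgP => e e0.
have [d d0 hd] := h x Ax e e0.
by apply/nbhs_nr; exists d => // y yx Ay; exact: hd.
Qed.

Lemma diff_nr (f : V -> W) x : differentiable f x ->
  forall e : R, 0 < e -> exists2 d : R, 0 < d &
    forall h, nr h < d -> nr (f (x + h) - f x - 'd f x h) <= e * nr h.
Proof.
move=> df e e0; have /eqaddoP /(_ e%:C) := diff_locally df.
rewrite ltcR => /(_ e0) /nbhs_nr[d d0 hd].
exists d => // h hh; have := hd h; rewrite subr0 => /(_ hh).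
rewrite !fctE /= !normE_nr -rmorphM /= lecR (addrC h).
by rewrite opprD addrA.
Qed.

(** Converse of [diff_nr]; [nr_der] and [nr_dmat] specialise it to functions of one complex variable
    and to Jacobian matrices. *)
Lemma nr_diff (f : V -> W) x (L : {linear V -> W}) : continuous L ->
  (forall e : R, 0 < e -> exists2 d : R, 0 < d &
    forall h, nr h < d -> nr (f (x + h) - f x - L h) <= e * nr h) ->
  differentiable f x /\ 'd f x = L :> (V -> W).
Proof.
move=> cL hf.
have key : f \o shift x = cst (f x) + L +o_ (0 : V) id.
  apply/eqaddoP => e e0.
  have er : e = (complex.Re (e : R[i]))%:C by rewrite RRe_real // gtr0_real.
  have e0' : 0 < complex.Re (e : R[i]) by rewrite -ltcR -er.
  have [d d0 hd] := hf _ e0'; apply/nbhs_nr; exists d => // h; rewrite subr0 => /hd.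
  rewrite -lecR rmorphM /= -er -!normE_nr => H.
  rewrite !fctE /=; move: H; congr (_ <= _); congr (`| _ |).
  by rewrite (addrC x h) opprD addrA.
have dE : 'd f x = L :> (V -> W) by exact: diff_unique.
split=> //; apply/diff_locallyP; split; first by rewrite dE.
by rewrite dE.
Qed.
End Continuity.

End RealNorm.

(** * Real and imaginary parts, compactness of closed balls *)

Section ComplexNumbers.
Variable R : realType.
Local Notation C := (Cplx R).
Implicit Types x y z : C.

Definition cre z : R := complex.Re (z : R[i]).
Definition cim z : R := complex.Im (z : R[i]).
Definition cr (a : R) : C := (a%:C : R[i]).
Definition ci : C := ('i : R[i]).
Definition cconj z : C := ((z : R[i])^*)%C.

Lemma crD a b : cr (a + b) = cr a + cr b. Proof. exact: rmorphD. Qed.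
Lemma crN a : cr (- a) = - cr a. Proof. exact: rmorphN. Qed.
Lemma crB a b : cr (a - b) = cr a - cr b. Proof. exact: rmorphB. Qed.
Lemma crM a b : cr (a * b) = cr a * cr b. Proof. exact: rmorphM. Qed.
Lemma crV a : cr (a^-1) = (cr a)^-1. Proof. exact: fmorphV. Qed.
Lemma cr0 : cr 0 = 0. Proof. exact: rmorph0. Qed.
Lemma cr1 : cr 1 = 1. Proof. exact: rmorph1. Qed.
Lemma crX a n : cr (a ^+ n) = cr a ^+ n. Proof. exact: rmorphXn. Qed.
Lemma cr_inj : injective cr. Proof. by move=> a b /complexI. Qed.
Lemma cr_eq0 a : (cr a == 0) = (a == 0).
Proof. by rewrite -cr0 (inj_eq cr_inj). Qed.

Lemma cE z : z = cr (cre z) + ci * cr (cim z).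
Proof. by rewrite {1}[z](@complexE R). Qed.

Lemma ci2 : ci * ci = -1.
Proof. by rewrite -expr2; exact: sqr_i. Qed.

Lemma creD x y : cre (x + y) = cre x + cre y.
Proof. by rewrite /cre; case: (x : R[i]) (y : R[i]) => [? ?] [? ?]. Qed.
Lemma cimD x y : cim (x + y) = cim x + cim y.
Proof. by rewrite /cim; case: (x : R[i]) (y : R[i]) => [? ?] [? ?]. Qed.
Lemma creN x : cre (- x) = - cre x.
Proof. by rewrite /cre; case: (x : R[i]). Qed.
Lemma creB x y : cre (x - y) = cre x - cre y.
Proof. by rewrite creD creN. Qed.
Lemma cre_r a : cre (cr a) = a. Proof. by []. Qed.
Lemma cim_r a : cim (cr a) = 0. Proof. by []. Qed.
Lemma creM x y : cre (x * y) = cre x * cre y - cim x * cim y.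
Proof. by rewrite /cre /cim; case: (x : R[i]) (y : R[i]) => [? ?] [? ?]. Qed.
Lemma cimM x y : cim (x * y) = cre x * cim y + cim x * cre y.
Proof. by rewrite /cre /cim; case: (x : R[i]) (y : R[i]) => [? ?] [? ?]. Qed.
Lemma cre_i : cre ci = 0. Proof. by []. Qed.
Lemma cim_i : cim ci = 1. Proof. by []. Qed.

Lemma nrM x y : nr (x * y) = nr x * nr y.
Proof. exact: nrZ. Qed.
Lemma nr1 : nr (1 : C) = 1.
Proof. by rewrite /nr normr1. Qed.
Lemma nrX x n : nr (x ^+ n) = nr x ^+ n.
Proof. by elim: n => [|n IH]; rewrite ?expr0 ?nr1// !exprS nrM IH. Qed.
Lemma nrV x : nr (x^-1) = (nr x)^-1.
Proof.
have [->|x0] := eqVneq x 0; first by rewrite invr0 !nr0 invr0.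
have nx : nr x != 0 by rewrite nr_eq0.
by apply: (mulfI nx); rewrite -nrM mulfV// mulfV// nr1.
Qed.
Lemma nrc_sqr x : nr x ^+ 2 = cre x ^+ 2 + cim x ^+ 2.
Proof.
apply: cr_inj; rewrite crX /cr -normE_nr.
by rewrite -(add_Re2_Im2 (x : R[i])).
Qed.
Lemma nr_cr a : nr (cr a) = `|a|.
Proof.
apply/eqP; rewrite -(eqrXn2 (n:=2)) ?nr_ge0//.
by rewrite nrc_sqr /= expr0n /= addr0 real_normK// num_real.
Qed.
Lemma nr_ci : nr ci = 1.
Proof.
apply/eqP; rewrite -(eqrXn2 (n:=2)) ?nr_ge0//.
by rewrite nrc_sqr /= expr0n /= add0r.
Qed.
Lemma cre_le x : `|cre x| <= nr x.
Proof.
rewrite -(ler_pXn2r (n:=2)) ?nnegrE ?nr_ge0// nrc_sqr real_normK ?num_real//.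
by rewrite lerDl sqr_ge0.
Qed.
Lemma cim_le x : `|cim x| <= nr x.
Proof.
rewrite -(ler_pXn2r (n:=2)) ?nnegrE ?nr_ge0// nrc_sqr real_normK ?num_real//.
by rewrite lerDr sqr_ge0.
Qed.
Lemma cre_le_nr x : cre x <= nr x.
Proof. exact: le_trans (ler_norm _) (cre_le x). Qed.
Lemma cre_cartesian (a b : R) : cre (cr a + ci * cr b) = a.
Proof. by rewrite creD creM !cre_r !cim_r cre_i mul0r mulr0 subrr addr0. Qed.
Lemma cim_cartesian (a b : R) : cim (cr a + ci * cr b) = b.
Proof. by rewrite cimD cimM !cre_r !cim_r cre_i cim_i mul1r mul0r !add0r. Qed.

Lemma cconj_mul z : z * cconj z = cr (nr z ^+ 2).
Proof.
rewrite [RHS]/cr nrc_sqr /cre /cim /cconj; case: (z : R[i]) => a b.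
apply/eqP; rewrite eq_complex /=; apply/andP; split; apply/eqP; ring.
Qed.
Lemma nr_conj z : nr (cconj z) = nr z.
Proof.
apply/eqP; rewrite -(eqrXn2 (n:=2)) ?nr_ge0// !nrc_sqr /cre /cim /cconj.
by case: (z : R[i]) => a b /=; rewrite sqrrN.
Qed.

(** Turns a bound on a modulus into a bound on a real part, which is linear; means, the mean value
    inequality and functionals are all estimated this way. *)
Lemma rotate_real z : exists2 u : C, nr u = 1 & u * z = cr (nr z).
Proof.
have [->|z0] := eqVneq z 0; first by exists 1; rewrite ?nr1// mulr0 nr0 cr0.
have nz : nr z != 0 by rewrite nr_eq0.
exists (cconj z / cr (nr z)).
  by rewrite nrM nrV nr_cr nr_conj ger0_norm ?nr_ge0// mulfV.
by rewrite mulrAC [cconj z * z]mulrC cconj_mul expr2 crM mulfK// cr_eq0.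
Qed.

Lemma compact_disc (c : C) (r : R) : compact [set z : C | nr (z - c) <= r].
Proof.
pose f : R * R -> C := fun p => cr p.1 + ci * cr p.2.
pose m := nr c + r.
apply: (@subclosed_compact _ _ [set f p | p in `[- m, m]%classic `*` `[-m, m]%classic]).
- exact: closed_nr_ball.
- apply: continuous_compact; last by apply: compact_setX; exact: segment_compact.
  apply: continuous_subspaceT => -[a b]; apply/nr_cvgP => e e0.
  have e2 : 0 < e / 2 by rewrite divr_gt0.
  exists (ball a (e / 2), ball b (e / 2)); first by split; exact: nbhsx_ballx.
  move=> [a' b'] [/= ha hb]; rewrite /f /=.
  have -> : cr a' + ci * cr b' - (cr a + ci * cr b) = cr (a' - a) + ci * cr (b' - b).
    by rewrite !crB; ring.
  apply: le_lt_trans (nrD _ _) _; rewrite nrM nr_ci mul1r !nr_cr.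
  by move: ha hb; rewrite /ball /= (distrC a) (distrC b) => *; lra.
- move=> z /= hz.
  have zm : nr z <= m by rewrite /m addrC -lerBlDr; exact: le_trans (nr_lb_dist _ _) hz.
  exists (cre z, cim z); last by rewrite /f /= -cE.
  split => /=; rewrite in_itv /= -ler_norml.
    exact: le_trans (cre_le _) zm.
  exact: le_trans (cim_le _) zm.
Qed.

Section Matrices.
Variable n : nat.
Local Notation V := 'rV[C]_n.

Lemma nr_coord (x : V) i : nr (x ord0 i) <= nr x.
Proof.
rewrite -lecR -!normE_nr [X in _ <= X]mx_normE.
by rewrite -[leLHS]nngE num_le; exact: (le_bigmax _ _ (ord0, i)).
Qed.

Lemma nr_rV_le (x : V) (r : R) : 0 <= r ->
  (forall i, nr (x ord0 i) <= r) -> nr x <= r.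
Proof.
move=> r0 h; have [->|x0] := eqVneq x 0; first by rewrite nr0.
have : mx_norm x != 0 by apply: contra_neq x0; exact: mx_norm_eq0.
move=> /mx_norm_neq0[[i j] /= e].
suff -> : nr x = nr (x ord0 j) by [].
by rewrite /nr -[`|x|]/(mx_norm x) e (ord1 i).
Qed.

Lemma compact_rV_ball (a : V) (r : R) : compact [set x : V | nr (x - a) <= r].
Proof.
apply: (@subclosed_compact _ _ [set v : V | forall i, [set z | nr (z - a ord0 i) <= r] (v ord0 i)]).
- exact: closed_nr_ball.
- by apply: (@rV_compact C n (fun i => [set z | nr (z - a ord0 i) <= r])) => i; exact: compact_disc.
- move=> x /= xr i; apply: le_trans xr.
  by have := nr_coord (x - a) i; rewrite !mxE.
Qed.

End Matrices.

Lemma nr_EVT_max (W : normedModType C) (A : set W) (f : W -> R) :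
  A !=set0 -> compact A ->
  (forall x : W, A x -> forall e : R, 0 < e -> exists2 d : R, 0 < d &
    forall y : W, A y -> nr (y - x) < d -> `|f y - f x| < e) ->
  exists2 c, A c & forall t, A t -> f t <= f c.
Proof.
move=> A0 cA /nr_cont_real cf; have [c cA' h] := compact_EVT_max A0 cA cf.
by exists c => [|t At]; [rewrite inE in cA'|apply: h; rewrite inE].
Qed.

Lemma nr_EVT_min (W : normedModType C) (A : set W) (f : W -> R) :
  A !=set0 -> compact A ->
  (forall x : W, A x -> forall e : R, 0 < e -> exists2 d : R, 0 < d &
    forall y : W, A y -> nr (y - x) < d -> `|f y - f x| < e) ->
  exists2 c, A c & forall t, A t -> f c <= f t.
Proof.
move=> A0 cA h; have [|c Ac hc] := @nr_EVT_max W A (fun t => - f t) A0 cA.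
  move=> x Ax e e0; have [d d0 hd] := h x Ax e e0; exists d => // y Ay yx.
  by rewrite opprK addrC distrC; exact: hd.
by exists c => // t /hc; rewrite lerN2.
Qed.

Section OneVariable.
Variable W : normedModType C.
Implicit Types (g : C -> W).

Definition der g z : W := 'd g z (1 : C).

Lemma diff_der g z h : differentiable g z -> 'd g z h = h *: der g z.
Proof. by move=> dg; rewrite /der -linearZ /= /GRing.scale /= mulr1. Qed.

Lemma der_nr g z : differentiable g z ->
  forall e : R, 0 < e -> exists2 d : R, 0 < d &
    forall h, nr h < d -> nr (g (z + h) - g z - h *: der g z) <= e * nr h.
Proof.
move=> dg e e0; have [d d0 hd] := diff_nr dg e0.
by exists d => // h /hd; rewrite diff_der.
Qed.

Lemma nr_der g z (c : W) :
  (forall e : R, 0 < e -> exists2 d : R, 0 < d &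
    forall h, nr h < d -> nr (g (z + h) - g z - h *: c) <= e * nr h) ->
  differentiable g z /\ der g z = c.
Proof.
move=> hg.
have slin : linear (fun h : C => h *: c).
  by move=> u y w; rewrite scalerDl scalerA.
pose LM := GRing.isLinear.Build _ _ _ _ _ slin.
pose L : {linear C -> W} := HB.pack (fun h : C => h *: c) LM.
have cL : continuous L by apply: scalel_continuous.
have [dg e] := @nr_diff R _ _ g z L cL hg.
by split=> //; rewrite /der e /L /= scale1r.
Qed.

End OneVariable.
End ComplexNumbers.

(** * One complex variable *)

Section UltraLimit.
Variable R : realType.
Local Notation C := (Cplx R).

(** Along an ultrafilter containing the eventual sets every bounded sequence converges, by
    compactness of discs. Hence [ulim] is linear on bounded sequences and keeps bounds, with no
    convergence to prove, and it extends the usual limit. *)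
Definition natU : set_system nat := sval (cid (@ultraFilterLemma nat \oo _)).

Lemma natU_ultra : UltraFilter natU.
Proof. by rewrite /natU; case: cid => ? []. Qed.

Lemma natU_proper : ProperFilter natU.
Proof. exact: (@ultra_proper _ _ natU_ultra). Qed.

Lemma natU_filter : Filter natU.
Proof. exact: (@filter_filter _ _ natU_proper). Qed.

Lemma natU_eventually N (P : set nat) : (forall k, (N <= k)%N -> P k) -> natU P.
Proof.
move=> h; rewrite /natU; case: cid => G [GU sub] /=; apply: sub.
by exists N.
Qed.

Definition cbnd (u : nat -> C) := exists M : R, forall k, nr (u k) <= M.

Definition ulim (u : nat -> C) : C :=
  xget 0 [set l : C | forall e : R, 0 < e -> natU [set k | nr (u k - l) < e]].

Lemma ulim_spec (u : nat -> C) :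
  (exists l : C, forall e : R, 0 < e -> natU [set k | nr (u k - l) < e]) ->
  forall e : R, 0 < e -> natU [set k | nr (u k - ulim u) < e].
Proof.
exact: (@xgetPex _ 0 [set l : C | forall e : R, 0 < e -> natU [set k | nr (u k - l) < e]]).
Qed.

Lemma ulimP (u : nat -> C) : cbnd u -> forall e : R, 0 < e -> natU [set k | nr (u k - ulim u) < e].
Proof.
move=> [M hM]; suff [l hl] : exists l : C, forall e : R, 0 < e -> natU [set k | nr (u k - l) < e].
  by apply: ulim_spec; exists l.
have UU := natU_ultra; have FF := natU_filter; have PF := natU_proper.
have [|l [_ hl]] := @compact_disc R 0 M (u @ natU) _.
  by apply: (@natU_eventually 0) => k _ /=; rewrite subr0; exact: hM.
exists l => e e0.
have [//|nh] := in_ultra_setVsetC [set k | nr (u k - l) < e] UU.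
have [||z [/= + ze]] := hl (~` [set z | nr (z - l) < e]) [set z | nr (z - l) < e].
- by apply: filterS nh => k /=.
- by apply/nbhs_nr; exists e.
by move=> /(_ ze).
Qed.

Lemma ulim_unique (u : nat -> C) (l : C) :
  (forall e : R, 0 < e -> natU [set k | nr (u k - l) < e]) -> ulim u = l.
Proof.
move=> hl; have hu := ulim_spec (ex_intro _ l hl).
apply/eqP; rewrite -subr_eq0 -nr_eq0; apply/negPn/negP => ne.
have d0 : 0 < nr (ulim u - l) / 2 by rewrite divr_gt0// lt_neqAle eq_sym ne nr_ge0.
have FF := natU_filter.
have [k [/= h1 h2]] := @filter_ex _ _ natU_proper _ (filterI (hl _ d0) (hu _ d0)).
have h3 := nr_dist_tri (u k) (ulim u) l; rewrite nr_distC in h2.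
by move: h1 h2 h3; move: (nr _) (nr _) (nr _) => *; lra.
Qed.

Lemma cbndD u v : cbnd u -> cbnd v -> cbnd (fun k => u k + v k).
Proof.
move=> [M hM] [N hN]; exists (M + N) => k.
by apply: le_trans (nrD _ _) _; rewrite lerD.
Qed.

Lemma cbndZ (c : C) u : cbnd u -> cbnd (fun k => c * u k).
Proof.
by move=> [M hM]; exists (nr c * M) => k; rewrite nrM ler_wpM2l ?nr_ge0.
Qed.

Lemma ulimD u v : cbnd u -> cbnd v -> ulim (fun k => u k + v k) = ulim u + ulim v.
Proof.
move=> bu bv; apply: ulim_unique => e e0.
have e2 : 0 < e / 2 by rewrite divr_gt0.
have FF := natU_filter.
apply: filterS (filterI (ulimP bu e2) (ulimP bv e2)) => k [/= h1 h2].
rewrite opprD addrACA; apply: le_lt_trans (nrD _ _) _.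
by move: h1 h2; move: (nr _) (nr _) => *; lra.
Qed.

Lemma ulimZ (c : C) u : cbnd u -> ulim (fun k => c * u k) = c * ulim u.
Proof.
move=> bu; apply: ulim_unique => e e0.
have c0 : 0 < nr c + 1 by rewrite ltr_wpDl ?nr_ge0.
have e2 : 0 < e / (nr c + 1) by rewrite divr_gt0.
have FF := natU_filter.
apply: filterS (ulimP bu e2) => k /= h1.
rewrite -mulrBr nrM; rewrite ltr_pdivlMr// in h1; apply: le_lt_trans h1.
by rewrite mulrC ler_wpM2l ?nr_ge0// lerDl.
Qed.

Lemma ulim_cvg u l :
  (forall e : R, 0 < e -> exists N, forall k, (N <= k)%N -> nr (u k - l) < e) -> ulim u = l.
Proof.
by move=> h; apply: ulim_unique => e /h[N hN]; exact: natU_eventually hN.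
Qed.

Lemma ulim_ext u v N : cbnd u -> (forall k, (N <= k)%N -> u k = v k) -> ulim v = ulim u.
Proof.
move=> bu h; apply: ulim_unique => e e0; have FF := natU_filter.
have h' : natU [set k | u k = v k] by apply: natU_eventually h.
by apply: filterS (filterI (ulimP bu e0) h') => k [/= + <-].
Qed.

Lemma ulim_re u (M : R) : cbnd u -> (forall k, cre (u k) <= M) -> cre (ulim u) <= M.
Proof.
move=> bu h; rewrite leNgt; apply/negP => lt.
have d0 : 0 < cre (ulim u) - M by rewrite subr_gt0.
have FF := natU_filter.
have [k /= h1] := @filter_ex _ _ natU_proper _ (ulimP bu d0).
have := le_lt_trans (cre_le_nr (ulim u - u k)) _; rewrite nr_distC => /(_ _ h1).
by rewrite creB; have := h k; move: (cre _) (cre _) => *; lra.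
Qed.

Lemma ulim_bound u (M : R) : (forall k, nr (u k) <= M) -> nr (ulim u) <= M.
Proof.
move=> h; have [w w1 hw] := rotate_real (ulim u).
have bu : cbnd u by exists M.
have <- : cre (w * ulim u) = nr (ulim u) by rewrite hw cre_r.
rewrite -ulimZ//; apply: ulim_re; first exact: cbndZ.
by move=> k; apply: le_trans (cre_le_nr _) _; rewrite nrM w1 mul1r.
Qed.

End UltraLimit.

(** * Integration by dyadic sums *)

Section DyadicIntegral.
Variable R : realType.
Local Notation C := (Cplx R).
Implicit Types (phi psi : R -> C) (a h M : R).

Fixpoint dsum (k : nat) phi a h : C :=
  if k is k'.+1 then dsum k' phi a (h / 2) + dsum k' phi (a + h / 2) (h / 2)
  else cr h * phi a.

Lemma dsum_ext k phi psi a h : 0 < h ->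
  (forall t, a <= t < a + h -> phi t = psi t) -> dsum k phi a h = dsum k psi a h.
Proof.
elim: k a h => [|k IH] a h h0 e /=; first by rewrite e// lexx ltrDl.
congr (_ + _); apply: IH; rewrite ?divr_gt0// => t /andP[t1 t2]; apply: e; apply/andP; split; lra.
Qed.

Lemma dsumD k phi psi a h :
  dsum k (fun t => phi t + psi t) a h = dsum k phi a h + dsum k psi a h.
Proof.
elim: k a h => [|k IH] a h /=; first by rewrite mulrDr.
by rewrite !IH addrACA.
Qed.

Lemma dsumZ k (c : C) phi a h :
  dsum k (fun t => c * phi t) a h = c * dsum k phi a h.
Proof.
elim: k a h => [|k IH] a h /=; first by rewrite mulrCA.
by rewrite !IH mulrDr.
Qed.

Lemma dsum_bound k phi a h M : 0 < h ->
  (forall t, a <= t < a + h -> nr (phi t) <= M) -> nr (dsum k phi a h) <= h * M.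
Proof.
elim: k a h => [|k IH] a h h0 e /=.
  by rewrite nrM nr_cr gtr0_norm// ler_wpM2l ?(ltW h0)// e// lexx ltrDl.
apply: le_trans (nrD _ _) _.
have -> : h * M = h / 2 * M + h / 2 * M by field.
by apply: lerD; apply: IH; rewrite ?divr_gt0// => t /andP[t1 t2]; apply: e; apply/andP; split; lra.
Qed.

Lemma dsum_re k phi a h M : 0 < h ->
  (forall t, a <= t < a + h -> cre (phi t) <= M) -> cre (dsum k phi a h) <= h * M.
Proof.
elim: k a h => [|k IH] a h h0 e /=.
  by rewrite creM cre_r cim_r mul0r subr0 ler_wpM2l ?(ltW h0)// e// lexx ltrDl.
rewrite creD; have -> : h * M = h / 2 * M + h / 2 * M by field.
by apply: lerD; apply: IH; rewrite ?divr_gt0// => t /andP[t1 t2]; apply: e; apply/andP; split; lra.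
Qed.

Lemma dsum_id k a h :
  dsum k (fun t => cr t) a h = cr (h * (a + h / 2 - h / 2 * (2^-1) ^+ k)).
Proof.
elim: k a h => [|k IH] a h /=.
  by rewrite -crM expr0; congr cr; field.
by rewrite !IH -crD exprS; congr cr; field.
Qed.

Lemma dsum_cst k (c : C) a h : dsum k (fun=> c) a h = cr h * c.
Proof.
elim: k a h => [|k IH] a h //=.
by rewrite !IH -mulrDl -crD; congr (cr _ * _); field.
Qed.

Definition mesh (l : nat) : R := (2^-1) ^+ l.

Lemma mesh_gt0 l : 0 < mesh l.
Proof. by rewrite exprn_gt0// invr_gt0. Qed.

Lemma meshS l : mesh l.+1 = mesh l / 2.
Proof. by rewrite /mesh exprS mulrC. Qed.

(* Integral from [a] to [a + 2^-l]: the ultralimit makes it linear on all bounded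
   functions, with no measurability or continuity to be checked. *)
Definition dint (l : nat) phi a : C := ulim (fun k => dsum (k - l) phi a (mesh l)).

Definition dbnd phi a h := exists M, forall t, a <= t < a + h -> nr (phi t) <= M.

Lemma dbnd_cbnd l phi a : dbnd phi a (mesh l) -> cbnd (fun k => dsum (k - l) phi a (mesh l)).
Proof.
by move=> [M hM]; exists (mesh l * M) => k; apply: dsum_bound => //; exact: mesh_gt0.
Qed.

Lemma dint_ext l phi psi a : (forall t, a <= t < a + mesh l -> phi t = psi t) ->
  dint l phi a = dint l psi a.
Proof.
move=> e; rewrite /dint; congr ulim; apply/funext => k.
by apply: dsum_ext => //; exact: mesh_gt0.
Qed.

Lemma dintD l phi psi a : dbnd phi a (mesh l) -> dbnd psi a (mesh l) ->
  dint l (fun t => phi t + psi t) a = dint l phi a + dint l psi a.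
Proof.
move=> /dbnd_cbnd b1 /dbnd_cbnd b2; rewrite /dint -ulimD//.
by congr ulim; apply/funext => k; rewrite dsumD.
Qed.

Lemma dintZ l (c : C) phi a : dbnd phi a (mesh l) ->
  dint l (fun t => c * phi t) a = c * dint l phi a.
Proof.
move=> /dbnd_cbnd b1; rewrite /dint -ulimZ//.
by congr ulim; apply/funext => k; rewrite dsumZ.
Qed.

Lemma dint_bound l phi a M : (forall t, a <= t < a + mesh l -> nr (phi t) <= M) ->
  nr (dint l phi a) <= mesh l * M.
Proof.
move=> h; apply: ulim_bound => k; apply: dsum_bound => //; exact: mesh_gt0.
Qed.

Lemma dint_re l phi a M : dbnd phi a (mesh l) ->
  (forall t, a <= t < a + mesh l -> cre (phi t) <= M) -> cre (dint l phi a) <= mesh l * M.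
Proof.
move=> /dbnd_cbnd b h; apply: ulim_re => // k; apply: dsum_re => //; exact: mesh_gt0.
Qed.

(** With the index [k - l] the sums over an interval and over its two halves use the same sample
    points, so they agree exactly for every [k > l]. *)
Lemma dint_split l phi a : dbnd phi a (mesh l) ->
  dint l phi a = dint l.+1 phi a + dint l.+1 phi (a + mesh l.+1).
Proof.
move=> b.
have hp := mesh_gt0 l; have hS := meshS l.
have b1 : dbnd phi a (mesh l.+1).
  by case: b => M hM; exists M => t /andP[t1 t2]; apply: hM; apply/andP; split; lra.
have b2 : dbnd phi (a + mesh l.+1) (mesh l.+1).
  by case: b => M hM; exists M => t /andP[t1 t2]; apply: hM; apply/andP; split; lra.
rewrite -ulimD; try exact: dbnd_cbnd.
apply: (@ulim_ext _ _ _ l.+1).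
  by apply: cbndD; exact: dbnd_cbnd.
by move=> k lk; rewrite -(subnSK lk) /= -meshS.
Qed.

Lemma dint_cst l (c : C) a : dint l (fun=> c) a = cr (mesh l) * c.
Proof.
apply: ulim_unique => e e0; apply: (@natU_eventually 0) => k _ /=.
by rewrite dsum_cst subrr nr0.
Qed.

Lemma mesh_small (e : R) : 0 < e -> exists N, forall k, (N <= k)%N -> mesh k < e.
Proof.
move=> e0; have /cvgrPdist_lt/(_ e e0)[N _ hN] : (fun k => mesh k) @ \oo --> (0 : R).
  by apply: cvg_expr; rewrite ger0_norm// invf_lt1// ltr1n.
by exists N => k /hN /=; rewrite sub0r normrN gtr0_norm// mesh_gt0.
Qed.

(** The left-endpoint sums miss the integral by a multiple of the mesh. Constants and the identity
    are the only functions integrated explicitly: they show that affine functions have zero contour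
    integral, which is what Goursat's argument needs. *)
Lemma dint_id l a : dint l (fun t => cr t) a = cr (mesh l * (a + mesh l / 2)).
Proof.
apply: ulim_cvg => e e0.
have [N hN] := mesh_small e0; exists (N + l)%N => k Nk.
have hl := mesh_gt0 l.
have h1 : mesh l <= 1 by rewrite exprn_ile1// ?invr_ge0// invf_le1// ler1n.
rewrite dsum_id -crB nr_cr -/(mesh _).
have -> : mesh l * (a + mesh l / 2 - mesh l / 2 * mesh (k - l)) - mesh l * (a + mesh l / 2)
  = - (mesh l * mesh l / 2 * mesh (k - l)) by ring.
have kp := mesh_gt0 (k - l).
rewrite normrN ger0_norm; last by rewrite !mulr_ge0// ltW.
apply: le_lt_trans (hN (k - l)%N _); last by rewrite leq_subRL; lia.
by rewrite ler_piMl// ?ltW//; nra.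
Qed.

End DyadicIntegral.

(** * The complex exponential *)

Section Exponential.
Variable R : realType.
Local Notation C := (Cplx R).

Lemma real_derive_eps (f : R -> R) (x d : R) : is_derive x 1 f d ->
  forall e : R, 0 < e -> exists2 r : R, 0 < r &
    forall h, `|h| < r -> `|f (x + h) - f x - d * h| <= e * `|h|.
Proof.
move=> [df dE] e e0.
have df' : differentiable f x by apply/derivable1_diffP.
have /eqaddoP /(_ e e0) /nbhs_normP[r r0 hr] := diff_locally df'.
exists r => // h hr0; have := hr h; rewrite /ball_ /= sub0r normrN => /(_ hr0).
rewrite !fctE /= (addrC h) (_ : 'd f x h = d * h).
  by rewrite opprD addrA.
by rewrite -[h in LHS]mulr1 -[h * 1]/(h *: (1:R)) linearZ /= -deriveE// dE mulrC.
Qed.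

Definition cexp (z : C) : C :=
  cr (expR (cre z)) * (cr (cos (cim z)) + ci R * cr (sin (cim z))).

Lemma cexpD z w : cexp (z + w) = cexp z * cexp w.
Proof.
rewrite /cexp creD cimD expRD cosD sinD crM crB crD !crM.
have := ci2 R; move: (ci R) (cr _) (cr _) (cr _) (cr _) (cr _) (cr _) => i a b c d e f hi.
by ring: hi.
Qed.

Lemma nr_cexp z : nr (cexp z) = expR (cre z).
Proof.
rewrite /cexp nrM nr_cr gtr0_norm ?expR_gt0//.
suff -> : nr (cr (cos (cim z)) + ci R * cr (sin (cim z))) = 1 by rewrite mulr1.
apply/eqP; rewrite -(eqrXn2 (n:=2)) ?nr_ge0// nrc_sqr cre_cartesian cim_cartesian.
by rewrite cos2Dsin2 expr1n.
Qed.

Lemma cexp_real a : cexp (cr a) = cr (expR a).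
Proof. by rewrite /cexp cre_r cim_r cos0 sin0 cr0 cr1 mulr0 addr0 mulr1. Qed.

Lemma cexp_2pii : cexp (ci R * cr (2 * pi)) = 1.
Proof.
have -> : ci R * cr (2 * pi) = cr 0 + ci R * cr (2 * pi) by rewrite cr0 add0r.
rewrite /cexp cre_cartesian cim_cartesian expR0 mulr_natl cos2pi mulr2n sinD sinpi.
by rewrite mul0r mulr0 addr0 cr1 cr0 mulr0 addr0 mulr1.
Qed.

Lemma cexp_diff0 : forall e : R, 0 < e -> exists2 d : R, 0 < d &
  forall h : C, nr h < d -> nr (cexp h - 1 - h) <= e * nr h.
Proof.
move=> e e0.
(* [cexp h - 1 - h] is split into the errors of [expR], of [cos] and [sin], and the cross term
   [i x y]; these contribute 2, 4 and 1 times [e' * nr h], so 20 is ample. The bound [e' <= 1] keeps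
   [1 + x] below 2. *)
have [e' [e'0 e'1 e'e]] : exists e', [/\ 0 < e', e' <= 1 & e' <= e / 20].
  exists (Num.min 1 (e / 20)).
  by rewrite lt_min ltr01 divr_gt0// !ge_min !lexx orbT.
have [d1 d10 h1] := real_derive_eps (is_derive_expR (0 : R)) e'0.
have [d2 d20 h2] := real_derive_eps (is_derive_cos (0 : R)) e'0.
have [d3 d30 h3] := real_derive_eps (is_derive_sin (0 : R)) e'0.
exists (Num.min (Num.min d1 d2) (Num.min d3 e')).
  by rewrite !lt_min d10 d20 d30 e'0.
move=> h; rewrite !lt_min => /andP[/andP[hd1 hd2] /andP[hd3 he]].
set x := cre h; set y := cim h.
have xn : `|x| <= nr h := cre_le h.
have yn : `|y| <= nr h := cim_le h.
have X := h1 x (le_lt_trans xn hd1).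
have Y := h2 y (le_lt_trans yn hd2).
have Z := h3 y (le_lt_trans yn hd3).
rewrite add0r expR0 mul1r in X.
rewrite add0r cos0 sin0 oppr0 mul0r subr0 in Y.
rewrite add0r cos0 sin0 subr0 mul1r in Z.
have n0 := nr_ge0 h.
have -> : cexp h - 1 - h = cr (expR x - 1 - x) * (cr (cos y) + ci R * cr (sin y))
   + cr (1 + x) * (cr (cos y - 1) + ci R * cr (sin y - y)) + ci R * cr (x * y).
  by rewrite [X in _ - _ - X = _](cE h) /cexp -/x -/y !(crB, crD, crM) cr1; ring.
have X' : `|expR x - 1 - x| <= e' * nr h.
  by apply: le_trans X _; rewrite ler_wpM2l// ltW.
have Y' : `|cos y - 1| <= e' * nr h.
  by apply: le_trans Y _; rewrite ler_wpM2l// ltW.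
have Z' : `|sin y - y| <= e' * nr h.
  by apply: le_trans Z _; rewrite ler_wpM2l// ltW.
have T1 : nr (cr (expR x - 1 - x) * (cr (cos y) + ci R * cr (sin y))) <= e' * nr h * 2.
  rewrite nrM nr_cr; apply: ler_pM => //; rewrite ?nr_ge0//.
  apply: le_trans (nrD _ _) _; rewrite nrM nr_ci mul1r !nr_cr.
  have := cos_max y; have := sin_max y; move=> *; lra.
have T2 : nr (cr (1 + x) * (cr (cos y - 1) + ci R * cr (sin y - y))) <= 2 * (2 * (e' * nr h)).
  rewrite nrM nr_cr; apply: ler_pM => //; rewrite ?nr_ge0//.
    apply: le_trans (ler_normD _ _) _; rewrite normr1; lra.
  apply: le_trans (nrD _ _) _; rewrite nrM nr_ci mul1r !nr_cr; lra.
have T3 : nr (ci R * cr (x * y)) <= e' * nr h.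
  rewrite nrM nr_ci mul1r nr_cr normrM; apply: ler_pM => //.
  by apply: le_trans xn _; exact: ltW.
apply: le_trans (nrD _ _) _; apply: le_trans (lerD (nrD _ _) (lexx _)) _.
have : e' * nr h <= e / 20 * nr h by rewrite ler_wpM2r.
have : 0 <= e * nr h by rewrite mulr_ge0// ltW.
lra.
Qed.

Lemma cexp_diff z : differentiable cexp z.
Proof.
suff [//] : differentiable cexp z /\ der cexp z = cexp z.
apply: nr_der => e e0.
have p0 : 0 < nr (cexp z) by rewrite nr_cexp expR_gt0.
have [d d0 hd] := cexp_diff0 (divr_gt0 e0 p0).
exists d => // h /hd hdh.
have -> : cexp (z + h) - cexp z - h *: cexp z = cexp z * (cexp h - 1 - h).
  by rewrite cexpD /GRing.scale /=; ring.
rewrite nrM; have : nr (cexp z) * nr (cexp h - 1 - h) <= nr (cexp z) * (e / nr (cexp z) * nr h).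
  by rewrite ler_wpM2l// ltW.
by rewrite mulrA mulrCA mulfV ?mulr1// gt_eqF.
Qed.

End Exponential.

(** * Goursat's theorem on a rectangle *)

Section Goursat.
Variable R : realType.
Local Notation C := (Cplx R).
Variable kap : R.
Hypothesis kap0 : 0 <= kap.
Implicit Types (H G : C -> C) (x y u v : R) (l : nat).

(* The circles of an annulus are the images of the vertical segments of a rectangle
   under the exponential; [kap] is the ratio of its sides. *)
Definition grid x y : C := cr (kap * x) + ci R * cr y.

(** The counterclockwise integral of [H dz] around the image under [grid] of the square with lower
    left corner [(x, y)] and side [mesh R l]: [dz] is [kap dx] on horizontal sides and [i dy] on
    vertical ones. *)
Definition contour H l x y : C :=
  cr kap * (dint l (fun u => H (grid u y)) x - dint l (fun u => H (grid u (y + mesh R l))) x)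
  + ci R * (dint l (fun v => H (grid (x + mesh R l) v)) y - dint l (fun v => H (grid x v)) y).

Definition cell_bounded H l x y := exists M : R, forall u v,
  x <= u <= x + mesh R l -> y <= v <= y + mesh R l -> nr (H (grid u v)) <= M.

Lemma cell_dbnd H l x y : cell_bounded H l x y ->
  [/\ dbnd (fun u => H (grid u y)) x (mesh R l),
      dbnd (fun u => H (grid u (y + mesh R l))) x (mesh R l),
      dbnd (fun v => H (grid (x + mesh R l) v)) y (mesh R l) &
      dbnd (fun v => H (grid x v)) y (mesh R l)].
Proof.
move=> [M hM]; have h0 := mesh_gt0 R l.
by split; exists M => t /andP[t1 t2]; apply: hM; apply/andP; split; lra.
Qed.

Lemma contourD H G l x y : cell_bounded H l x y -> cell_bounded G l x y ->
  contour (fun z => H z + G z) l x y = contour H l x y + contour G l x y.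
Proof.
move=> /cell_dbnd[a1 a2 a3 a4] /cell_dbnd[b1 b2 b3 b4].
by rewrite /contour !dintD//; ring.
Qed.

Lemma contour_affine (a b : C) l x y : contour (fun z => a + b * z) l x y = 0.
Proof.
have bnd w s : w <= s -> s < w + mesh R l -> `|s| <= `|w| + `|w + mesh R l|.
  move=> s1 s2; rewrite ler_norml; have := ler_norm (w + mesh R l).
  have := ler_norm (- w); rewrite normrN.
  have := normr_ge0 w; have := normr_ge0 (w + mesh R l).
  by move=> *; apply/andP; split; lra.
have lin1 w t : dint l (fun u => a + b * grid u t) w
   = cr (mesh R l) * (a + b * ci R * cr t) + b * cr kap * cr (mesh R l * (w + mesh R l / 2)).
  rewrite -dint_id -dintZ; last first.
    exists (`|w| + `|w + mesh R l|) => s /andP[s1 s2]; rewrite nr_cr.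
    exact: bnd.
  rewrite -(dint_cst l _ w) -dintD.
  - by apply: dint_ext => s _; rewrite /grid crM; ring.
  - by exists (nr (a + b * ci R * cr t)).
  - exists (nr (b * cr kap) * (`|w| + `|w + mesh R l|)) => s /andP[s1 s2].
    rewrite nrM ler_wpM2l ?nr_ge0// nr_cr.
    exact: bnd.
have lin2 w t : dint l (fun v => a + b * grid t v) w
   = cr (mesh R l) * (a + b * cr (kap * t)) + b * ci R * cr (mesh R l * (w + mesh R l / 2)).
  rewrite -dint_id -dintZ; last first.
    exists (`|w| + `|w + mesh R l|) => s /andP[s1 s2]; rewrite nr_cr.
    exact: bnd.
  rewrite -(dint_cst l _ w) -dintD.
  - by apply: dint_ext => s _; rewrite /grid; ring.
  - by exists (nr (a + b * cr (kap * t))).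
  - exists (nr (b * ci R) * (`|w| + `|w + mesh R l|)) => s /andP[s1 s2].
    rewrite nrM ler_wpM2l ?nr_ge0// nr_cr.
    exact: bnd.
by rewrite /contour !lin1 !lin2 !(crM, crD); ring.
Qed.

Lemma contour_bound H l x y (m : R) :
  (forall u v, x <= u <= x + mesh R l -> y <= v <= y + mesh R l -> nr (H (grid u v)) <= m) ->
  nr (contour H l x y) <= 2 * (kap + 1) * mesh R l * m.
Proof.
move=> hm; have h0 := mesh_gt0 R l.
have B1 : nr (dint l (fun u => H (grid u y)) x) <= mesh R l * m.
  by apply: dint_bound => t /andP[t1 t2]; apply: hm; apply/andP; split; lra.
have B2 : nr (dint l (fun u => H (grid u (y + mesh R l))) x) <= mesh R l * m.
  by apply: dint_bound => t /andP[t1 t2]; apply: hm; apply/andP; split; lra.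
have B3 : nr (dint l (fun v => H (grid (x + mesh R l) v)) y) <= mesh R l * m.
  by apply: dint_bound => t /andP[t1 t2]; apply: hm; apply/andP; split; lra.
have B4 : nr (dint l (fun v => H (grid x v)) y) <= mesh R l * m.
  by apply: dint_bound => t /andP[t1 t2]; apply: hm; apply/andP; split; lra.
apply: le_trans (nrD _ _) _; rewrite !nrM nr_ci mul1r nr_cr (ger0_norm kap0).
have N1 := nrB (dint l (fun u => H (grid u y)) x) (dint l (fun u => H (grid u (y + mesh R l))) x).
have N2 := nrB (dint l (fun v => H (grid (x + mesh R l) v)) y) (dint l (fun v => H (grid x v)) y).
have -> : 2 * (kap + 1) * mesh R l * m = kap * (mesh R l * m + mesh R l * m) + (mesh R l * m + mesh R l * m) by ring.
apply: lerD; last lra.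
apply: ler_wpM2l => //; lra.
Qed.

Lemma contour_quarter H l x y : cell_bounded H l x y ->
  contour H l x y = contour H l.+1 x y + contour H l.+1 (x + mesh R l.+1) y
   + contour H l.+1 x (y + mesh R l.+1) + contour H l.+1 (x + mesh R l.+1) (y + mesh R l.+1).
Proof.
move=> /cell_dbnd[a1 a2 a3 a4].
have e w : w + mesh R l = w + mesh R l.+1 + mesh R l.+1 by rewrite meshS; field.
rewrite /contour (dint_split a1) (dint_split a2) (dint_split a3) (dint_split a4).
by rewrite !e; ring.
Qed.

Section Vanishing.
Variable H : C -> C.
Hypothesis dH : forall x y, 0 <= x <= 1 -> 0 <= y <= 1 -> differentiable H (grid x y).
Variable M : R.
Hypothesis bH : forall x y, 0 <= x <= 1 -> 0 <= y <= 1 -> nr (H (grid x y)) <= M.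

Let inside l x y := [/\ 0 <= x, x + mesh R l <= 1, 0 <= y & y + mesh R l <= 1].

Let inside_bounded l x y : inside l x y -> cell_bounded H l x y.
Proof.
by move=> [x0 x1 y0 y1]; exists M => u v /andP[u1 u2] /andP[v1 v2]; apply: bH; apply/andP; split; lra.
Qed.

(* Goursat's bisection argument. *)
Lemma contour_vanishes : contour H 0 0 0 = 0.
Proof.
apply/eqP; rewrite -nr_eq0; apply/negPn/negP => ne.
set c := nr _ in ne; have c0 : 0 < c by rewrite lt_neqAle eq_sym ne nr_ge0.
(* One of the four quarters carries at least a quarter of the modulus, and the area is divided by
   four as well, so the bound by [c] times the area is inherited. *)
pose ok l (p : R * R) := inside l p.1 p.2 /\ c * mesh R l ^+ 2 <= nr (contour H l p.1 p.2).
pose sub l (p q : R * R) := [/\ p.1 <= q.1, q.1 + mesh R l.+1 <= p.1 + mesh R l,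
  p.2 <= q.2 & q.2 + mesh R l.+1 <= p.2 + mesh R l].
have step (lp : nat * (R * R)) : exists q, ok lp.1 lp.2 -> ok lp.1.+1 q /\ sub lp.1 lp.2 q.
  case: lp => l [x y] /=; have [okp|nok] := pselect (ok l (x, y)); last by exists (0, 0).
  have [[x0 x1 y0 y1] hc] := okp; simpl in *.
  have h0 := mesh_gt0 R l.+1; have hS := meshS R l.
  have q := contour_quarter (inside_bounded (And4 x0 x1 y0 y1)).
  have key : [\/ c * mesh R l.+1 ^+ 2 <= nr (contour H l.+1 x y),
     c * mesh R l.+1 ^+ 2 <= nr (contour H l.+1 (x + mesh R l.+1) y),
     c * mesh R l.+1 ^+ 2 <= nr (contour H l.+1 x (y + mesh R l.+1)) |
     c * mesh R l.+1 ^+ 2 <= nr (contour H l.+1 (x + mesh R l.+1) (y + mesh R l.+1))].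
    have [|k1] := leP (c * mesh R l.+1 ^+ 2) (nr (contour H l.+1 x y)); first by constructor 1.
    have [|k2] := leP (c * mesh R l.+1 ^+ 2) (nr (contour H l.+1 (x + mesh R l.+1) y)); first by constructor 2.
    have [|k3] := leP (c * mesh R l.+1 ^+ 2) (nr (contour H l.+1 x (y + mesh R l.+1))); first by constructor 3.
    constructor 4; move: hc; rewrite q => hc.
    have := le_trans hc (nrD _ _); have := nrD (contour H l.+1 x y + contour H l.+1 (x + mesh R l.+1) y) (contour H l.+1 x (y + mesh R l.+1)).
    have := nrD (contour H l.+1 x y) (contour H l.+1 (x + mesh R l.+1) y).
    have e4 : c * mesh R l ^+ 2 = 4 * (c * mesh R l.+1 ^+ 2) by rewrite meshS; field.
    rewrite e4; move: k1 k2 k3; move: (c * _) (nr _) (nr _) (nr _) (nr _) (nr _) (nr _) => *; lra.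
  case: key => hk {q hc}; [exists (x, y) | exists (x + mesh R l.+1, y) | exists (x, y + mesh R l.+1) |
    exists (x + mesh R l.+1, y + mesh R l.+1)] => _; (split; [split; [split|] | split]) => //=; lra.
have [f hf] := choice step.
pose p l := iteri l (fun k q => f (k, q)) (0, 0) : R * R.
have hp l : ok l (p l).
  elim: l => [|l IH]; last by have [] := hf (l, p l) IH.
  split; last by rewrite /= /mesh expr0 expr1n mulr1.
  by rewrite /inside /p /= /mesh expr0; split; lra.
have hs l : sub l (p l) (p l.+1) by have [] := hf (l, p l) (hp l).
(* Nested intervals, one coordinate at a time: the supremum of the left ends lies in all of them. *)
have lim (g : R * R -> R) : (forall l, g (p l) <= g (p l.+1) /\ g (p l.+1) + mesh R l.+1 <= g (p l) + mesh R l) ->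
    exists a, forall l, g (p l) <= a <= g (p l) + mesh R l.
  move=> hg.
  have mono k l : (k <= l)%N -> g (p k) <= g (p l) /\ g (p l) + mesh R l <= g (p k) + mesh R k.
    elim: l => [|l IH]; first by rewrite leqn0 => /eqP ->.
    rewrite leq_eqVlt => /orP[/eqP ->//|]; rewrite ltnS => /IH[i1 i2].
    by have [j1 j2] := hg l; split; lra.
  have all k l : g (p k) <= g (p l) + mesh R l.
    have [kl|/ltnW lk] := leqP k l.
      by have [? ?] := mono _ _ kl; have := mesh_gt0 R l; lra.
    by have [? ?] := mono _ _ lk; have := mesh_gt0 R k; lra.
  pose S := [set g (p l) | l in [set: nat]].
  have S0 : S !=set0 by exists (g (p 0)); exists 0%N.
  have hS : has_sup S by split=> //; exists (g (p 0) + mesh R 0) => _ [k _ <-]; exact: all.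
  exists (sup S) => l; apply/andP; split.
    by apply: ub_le_sup; [case: hS|exists l].
  by apply: ge_sup => // _ [k _ <-]; exact: all.
have [a ha] : exists a, forall l, (p l).1 <= a <= (p l).1 + mesh R l.
  by apply: (lim fst) => l; have [] := hs l.
have [b hb] : exists b, forall l, (p l).2 <= b <= (p l).2 + mesh R l.
  by apply: (lim snd) => l; have [] := hs l.
have [a01 b01] : 0 <= a <= 1 /\ 0 <= b <= 1.
  have := ha 0%N; have := hb 0%N; rewrite /p /= /mesh expr0 => /andP[? ?] /andP[? ?].
  by split; apply/andP; split; lra.
(* The affine part of [H] at the common point integrates to zero. The rest is at most
   [e * (kap + 1) * mesh], on a perimeter of [2 * (kap + 1) * mesh]: the product is half of the
   lower bound [c * mesh ^+ 2]. *)
pose e := c / (4 * (kap + 1) ^+ 2).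
have k1 : 0 < kap + 1 by rewrite ltr_wpDl.
have e0 : 0 < e by rewrite divr_gt0// mulr_gt0// exprn_gt0.
have [d d0 hd] := der_nr (dH a01 b01) e0.
have [N hN] := @mesh_small R (d / (kap + 1)) (divr_gt0 d0 k1).
have /(hN N) hl := leqnn N; rewrite ltr_pdivlMr// in hl.
have [ins hc] := hp N; set x := (p N).1 in ins hc; set y := (p N).2 in ins hc.
have h0 := mesh_gt0 R N.
pose be := der H (grid a b); pose al := H (grid a b) - be * grid a b.
pose rr := fun z => H z - (al + be * z).
have rb u v : x <= u <= x + mesh R N -> y <= v <= y + mesh R N ->
    nr (rr (grid u v)) <= e * ((kap + 1) * mesh R N).
  move=> /andP[u1 u2] /andP[v1 v2].
  have := ha N; rewrite -/x => /andP[a1 a2]; have := hb N; rewrite -/y => /andP[b1 b2].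
  pose h := grid u v - grid a b.
  have hn : nr h <= (kap + 1) * mesh R N.
    have -> : h = cr (kap * (u - a)) + ci R * cr (v - b).
      by rewrite /h /grid mulrBr !crB; ring.
    apply: le_trans (nrD _ _) _; rewrite nrM nr_ci mul1r !nr_cr normrM (ger0_norm kap0).
    rewrite mulrDl mul1r; apply: lerD; last by rewrite ler_norml; apply/andP; split; lra.
    by apply: ler_wpM2l => //; rewrite ler_norml; apply/andP; split; lra.
  have hd' : nr h < d by apply: le_lt_trans hn _; rewrite mulrC.
  have := hd h hd'; have -> : grid a b + h = grid u v by rewrite /h addrC subrK.
  have -> : H (grid u v) - H (grid a b) - h *: der H (grid a b) = rr (grid u v).
    by rewrite /rr /al -/be /h /GRing.scale /=; ring.
  by move/le_trans; apply; rewrite ler_wpM2l// ltW.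
have cb1 : cell_bounded rr N x y by exists (e * ((kap + 1) * mesh R N)).
have cb2 : cell_bounded (fun z => al + be * z) N x y.
  exists (nr al + nr be * (kap + 1)) => u v /andP[u1 u2] /andP[v1 v2].
  apply: le_trans (nrD _ _) _; rewrite lerD2l nrM; apply: ler_wpM2l; first exact: nr_ge0.
  have [? ? ? ?] := ins.
  apply: le_trans (nrD _ _) _; rewrite nrM nr_ci mul1r !nr_cr.
  rewrite !ger0_norm ?mulr_ge0//; [|lra|lra].
  by apply: lerD; [rewrite ler_piMr//; lra|lra].
have HE : contour H N x y = contour rr N x y.
  have HE' : H = (fun z => rr z + (al + be * z)) by apply/funext => z; rewrite /rr subrK.
  by rewrite {1}HE' (contourD cb1 cb2) contour_affine addr0.
have := contour_bound rb; rewrite -HE => /(le_trans hc).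
have -> : 2 * (kap + 1) * mesh R N * (e * ((kap + 1) * mesh R N)) = c / 2 * mesh R N ^+ 2.
  by rewrite /e; field; apply/lt0r_neq0.
rewrite ler_pM2r ?exprn_gt0//; lra.
Qed.

End Vanishing.
End Goursat.

(** * Local criteria for differentiability and the mean value inequality *)

Section LocalFacts.
Variable R : realType.
Local Notation C := (Cplx R).

Lemma diff_local (V W : normedModType C) (f g : V -> W) (x : V) (d : R) : 0 < d ->
  (forall y, nr (y - x) < d -> f y = g y) -> differentiable f x -> differentiable g x.
Proof.
move=> d0 fg df.
have cL : continuous ('d f x) by exact: diff_continuous.
suff [//] : differentiable g x /\ 'd g x = 'd f x :> (V -> W).
apply: nr_diff => // e e0; have [r r0 hr] := diff_nr df e0.
exists (Num.min r d); first by rewrite lt_min r0 d0.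
move=> h; rewrite lt_min => /andP[h1 h2]; rewrite -!fg ?subrr ?nr0//; last first.
  by rewrite addrC addKr.
exact: hr.
Qed.

Lemma closed_nr_sphere (W : normedModType C) (c : W) (r : R) :
  closed [set y | nr (y - c) = r].
Proof.
rewrite -openC; apply: open_nr => y /= /eqP yr.
exists `|nr (y - c) - r|; first by rewrite normr_gt0 subr_eq0.
move=> z zy /= zr; have := nr_dist_dist (y - c) (z - c).
have -> : y - c - (z - c) = y - z by rewrite opprB addrA subrK.
by rewrite zr (nr_distC y z) leNgt zy.
Qed.

Lemma compact_bounded (V W : normedModType C) (K : set V) (g : V -> W) :
  compact K -> (forall x, K x -> {for x, continuous g}) ->
  exists M : R, forall x, K x -> nr (g x) <= M.
Proof.
move=> cK cg; have [[x0 Kx0]|K0] := pselect (K !=set0); last first.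
  by exists 0 => x Kx; exfalso; apply: K0; exists x.
have [|c Kc hc] := @nr_EVT_max R V K (fun x => nr (g x)) (ex_intro _ x0 Kx0) cK.
  move=> x Kx e e0; have /nr_cont/(_ e e0)[d d0 hd] := cg x Kx.
  by exists d => // y _ /hd; apply: le_lt_trans (nr_dist_dist _ _).
by exists (nr (g c)).
Qed.

Lemma diff_cont (V W : normedModType C) (f : V -> W) x :
  differentiable f x -> {for x, continuous f}.
Proof. exact: differentiable_continuous. Qed.

Lemma diff_affine (W : normedModType C) (a b : W) (z : C) :
  differentiable (fun w : C => a + w *: b) z.
Proof.
suff [//] : differentiable (fun w : C => a + w *: b) z /\ der (fun w : C => a + w *: b) z = b.
apply: nr_der => e e0; exists 1 => // h _.
by rewrite scalerDl [a + (_ + _)]addrA [a + _ + _]addrC addrK subrr nr0 mulr_ge0 ?nr_ge0// ltW.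
Qed.

Lemma diff_comp_affine (V W : normedModType C) (f : V -> W) (a b : V) (z : C) :
  differentiable f (a + z *: b) -> differentiable (fun w : C => f (a + w *: b)) z.
Proof. by move=> df; apply: differentiable_comp => //; exact: diff_affine. Qed.

Lemma eps_real_derive (f : R -> R) (x d : R) :
  (forall e : R, 0 < e -> exists2 r : R, 0 < r &
    forall h, `|h| < r -> `|f (x + h) - f x - d * h| <= e * `|h|) ->
  is_derive x 1 f d.
Proof.
move=> hf.
have slin : linear (fun h : R => h *: d).
  by move=> u y w; rewrite scalerDl scalerA.
pose LM := GRing.isLinear.Build _ _ _ _ _ slin.
pose L : {linear R -> R} := HB.pack (fun h : R => h *: d) LM.
have cL : continuous L by apply: scalel_continuous.
have key : f \o shift x = cst (f x) + L +o_ (0 : R) id.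
  apply/eqaddoP => e e0; have [r r0 hr] := hf e e0; apply/nbhs_normP; exists r => //.
  move=> h; rewrite /ball_ /= sub0r normrN => /hr.
  rewrite !fctE /= (addrC h) /GRing.scale /= [h * d]mulrC.
  by rewrite opprD addrA.
have dE : 'd f x = L :> (R -> R) by exact: diff_unique.
have df : differentiable f x by apply/diff_locallyP; rewrite dE.
apply: DeriveDef; first exact/derivable1_diffP.
by rewrite deriveE// dE /= /GRing.scale /= mul1r.
Qed.

(* the real mean value theorem applied to the real part of a rotated function *)
Lemma mean_value_ineq (f : C -> C) (a h : C) (M : R) :
  (forall t : R, 0 <= t <= 1 -> differentiable f (a + cr t * h) /\
     nr (der f (a + cr t * h)) <= M) ->
  nr (f (a + h) - f a) <= M * nr h.
Proof.
move=> hf; have [u u1 hu] := rotate_real (f (a + h) - f a).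
pose p (t : R) : R := cre (u * f (a + cr t * h)).
pose dp (t : R) : R := cre (u * (h * der f (a + cr t * h))).
have dP (t : R) : 0 <= t <= 1 -> is_derive t 1 p (dp t).
  move=> /hf[df _]; apply: eps_real_derive => e e0.
  have h1 : 0 < nr h + 1 by rewrite ltr_wpDl ?nr_ge0.
  have e1 : 0 < e / (nr h + 1) by rewrite divr_gt0.
  have [d d0 hd] := der_nr df e1.
  exists (d / (nr h + 1)); first by rewrite divr_gt0.
  move=> k kd; rewrite /p /dp.
  have kd' : nr (cr k * h) < d.
    rewrite nrM nr_cr; apply: le_lt_trans (_ : `|k| * (nr h + 1) < d).
      by rewrite ler_wpM2l// lerDl.
    by rewrite -ltr_pdivlMr.
  have := hd _ kd'.
  have -> : a + cr t * h + cr k * h = a + cr (t + k) * h by rewrite crD; ring.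
  set X := _ - _ - _ => hX.
  have -> : cre (u * f (a + cr (t + k) * h)) - cre (u * f (a + cr t * h))
     - cre (u * (h * der f (a + cr t * h))) * k = cre (u * X).
    rewrite /X /GRing.scale /=.
    have -> : u * (f (a + cr (t + k) * h) - f (a + cr t * h) - cr k * h * der f (a + cr t * h))
      = u * f (a + cr (t + k) * h) - u * f (a + cr t * h) - cr k * (u * (h * der f (a + cr t * h))) by ring.
    by rewrite !creB [cre (cr k * _)]creM cre_r cim_r mul0r subr0 [k * _]mulrC.
  apply: le_trans (cre_le _) _; rewrite nrM u1 mul1r; apply: le_trans hX _.
  rewrite nrM nr_cr.
  have -> : e / (nr h + 1) * (`|k| * nr h) = e * `|k| * (nr h / (nr h + 1)) by ring.
  apply: ler_piMr; first by rewrite mulr_ge0// ltW.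
  by rewrite ler_pdivrMr// mul1r lerDl.
have cp : {within `[0, 1], continuous p}.
  apply: derivable_within_continuous => t; by rewrite in_itv /= => /dP[].
have [||t t01] := @MVT_segment R p dp 0 1 _ _ cp; first exact: ler01.
  by move=> t; rewrite in_itv /= => /andP[t0 t1]; apply: dP; rewrite !ltW.
rewrite subr0 mulr1 => pE.
have <- : p 1 - p 0 = nr (f (a + h) - f a).
  by rewrite /p cr1 cr0 mul1r mul0r addr0 -creB -mulrBr hu cre_r.
rewrite pE /dp; apply: le_trans (cre_le_nr _) _; rewrite !nrM u1 mul1r mulrC.
apply: ler_wpM2r; first exact: nr_ge0.
by have [] := hf t t01.
Qed.

End LocalFacts.

(** * Means over circles *)

Section CircleMean.
Variable R : realType.
Local Notation C := (Cplx R).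
Implicit Types (phi psi : C -> C).

Definition circ (t : R) : C := cexp (ci R * cr (2 * pi * t)).

Lemma nr_circ t : nr (circ t) = 1.
Proof.
by rewrite /circ nr_cexp creM cre_i cim_i cim_r mul0r mulr0 subrr expR0.
Qed.

Definition cmean phi : C := dint 0 (fun t => phi (circ t)) 0.

Definition cbounded phi := exists M : R, forall z : C, nr z = 1 -> nr (phi z) <= M.

Lemma cbounded_dbnd phi a h : cbounded phi -> dbnd (fun t => phi (circ t)) a h.
Proof. by move=> [M hM]; exists M => t _; apply: hM; exact: nr_circ. Qed.

Lemma cmean_ext phi psi : (forall z, nr z = 1 -> phi z = psi z) -> cmean phi = cmean psi.
Proof. by move=> h; apply: dint_ext => t _; apply: h; exact: nr_circ. Qed.

Lemma cmeanD phi psi : cbounded phi -> cbounded psi ->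
  cmean (fun z => phi z + psi z) = cmean phi + cmean psi.
Proof.
by move=> b1 b2; apply: dintD; exact: cbounded_dbnd.
Qed.

Lemma cmeanZ (c : C) phi : cbounded phi -> cmean (fun z => c * phi z) = c * cmean phi.
Proof. by move=> b; apply: dintZ; exact: cbounded_dbnd. Qed.

Lemma cboundedD phi psi : cbounded phi -> cbounded psi -> cbounded (fun z => phi z + psi z).
Proof.
move=> [M hM] [N hN]; exists (M + N) => z z1; apply: le_trans (nrD _ _) _.
by apply: lerD; [exact: hM|exact: hN].
Qed.

Lemma cboundedM phi psi : cbounded phi -> cbounded psi -> cbounded (fun z => phi z * psi z).
Proof.
move=> [M hM] [N hN]; exists (M * N) => z z1; rewrite nrM.
by apply: ler_pM; rewrite ?nr_ge0//; [exact: hM|exact: hN].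
Qed.

Lemma cbounded_cst (c : C) : cbounded (fun=> c).
Proof. by exists (nr c). Qed.

Lemma cmeanB phi psi : cbounded phi -> cbounded psi ->
  cmean (fun z => phi z - psi z) = cmean phi - cmean psi.
Proof.
move=> b1 b2; have e : (fun z => phi z - psi z) = (fun z => phi z + (-1) * psi z).
  by apply/funext => z; rewrite mulN1r.
rewrite e cmeanD// ?cmeanZ ?mulN1r//.
by apply: cboundedM => //; exact: cbounded_cst.
Qed.

Lemma mesh0 : mesh R 0 = 1. Proof. by rewrite /mesh expr0. Qed.

Lemma cmean_cst (c : C) : cmean (fun=> c) = c.
Proof. by rewrite /cmean dint_cst mesh0 cr1 mul1r. Qed.

Lemma cmean_bound phi (M : R) : (forall z, nr z = 1 -> nr (phi z) <= M) ->
  nr (cmean phi) <= M.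
Proof.
move=> h; rewrite -[M]mul1r -mesh0; apply: dint_bound => t _; apply: h; exact: nr_circ.
Qed.

Lemma cmean_re phi (M : R) : cbounded phi -> (forall z, nr z = 1 -> cre (phi z) <= M) ->
  cre (cmean phi) <= M.
Proof.
move=> b h; rewrite -[M]mul1r -mesh0; apply: dint_re; first exact: cbounded_dbnd.
by move=> t _; apply: h; exact: nr_circ.
Qed.

Lemma circle_bounded (g : C -> C) (c : C) (t : R) : 0 <= t ->
  (forall z, nr (z - c) = t -> {for z, continuous g}) ->
  cbounded (fun z => g (c + cr t * z)).
Proof.
move=> t0 cg.
have cS : compact [set z : C | nr (z - c) = t].
  apply: (subclosed_compact (@closed_nr_sphere _ _ c t) (@compact_disc _ c t)).
  by move=> z /= ->.
have [M hM] := compact_bounded cS cg; exists M => z z1; apply: hM => /=.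
by rewrite addrC addKr nrM z1 mulr1 nr_cr ger0_norm.
Qed.

Lemma cmean_dint phi : cmean phi = dint 0 (fun t => phi (circ t)) 0.
Proof. by []. Qed.

#[global] Opaque cmean.

(** The map [z -> s exp (2 pi z)] wraps the rectangle of sides [kap] and [1] around the annulus and
    carries [dz] to [dzeta / (2 pi zeta)]. In Goursat's theorem the horizontal sides cancel by
    periodicity of the exponential, and the vertical ones are the two means. *)
Lemma cmean_annulus_lt (h : C -> C) (s t : R) : 0 < s -> s < t ->
  (forall z, s <= nr z <= t -> differentiable h z) ->
  cmean (fun z => h (cr s * z)) = cmean (fun z => h (cr t * z)).
Proof.
move=> s0 st dh.
have t0 : 0 < t by apply: lt_trans st.
have p0 : 0 < 2 * pi :> R by rewrite mulr_gt0// pi_gt0.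
have p1 : 2 * pi != 0 :> R by rewrite gt_eqF.
pose kap := ln (t / s) / (2 * pi).
have kap0 : 0 <= kap.
  by rewrite divr_ge0 ?(ltW p0)// ln_ge0// ler_pdivlMr// mul1r ltW.
pose H (z : C) := h (cr s * cexp (cr (2 * pi) * z)).
have nE x y : nr (cr s * cexp (cr (2 * pi) * grid kap x y)) = s * expR (x * ln (t / s)).
  rewrite nrM nr_cr (gtr0_norm s0) nr_cexp creM cre_r cim_r mul0r subr0 /grid cre_cartesian /kap.
  by congr (_ * expR _); rewrite mulrA [2 * pi * _]mulrC divfK// mulrC.
have ts0 : 0 < t / s by rewrite divr_gt0.
have range x y : 0 <= x <= 1 -> s <= nr (cr s * cexp (cr (2 * pi) * grid kap x y)) <= t.
  move=> /andP[x0 x1]; rewrite nE; have l0 : 0 <= ln (t / s).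
    by rewrite ln_ge0// ler_pdivlMr// mul1r ltW.
  apply/andP; split.
    by rewrite ler_pMr// -expR0 ler_expR mulr_ge0.
  rewrite mulrC -ler_pdivlMr// -[leRHS]lnK ?posrE// ler_expR.
  by rewrite ler_piMl.
have dH x y : 0 <= x <= 1 -> 0 <= y <= 1 -> differentiable H (grid kap x y).
  move=> hx hy.
  have e : H = h \o (fun z => cr s * cexp (cr (2 * pi) * z)) by [].
  rewrite e; apply: differentiable_comp; last exact/dh/range.
  apply: differentiableM; first exact: differentiable_cst.
  have -> : (fun z : C => cexp (cr (2 * pi) * z)) = @cexp R \o (fun z => 0 + z *: cr (2 * pi)).
    by apply/funext => z; rewrite /= add0r /GRing.scale /= mulrC.
  by apply: differentiable_comp; [exact: diff_affine|exact: cexp_diff].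
have cA : compact [set z : C | s <= nr z <= t].
  apply: (subclosed_compact _ (@compact_disc _ 0 t)).
    rewrite -openC; apply: open_nr => z /= /negP; rewrite negb_and -!ltNge => /orP[zs|zt].
      exists (s - nr z); first by rewrite subr_gt0.
      move=> y yz /= /andP[h1 _].
      have := nr_lb_dist (y : C) z; lra.
    exists (nr z - t); first by rewrite subr_gt0.
    move=> y yz /= /andP[_ h1].
    have := nr_lb_dist z (y : C); rewrite nr_distC; lra.
  by move=> z /= /andP[_]; rewrite subr0.
have [M hM] := compact_bounded cA (fun z hz => diff_cont (dh z hz)).
have bH x y : 0 <= x <= 1 -> 0 <= y <= 1 -> nr (H (grid kap x y)) <= M.
  by move=> hx hy; apply: hM => /=; exact: range.
have := contour_vanishes kap0 dH bH; rewrite /contour mesh0 add0r.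
have -> : (fun u => H (grid kap u 1)) = (fun u => H (grid kap u 0)).
  apply/funext => u; rewrite /H; congr h; congr (_ * _).
  have -> : cr (2 * pi) * grid kap u 1 = cr (2 * pi) * grid kap u 0 + ci R * cr (2 * pi).
    by rewrite /grid cr0 cr1; ring.
  by rewrite cexpD cexp_2pii mulr1.
rewrite subrr mulr0 add0r => /eqP; rewrite !cmean_dint mulf_eq0 => /orP[/eqP i0|].
  by have := nr_ci R; rewrite i0 nr0 => /eqP; rewrite eq_sym oner_eq0.
rewrite subr_eq0 => /eqP e.
transitivity (dint 0 (fun v : R => H (grid kap 0 v)) 0).
  apply: dint_ext => v _; rewrite /H /circ; congr (h (_ * cexp _)).
  by rewrite /grid mulr0 cr0 crM; ring.
rewrite -e; apply: dint_ext => v _; rewrite /H /circ; congr h.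
have -> : cr (2 * pi) * grid kap 1 v = cr (ln (t / s)) + ci R * cr (2 * pi * v).
  rewrite /grid mulr1 mulrDr -crM {1}/kap; congr (cr _ + _); last by rewrite crM; ring.
  by rewrite mulrC divfK.
rewrite cexpD cexp_real lnK ?posrE// mulrA -crM; congr (cr _ * _).
by rewrite mulrC divfK// gt_eqF.
Qed.

Lemma cmean_annulus (h : C -> C) (r1 r2 s t : R) : 0 <= r1 ->
  r1 < s < r2 -> r1 < t < r2 ->
  (forall z, r1 < nr z < r2 -> differentiable h z) ->
  cmean (fun z => h (cr s * z)) = cmean (fun z => h (cr t * z)).
Proof.
move=> r0 /andP[s1 s2] /andP[t1 t2] dh.
have [st|ts|->//] := ltgtP s t.
  apply: cmean_annulus_lt => //; first by apply: le_lt_trans s1.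
  by move=> z /andP[z1 z2]; apply: dh; rewrite (lt_le_trans s1)//= (le_lt_trans z2).
apply/esym; apply: cmean_annulus_lt => //; first by apply: le_lt_trans t1.
by move=> z /andP[z1 z2]; apply: dh; rewrite (lt_le_trans t1)//= (le_lt_trans z2).
Qed.

(** The radius can be shrunk until [g] is within [e] of [g c]. Only continuity is asked at the
    centre, so that difference quotients can be averaged before they are known to be differentiable
    there. *)
Lemma cmean_value (g : C -> C) (c : C) (s t : R) : 0 < t < s ->
  {for c, continuous g} ->
  (forall z, 0 < nr (z - c) < s -> differentiable g z) ->
  cmean (fun z => g (c + cr t * z)) = g c.
Proof.
move=> /andP[t0 ts] cg dg; apply/eqP; rewrite -subr_eq0 -nr_eq0 eq_le nr_ge0 andbT.
apply/ler_addgt0Pl => e e0; rewrite addr0.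
have /nr_cont/(_ e e0)[d d0 hd] := cg.
have [r [r0 rt rd]] : exists r, [/\ 0 < r, r <= t & r < d].
  exists (Num.min (d / 2) t); split; first by rewrite lt_min t0 divr_gt0.
    by rewrite ge_min lexx orbT.
  by apply: (@le_lt_trans _ _ (d / 2)); rewrite ?ge_min ?lexx// ltr_pdivrMr// ltr_pMr// ltr1n.
have -> : cmean (fun z => g (c + cr t * z)) = cmean (fun z => g (c + cr r * z)).
  apply: (@cmean_annulus (fun z => g (c + z)) 0 s t r (lexx 0)); [by rewrite t0|by rewrite r0 (le_lt_trans rt)|].
  move=> z zs; have e1 : (fun z0 => g (c + z0)) = (fun z0 : C => g (c + z0 *: (1:C))).
    by apply/funext => w; rewrite /GRing.scale /= mulr1.
  rewrite e1; apply: diff_comp_affine; rewrite /GRing.scale /= mulr1.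
  by apply: dg; rewrite [c + z]addrC addrK.
have b z : nr z = 1 -> nr (g (c + cr r * z) - g c) <= e.
  move=> z1; apply/ltW/hd; rewrite addrC addKr nrM z1 mulr1 nr_cr gtr0_norm//.
have -> : (fun z => g (c + cr r * z)) = (fun z => (g (c + cr r * z) - g c) + g c).
  by apply/funext => z; rewrite subrK.
rewrite cmeanD; last 2 first.
- by exists e.
- exact: cbounded_cst.
by rewrite cmean_cst addrK; exact: cmean_bound.
Qed.

(** Passing from radius 1 to radius 2 halves the function but leaves the mean unchanged. *)
Lemma cmean_inv : cmean (fun z => z^-1) = 0.
Proof.
have b : cbounded (fun z => z^-1) by exists 1 => z z1; rewrite nrV z1 invr1.
have := @cmean_annulus_lt (fun z => z^-1) 1 2 ltr01 (ltr1n _ 2) _.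
have d z : 1 <= nr z <= 2 -> differentiable (fun z : C => z^-1) z.
  move=> /andP[z1 _]; apply: differentiable_Rinv; rewrite -nr_gt0; exact: lt_le_trans z1.
move=> /(_ d); rewrite cr1.
have -> : (fun z : C => (1 * z)^-1) = (fun z => z^-1) by apply/funext => z; rewrite mul1r.
have -> : (fun z : C => (cr 2 * z)^-1) = (fun z => (cr 2)^-1 * z^-1) by apply/funext => z; rewrite invfM.
rewrite cmeanZ// => /eqP; rewrite -subr_eq0 -{1}[cmean _]mul1r -mulrBl mulf_eq0 => /orP[|/eqP//].
rewrite -cr1 -crV -crB cr_eq0 => /eqP h; exfalso; move: h; lra.
Qed.

End CircleMean.

(** * Cauchy's formula and its consequences in one variable *)

Section OneVariableTheory.
Variable R : realType.
Local Notation C := (Cplx R).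
Implicit Types (g q : C -> C) (c z w : C) (s t M : R).

Lemma disc_circle_nr c t z : nr z = 1 -> 0 <= t -> nr (c + cr t * z - c) = t.
Proof. by move=> z1 t0; rewrite addrC addKr nrM z1 mulr1 nr_cr ger0_norm. Qed.

Lemma nr_addK c h : nr (c + h - c) = nr h.
Proof. by rewrite addrC addKr. Qed.

(** The difference quotient with its removable singularity at [c] filled in. *)
Definition slope g c z : C := if z == c then der g c else (g z - g c) / (z - c).

Lemma slope_cont g c : differentiable g c -> {for c, continuous (slope g c)}.
Proof.
move=> dg; apply/nr_cont => e e0.
have e2 : 0 < e / 2 by rewrite divr_gt0.
have [d d0 hd] := der_nr dg e2; exists d => // z zd.
rewrite /slope eqxx; case: eqVneq => [_|zc]; first by rewrite subrr nr0.
have zc0 : z - c != 0 by rewrite subr_eq0.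
have n0 : 0 < nr (z - c) by rewrite nr_gt0.
have := hd (z - c) zd; rewrite [c + _]addrC subrK /GRing.scale /=.
have -> : g z - g c - (z - c) * der g c = (z - c) * ((g z - g c) / (z - c) - der g c).
  by field.
rewrite nrM mulrC ler_pM2r// => h; apply: le_lt_trans h _.
by rewrite ltr_pdivrMr// ltr_pMr// ltr1n.
Qed.

Lemma slope_diff g c z : z != c -> differentiable g z -> differentiable (slope g c) z.
Proof.
move=> zc dg.
have n0 : 0 < nr (z - c) by rewrite nr_gt0 subr_eq0.
apply: (@diff_local _ _ _ (fun w => (g w - g c) * (w - c)^-1) _ _ _ n0).
  move=> w wz; rewrite /slope; case: eqVneq => // wc.
  by move: wz; rewrite wc nr_distC ltxx.
apply: differentiableM.
  by apply: differentiableB => //; exact: differentiable_cst.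
apply: differentiableV; last by rewrite subr_eq0.
by apply: differentiableB => //; exact: differentiable_cst.
Qed.

(** Cauchy's formula for the derivative: the mean value property of [slope g c], whose value at [c]
    is the derivative, where the term in [g c] drops out by [cmean_inv]. *)
Lemma der_cmean g c s t : 0 < t < s ->
  (forall z, nr (z - c) < s -> differentiable g z) ->
  der g c = cmean (fun z => g (c + cr t * z) * (cr t * z)^-1).
Proof.
move=> ts dg; have /andP[t0 t_s] := ts.
have dc : differentiable g c by apply: dg; rewrite subrr nr0 (lt_trans t0).
have ct : cr t != 0 by rewrite cr_eq0 gt_eqF.
have bg : cbounded (fun z => g (c + cr t * z)).
  by apply: circle_bounded => [|z zt]; [exact: ltW|apply: diff_cont; apply: dg; rewrite zt].
have bi : cbounded (fun z : C => (cr t * z)^-1).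
  exists (t^-1) => z z1; rewrite nrV nrM z1 mulr1 nr_cr gtr0_norm//.
have bj : cbounded (fun z : C => z^-1).
  by exists 1 => z z1; rewrite nrV z1 invr1.
have := @cmean_value R (slope g c) c s t ts (slope_cont dc).
rewrite {3}/slope eqxx => <-; last first.
  move=> z /andP[z0 zs]; apply: slope_diff; last exact: dg.
  by rewrite -subr_eq0 -nr_gt0.
transitivity (cmean (fun z => g (c + cr t * z) * (cr t * z)^-1 - g c / cr t * z^-1)).
  apply: cmean_ext => z z1.
  have z0 : z != 0 by rewrite -nr_gt0 z1.
  rewrite /slope -subr_eq0 addrC addKr mulf_eq0 (negPf ct) (negPf z0) /=.
  by field; rewrite ct z0.
rewrite cmeanB ?cmeanZ ?cmean_inv ?mulr0 ?subr0//.
  exact: cboundedM.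
by apply: cboundedM => //; exact: cbounded_cst.
Qed.

Lemma der_bound g c s t M : 0 < t < s ->
  (forall z, nr (z - c) < s -> differentiable g z) ->
  (forall z, nr (z - c) < s -> nr (g z) <= M) -> nr (der g c) <= M / t.
Proof.
move=> ts dg bg; have /andP[t0 t_s] := ts.
rewrite (der_cmean ts dg); apply: cmean_bound => z z1.
rewrite nrM nrV nrM z1 mulr1 nr_cr gtr0_norm//; apply: ler_wpM2r; first by rewrite invr_ge0 ltW.
by apply: bg; rewrite disc_circle_nr// ltW.
Qed.

(** Around each point of the half disc a disc of radius [s / 2] is available, so Cauchy's estimate
    on the radius [s / 4] bounds the derivative by [4 * M / s] along the segment. *)
Lemma lipschitz_disc g c s M x y : 0 < s ->
  (forall z, nr (z - c) < s -> differentiable g z) ->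
  (forall z, nr (z - c) < s -> nr (g z) <= M) ->
  nr (x - c) < s / 2 -> nr (y - c) < s / 2 ->
  nr (g y - g x) <= 4 * M / s * nr (y - x).
Proof.
move=> s0 dg bg xs ys.
have -> : y = x + (y - x) by rewrite addrC subrK.
rewrite [x + (y - x) - x]addrC addKr.
apply: mean_value_ineq => t /andP[t0 t1].
have zs : nr (x + cr t * (y - x) - c) < s / 2.
  have -> : x + cr t * (y - x) - c = cr (1 - t) * (x - c) + cr t * (y - c).
    by rewrite crB cr1; ring.
  apply: le_lt_trans (nrD _ _) _; rewrite !nrM !nr_cr !ger0_norm ?subr_ge0//.
  have [->|tn] := eqVneq t 0; first by rewrite subr0 mul1r mul0r addr0.
  have tp : 0 < t by rewrite lt_neqAle eq_sym tn.
  have : t * nr (y - c) < t * (s / 2) by rewrite ltr_pM2l.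
  have : (1 - t) * nr (x - c) <= (1 - t) * (s / 2) by rewrite ler_wpM2l ?subr_ge0// ltW.
  by move: (nr _) (nr _) => *; lra.
split; first by apply: dg; apply: lt_trans zs _; rewrite ltr_pdivrMr// ltr_pMr// ltr1n.
have -> : 4 * M / s = M / (s / 4) by field; rewrite gt_eqF.
have ss : 0 < s / 4 < s / 2 by apply/andP; split; lra.
apply: (der_bound ss) => z zz; [apply: dg|apply: bg]; 
  have := nr_dist_tri (x + cr t * (y - x)) z c; lra.
Qed.

(** Cauchy's formulas at [x] and [c] are subtracted on circles of the same radius [s / 8]: the
    Lipschitz constant [4 * M / s] divided by [s / 8] gives 32. *)
Lemma der_lipschitz g c s M x : 0 < s ->
  (forall z, nr (z - c) < s -> differentiable g z) ->
  (forall z, nr (z - c) < s -> nr (g z) <= M) ->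
  nr (x - c) < s / 4 ->
  nr (der g x - der g c) <= 32 * M / s ^+ 2 * nr (x - c).
Proof.
move=> s0 dg bg xs.
have ts : 0 < s / 8 < s / 2 by apply/andP; split; lra.
have nc : nr (c - c) < s / 4 by rewrite subrr nr0 divr_gt0.
have near y : nr (y - c) < s / 4 -> forall z, nr (z - y) < s / 2 -> nr (z - c) < s.
  by move=> yc z zy; have := nr_dist_tri y z c; lra.
have D y : nr (y - c) < s / 4 -> forall z, nr (z - y) < s / 2 -> differentiable g z.
  by move=> yc z zy; apply: dg; apply: near zy.
have s8 : 0 <= s / 8 by rewrite divr_ge0// ltW.
have Bi : cbounded (fun z : C => (cr (s / 8) * z)^-1).
  exists ((s / 8)^-1) => z z1; rewrite nrV nrM z1 mulr1 nr_cr ger0_norm//.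
have B y : nr (y - c) < s / 4 -> cbounded (fun z => g (y + cr (s / 8) * z) * (cr (s / 8) * z)^-1).
  move=> yc; apply: cboundedM => //; exists M => z z1; apply: bg; apply: (near _ yc).
  by rewrite disc_circle_nr//; lra.
rewrite (der_cmean ts (D x xs)) (der_cmean ts (D c nc)) -cmeanB; try exact: B.
apply: cmean_bound => z z1; rewrite -mulrBl nrM nrV nrM z1 mulr1 nr_cr ger0_norm//.
have -> : 32 * M / s ^+ 2 * nr (x - c) = 4 * M / s * nr (x - c) / (s / 8).
  by field; rewrite gt_eqF.
apply: ler_wpM2r; first by rewrite invr_ge0.
have -> : x - c = (x + cr (s / 8) * z) - (c + cr (s / 8) * z) by ring.
apply: (@lipschitz_disc g c s M) => //.
  by rewrite disc_circle_nr//; lra.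
have := nr_dist_tri x (x + cr (s / 8) * z) c; rewrite disc_circle_nr//; lra.
Qed.

Lemma der_subaffine g (a b : C) z : differentiable g z ->
  differentiable (fun w => g w - (a + w * b)) z /\ der (fun w => g w - (a + w * b)) z = der g z - b.
Proof.
move=> dg; apply: nr_der => e e0; have [d d0 hd] := der_nr dg e0.
exists d => // h /hd; rewrite /GRing.scale /=.
suff -> : g (z + h) - (a + (z + h) * b) - (g z - (a + z * b)) - h * (der g z - b) = g (z + h) - g z - h * der g z by [].
by ring.
Qed.

Lemma taylor2 g c s M h : 0 < s ->
  (forall z, nr (z - c) < s -> differentiable g z) ->
  (forall z, nr (z - c) < s -> nr (g z) <= M) -> nr h < s / 4 ->
  nr (g (c + h) - g c - h * der g c) <= 32 * M / s ^+ 2 * nr h ^+ 2.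
Proof.
move=> s0 dg bg hs.
pose k w := g w - (0 + w * der g c).
have -> : g (c + h) - g c - h * der g c = k (c + h) - k c by rewrite /k; ring.
rewrite expr2 mulrA; apply: mean_value_ineq => t /andP[t0 t1].
have th : nr (cr t * h) <= nr h.
  by rewrite nrM nr_cr ger0_norm// ler_piMl// nr_ge0.
have M0 : 0 <= M by apply: le_trans (nr_ge0 (g c)) (bg c _); rewrite subrr nr0.
have [|dk kE] := @der_subaffine g 0 (der g c) (c + cr t * h).
  by apply: dg; rewrite nr_addK; apply: le_lt_trans th _; lra.
split=> //; rewrite kE; apply: le_trans (der_lipschitz s0 dg bg _) _.
  by rewrite nr_addK; apply: le_lt_trans th hs.
rewrite nr_addK; apply: ler_wpM2l => //.
by apply: divr_ge0; [apply: mulr_ge0; rewrite ?ler0n|exact: sqr_ge0].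
Qed.

(** Differentiation under the mean: the quadratic remainder of [taylor2] depends only on [s] and
    [M], hence is uniform in [z]. *)
Lemma cmean_param_diff (phi : C -> C -> C) c s M : 0 < s ->
  (forall z mu, nr z = 1 -> nr (mu - c) < s -> differentiable (phi ^~ z) mu) ->
  (forall z mu, nr z = 1 -> nr (mu - c) < s -> nr (phi mu z) <= M) ->
  differentiable (fun mu => cmean (phi mu)) c.
Proof.
move=> s0 dphi bphi.
have cc : nr (c - c) < s by rewrite subrr nr0.
have M0 : 0 <= M by apply: le_trans (nr_ge0 _) (bphi 1 c (nr1 _) cc).
suff [//] : differentiable (fun mu => cmean (phi mu)) c /\
  der (fun mu => cmean (phi mu)) c = cmean (fun z => der (phi ^~ z) c).
apply: nr_der => e e0.
pose K := 32 * M / s ^+ 2.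
have K0 : 0 <= K by apply: divr_ge0; [apply: mulr_ge0; rewrite ?ler0n|exact: sqr_ge0].
exists (Num.min (s / 4) (e / (K + 1))).
  by rewrite lt_min !divr_gt0// ltr_wpDl.
move=> h; rewrite lt_min => /andP[h1 h2].
have B1 : cbounded (phi (c + h)).
  by exists M => z z1; apply: bphi => //; rewrite nr_addK; lra.
have B2 : cbounded (phi c) by exists M => z z1; apply: bphi.
have s2 : 0 < s / 2 < s by apply/andP; split; lra.
have B3 : cbounded (fun z => der (phi ^~ z) c).
  exists (M / (s / 2)) => z z1; apply: (der_bound s2) => w ws; [exact: dphi|exact: bphi].
have B4 : cbounded (fun z => h * der (phi ^~ z) c).
  by apply: cboundedM => //; exact: cbounded_cst.
have B5 : cbounded (fun z => phi (c + h) z - phi c z).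
  by case: B1 B2 => [N hN] [N' hN']; exists (N + N') => z z1; apply: le_trans (nrB _ _) _; rewrite lerD ?hN ?hN'.
rewrite /GRing.scale /= -(cmeanZ h B3) -cmeanB// -cmeanB//.
apply: cmean_bound => z z1.
apply: le_trans (@taylor2 (phi ^~ z) c s M h s0 (fun w => dphi z w z1) (fun w => bphi z w z1) h1) _.
rewrite -/K expr2 mulrA; apply: ler_wpM2r; first exact: nr_ge0.
have K1 : 0 < K + 1 by rewrite ltr_wpDl.
rewrite ltr_pdivlMr// in h2; apply: ltW; apply: le_lt_trans h2.
by rewrite mulrC; apply: ler_wpM2l; rewrite ?nr_ge0// lerDl.
Qed.

Lemma disc_bounded g c s t : t < s ->
  (forall z, nr (z - c) < s -> differentiable g z) ->
  exists M, forall z, nr (z - c) <= t -> nr (g z) <= M.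
Proof.
move=> ts dg; have [] := compact_bounded (@compact_disc R c t) (g := g).
  by move=> z /= zt; apply: diff_cont; apply: dg; apply: le_lt_trans ts.
by move=> M hM; exists M.
Qed.

Lemma der_diff g c s : 0 < s ->
  (forall z, nr (z - c) < s -> differentiable g z) -> differentiable (der g) c.
Proof.
move=> s0 dg.
have [|M hM] := @disc_bounded g c s (s / 2) _ dg; first by lra.
have s8 : 0 <= s / 8 by rewrite divr_ge0// ltW.
have s88 : 0 < s / 8 by rewrite divr_gt0.
pose phi mu z := g (mu + cr (s / 8) * z) * (cr (s / 8) * z)^-1.
apply: (@diff_local _ _ _ (fun mu => cmean (phi mu)) _ _ (s / 8)) => //.
  move=> y yc; apply/esym; apply: (@der_cmean g y (s / 2) (s / 8)).
    by apply/andP; split; lra.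
  by move=> z zy; apply: dg; have := nr_dist_tri y z c; lra.
have pos z mu : nr z = 1 -> nr (mu - c) < s / 8 -> nr (mu + cr (s / 8) * z - c) <= s / 2.
  move=> z1 mc; have := nr_dist_tri mu (mu + cr (s / 8) * z) c; rewrite disc_circle_nr//; lra.
apply: (@cmean_param_diff phi c (s / 8) (M * (s / 8)^-1) s88).
  move=> z mu z1 mc; apply: differentiableM; last exact: differentiable_cst.
  have -> : (fun m => g (m + cr (s / 8) * z)) = (fun m : C => g (cr (s / 8) * z + m *: (1 : C))).
    by apply/funext => m; rewrite /GRing.scale /= mulr1 addrC.
  apply: diff_comp_affine; rewrite /GRing.scale /= mulr1 addrC; apply: dg.
  by apply: le_lt_trans (pos _ _ z1 mc) _; lra.
move=> z mu z1 mc; rewrite nrM nrV nrM z1 mulr1 nr_cr ger0_norm//.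
by apply: ler_wpM2r; rewrite ?invr_ge0//; apply: hM; exact: pos.
Qed.

(** Removable singularity. Since [der g] is differentiable at [c], [g] has a second order expansion
    there, and its quadratic coefficient is the derivative of the slope. *)
Lemma slope_diff_center g c s : 0 < s ->
  (forall z, nr (z - c) < s -> differentiable g z) -> differentiable (slope g c) c.
Proof.
move=> s0 dg; have ddg := der_diff s0 dg.
have dc : differentiable g c by apply: dg; rewrite subrr nr0.
(* [E] is half of the second derivative at [c]. *)
have [E g2E] : exists E, der (der g) c = E + E.
  exists (der (der g) c / 2); rewrite -mulrDr -mulr2n -[2^-1 *+ 2]mulr_natl mulfV ?mulr1//.
suff [//] : differentiable (slope g c) c /\ der (slope g c) c = E.
apply: nr_der => e e0; have [d d0 hd] := der_nr ddg e0.
exists (Num.min d s); first by rewrite lt_min d0 s0.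
move=> h; rewrite lt_min => /andP[hd1 hs].
have [->|h0] := eqVneq h 0.
  by rewrite addr0 subrr scale0r subr0 !nr0 mulr0.
have n0 : 0 < nr h by rewrite nr_gt0.
rewrite {1}/slope -subr_eq0 [c + h - c]addrC addKr (negPf h0) /slope eqxx.
(* Up to a constant, [k] is the second order Taylor remainder. Its derivative is the first order
   remainder of [der g], so the mean value inequality bounds the increment of [k] by
   [e * nr h ^+ 2]. *)
pose k (w : C) := (g w - (0 + w * der g c)) - (w - c) * (w - c) * E.
have -> : (g (c + h) - g c) / h - der g c - h *: E = (k (c + h) - k c) / h.
  rewrite /k /GRing.scale /=; move: (g (c + h)) (g c) (der g c) => A B D.
  by field.
rewrite nrM nrV ler_pdivrMr//.
apply: mean_value_ineq => t /andP[t0 t1].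
have th : nr (cr t * h) <= nr h.
  by rewrite nrM nr_cr ger0_norm// ler_piMl// nr_ge0.
set w := c + cr t * h.
have ws : nr (w - c) < s by rewrite /w nr_addK; apply: le_lt_trans th hs.
suff [dk kE] : differentiable k w /\ der k w = der g w - der g c - (w - c) * (E + E).
  split=> //; rewrite kE -g2E; have := hd (w - c).
  rewrite {1}/w nr_addK => /(_ (le_lt_trans th hd1)); rewrite [c + _]addrC subrK.
  by move=> hh; apply: le_trans hh _; apply: ler_wpM2l; first exact: ltW.
have [dk1 k1E] := @der_subaffine g 0 (der g c) w (dg _ ws).
apply: nr_der => e' e'0; have e2 : 0 < e' / 2 by rewrite divr_gt0.
have [d' d'0 hd'] := der_nr dk1 e2.
have g20 : 0 < nr E + 1 by rewrite ltr_wpDl ?nr_ge0.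
exists (Num.min d' (e' / 2 / (nr E + 1))); first by rewrite lt_min d'0 !divr_gt0.
move=> r; rewrite lt_min => /andP[r1 r2].
have := hd' r r1; rewrite k1E /GRing.scale /= => hr.
rewrite [X in nr X](_ : _ = (g (w + r) - (0 + (w + r) * der g c) - (g w - (0 + w * der g c)) -
   r * (der g w - der g c)) - r * r * E); last first.
  by rewrite /k; move: (g (w + r)) (g w) (der g w) (der g c) => A B D F; ring.
apply: le_trans (nrB _ _) _.
have : nr (r * r * E) <= e' / 2 * nr r.
  rewrite !nrM mulrAC; apply: ler_wpM2r; first exact: nr_ge0.
  rewrite ltr_pdivlMr// in r2; apply: ltW; apply: le_lt_trans r2.
  by apply: ler_wpM2l; rewrite ?nr_ge0// lerDl.
by move: hr; move: (nr r) (nr _) (nr _) => *; lra.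
Qed.

End OneVariableTheory.

(** * Maximum principle, Schwarz lemma, identity theorem, weak Rado theorem *)

Section MaximumPrinciple.
Variable R : realType.
Local Notation C := (Cplx R).
Implicit Types (g q : C -> C) (c z w : C) (s t M : R).

Lemma diff_id z : differentiable (fun w : C => w) z.
Proof.
have -> : (fun w : C => w) = (fun w : C => 0 + w *: (1 : C)).
  by apply/funext => w; rewrite add0r /GRing.scale /= mulr1.
exact: diff_affine.
Qed.

Lemma diff_exp g z k : differentiable g z -> differentiable (fun w => g w ^+ k) z.
Proof.
move=> dg; elim: k => [|k IH].
  have -> : (fun w => g w ^+ 0) = (fun=> 1) by apply/funext => w; rewrite expr0.
  exact: differentiable_cst.
have -> : (fun w => g w ^+ k.+1) = (fun w => g w * g w ^+ k) by apply/funext => w; rewrite exprS.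
exact: differentiableM.
Qed.

Lemma cmean_id : cmean (fun z : C => z) = 0.
Proof.
have := @cmean_value R id 0 2 1 _ _ _.
have -> : (fun z : C => id (0 + cr 1 * z)) = (fun z => z).
  by apply/funext => z; rewrite cr1 mul1r add0r.
apply; first by rewrite ltr01 ltr1n.
  exact: cvg_id.
by move=> z _; exact: diff_id.
Qed.

Lemma nr_sqrD (a b : C) : nr (a + b) ^+ 2 = nr a ^+ 2 + 2 * cre (cconj a * b) + nr b ^+ 2.
Proof.
rewrite !nrc_sqr creD cimD creM.
have -> : cre (cconj a) = cre a by rewrite /cre /cconj; case: (a : R[i]).
have -> : cim (cconj a) = - cim a by rewrite /cim /cconj; case: (a : R[i]).
by ring.
Qed.

(* At a maximum [z1] of [|q| + eta |z - c|^2] with [q z1 <> 0], the mean value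
   property over a small circle gains [eta t^2], a contradiction. *)
Lemma max_principle q c s M : 0 < s -> 0 <= M ->
  (forall z, nr (z - c) <= s -> {for z, continuous q}) ->
  (forall z, nr (z - c) < s -> q z != 0 -> differentiable q z) ->
  (forall z, nr (z - c) = s -> nr (q z) <= M) ->
  forall z, nr (z - c) <= s -> nr (q z) <= M.
Proof.
move=> s0 M0 cq dq bq z0 z0s; rewrite leNgt; apply/negP => Mq.
(* The quadratic term costs at most half of the excess of [nr (q z0)] over [M], so a maximum point
   still has [nr (q z1) > M]; hence it lies inside the disc and [q] does not vanish there. *)
have [eta [eta0 etas]] : exists eta : R, 0 < eta /\ eta * s ^+ 2 = (nr (q z0) - M) / 2.
  have s20 : 0 < 2 * s ^+ 2 by rewrite mulr_gt0// exprn_gt0.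
  exists ((nr (q z0) - M) / (2 * s ^+ 2)); split; first by rewrite divr_gt0// subr_gt0.
  by field; rewrite gt_eqF.
pose T z := nr (q z) + eta * nr (z - c) ^+ 2.
have T0 z : nr (z - c) <= s -> eta * nr (z - c) ^+ 2 <= (nr (q z0) - M) / 2.
  move=> zs; rewrite -etas ler_pM2l// ler_pXn2r ?nnegrE ?nr_ge0//.
  exact: ltW.
have [||z1 z1s hz1] := @nr_EVT_max R C [set z : C | nr (z - c) <= s] T _ (@compact_disc R c s).
- by exists z0.
- move=> x xs e e0; have e2 : 0 < e / 2 by rewrite divr_gt0.
  have /nr_cont/(_ _ e2)[d d0 hd] := cq x xs.
  have k0 : 0 < eta * (2 * s) + 1.
    by rewrite ltr_wpDl//; apply: mulr_ge0; [exact: ltW|apply: mulr_ge0 => //; exact: ltW].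
  exists (Num.min d (e / 2 / (eta * (2 * s) + 1))); first by rewrite lt_min d0 !divr_gt0.
  move=> y ys; rewrite lt_min => /andP[/hd h1 h2].
  have -> : T y - T x = (nr (q y) - nr (q x)) + eta * (nr (y - c) - nr (x - c)) * (nr (y - c) + nr (x - c)).
    by rewrite /T; ring.
  apply: le_lt_trans (ler_normD _ _) _.
  have h3 : `|nr (q y) - nr (q x)| < e / 2 by apply: le_lt_trans (nr_dist_dist _ _) h1.
  suff : `|eta * (nr (y - c) - nr (x - c)) * (nr (y - c) + nr (x - c))| <= e / 2 by move=> *; lra.
  rewrite !normrM (gtr0_norm eta0) [`|nr _ + nr _|]ger0_norm ?addr_ge0 ?nr_ge0//.
  have h4 : `|nr (y - c) - nr (x - c)| <= nr (y - x).
    by apply: le_trans (nr_dist_dist _ _) _; rewrite opprB addrA subrK.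
  rewrite ltr_pdivlMr// in h2; apply: ltW; apply: le_lt_trans h2.
  apply: le_trans (_ : nr (y - x) * (eta * (2 * s)) <= _); last first.
    by apply: ler_wpM2l; [exact: nr_ge0|rewrite lerDl].
  rewrite mulrAC mulrC; apply: ler_pM => //.
    by rewrite mulr_ge0 ?addr_ge0 ?nr_ge0// ltW.
  apply: ler_wpM2l; first exact: ltW.
  by move: ys xs => /=; lra.
have hT := hz1 z0 z0s; rewrite /= in z1s.
have q1 : M < nr (q z1).
  have := T0 _ z1s; move: hT; rewrite /T => h1 h2.
  have : 0 <= eta * nr (z0 - c) ^+ 2 by rewrite mulr_ge0 ?sqr_ge0// ltW.
  by move=> *; lra.
have qn : q z1 != 0 by rewrite -nr_gt0; exact: le_lt_trans q1.
have z1i : nr (z1 - c) < s.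
  rewrite lt_neqAle z1s andbT; apply/negP => /eqP /bq; rewrite leNgt q1 //.
have n0 : 0 < nr (q z1) by rewrite nr_gt0.
have /nr_cont/(_ _ n0)[d d0 hd] := cq z1 z1s.
pose r := Num.min d (s - nr (z1 - c)).
have r0 : 0 < r by rewrite lt_min d0 subr_gt0.
have near w : nr (w - z1) < r -> nr (w - c) < s /\ q w != 0.
  rewrite lt_min => /andP[/hd h1 h2]; split.
    by have := nr_dist_tri z1 w c; lra.
  apply/eqP => q0; move: h1; rewrite q0 sub0r nrN ltxx //.
pose t := r / 2.
have tr : 0 < t < r by rewrite /t; apply/andP; split; lra.
have /andP[t0 t_r] := tr.
have dq' w : nr (w - z1) < r -> differentiable q w by move=> /near[h1 h2]; exact: dq.
have mean := @cmean_value R q z1 r t tr (cq z1 z1s) (fun w hw => dq' w (proj2 (andP hw))).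
have [u u1 hu] := rotate_real (q z1).
set a := z1 - c in z1i.
(* [b * z] has mean zero and its real part is the cross term of [eta * nr (a + t z) ^+ 2]; adding it
   leaves exactly the gain [eta * t ^+ 2] at each point of the circle. *)
pose b := cr (2 * eta * t) * cconj a.
have Bq : cbounded (fun z => q (z1 + cr t * z)).
  apply: circle_bounded => [|w wt]; first exact: ltW.
  by apply: diff_cont; apply: dq'; rewrite wt.
have Bid : cbounded (fun z : C => z) by exists 1 => z ->.
have Bu : cbounded (fun z => u * q (z1 + cr t * z)) by apply: cboundedM => //; exact: cbounded_cst.
have Bb : cbounded (fun z => b * z) by apply: cboundedM => //; exact: cbounded_cst.
have val : cmean (fun z => u * q (z1 + cr t * z) + b * z) = cr (nr (q z1)).
  by rewrite cmeanD// !cmeanZ// mean cmean_id mulr0 addr0.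
have := @cmean_re R (fun z => u * q (z1 + cr t * z) + b * z) (nr (q z1) - eta * t ^+ 2) (cboundedD Bu Bb).
rewrite val cre_r => h.
have {h} : nr (q z1) <= nr (q z1) - eta * t ^+ 2.
  apply: h => z z1'; rewrite creD.
  have hq : cre (u * q (z1 + cr t * z)) <= nr (q (z1 + cr t * z)).
    by apply: le_trans (cre_le_nr _) _; rewrite nrM u1 mul1r.
  have wd : nr (z1 + cr t * z - z1) < r by rewrite disc_circle_nr// ltW.
  have [wc _] := near _ wd.
  have := hz1 _ (ltW wc); rewrite /T.
  have -> : z1 + cr t * z - c = a + cr t * z by rewrite /a; ring.
  rewrite -/a (nr_sqrD a (cr t * z)) (nrM (cr t) z) z1' mulr1 nr_cr (gtr0_norm t0).
  have -> : cconj a * (cr t * z) = cr t * (cconj a * z) by ring.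
  rewrite creM cre_r cim_r mul0r subr0.
  have -> : cre (b * z) = 2 * eta * t * cre (cconj a * z).
    by rewrite /b -mulrA creM cre_r cim_r mul0r subr0.
  move=> h2; clear -hq h2; move: (cre (u * _)) (nr (q (z1 + _))) (nr (q z1)) (nr a) (cre (cconj _ * _)) hq h2 => A B D E F h1 h2.
  lra.
have : 0 < eta * t ^+ 2 by rewrite mulr_gt0// exprn_gt0.
lra.
Qed.

(** The maximum principle for [slope g 0] on discs of radius [t < s], followed by [t -> s]. *)
Lemma schwarz g s M : 0 < s -> 0 <= M -> g 0 = 0 ->
  (forall z, nr z < s -> differentiable g z) ->
  (forall z, nr z < s -> nr (g z) <= M) ->
  forall z, nr z < s -> nr (g z) * s <= M * nr z.
Proof.
move=> s0 M0 g0 dg bg.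
have key z t : nr z < t -> t < s -> nr (g z) * t <= M * nr z.
  move=> zt ts; have t0 : 0 < t by apply: le_lt_trans zt; exact: nr_ge0.
  have [->|z0] := eqVneq z 0; first by rewrite g0 nr0 mul0r mulr0.
  have n0 : 0 < nr z by rewrite nr_gt0.
  have dS w : nr w < s -> differentiable (slope g 0) w.
    move=> ws; have [->|w0] := eqVneq w 0; last by apply: slope_diff => //; exact: dg.
    by apply: (@slope_diff_center _ _ _ s) => // v; rewrite subr0; exact: dg.
  have sE w : w != 0 -> slope g 0 w = g w / w.
    by move=> w0; rewrite /slope (negPf w0) g0 !subr0.
  have := @max_principle (slope g 0) 0 t (M / t) t0 _ _ _ _ z.
  rewrite subr0 sE// nrM nrV ler_pdivrMr// => h.
  rewrite -ler_pdivlMr//; rewrite mulrAC; apply: h; last exact: ltW.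
  - by rewrite divr_ge0// ltW.
  - by move=> w; rewrite subr0 => wt; apply: diff_cont; apply: dS; apply: le_lt_trans ts.
  - by move=> w; rewrite subr0 => wt _; apply: dS; apply: lt_trans ts.
  - move=> w; rewrite subr0 => wt; have w0 : w != 0 by rewrite -nr_gt0 wt.
    by rewrite sE// nrM nrV wt ler_wpM2r ?invr_ge0 ?(ltW t0)//; apply: bg; rewrite wt.
move=> z zs; rewrite leNgt; apply/negP => lt.
have gp : 0 < nr (g z).
  rewrite lt_neqAle nr_ge0 andbT eq_sym; apply/eqP => e.
  by move: lt; rewrite e mul0r ltNge mulr_ge0 ?nr_ge0.
(* A failure of the estimate at [s] means [M * nr z / nr (g z) < s]; any radius strictly between
   contradicts [key]. *)
pose t := (Num.max (nr z) (M * nr z / nr (g z)) + s) / 2.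
have m1 : Num.max (nr z) (M * nr z / nr (g z)) < s.
  by rewrite gt_max zs ltr_pdivrMr//= [s * _]mulrC.
have m2 : nr z <= Num.max (nr z) (M * nr z / nr (g z)) by rewrite le_max lexx.
have m3 : M * nr z / nr (g z) <= Num.max (nr z) (M * nr z / nr (g z)) by rewrite le_max lexx orbT.
have zt : nr z < t by rewrite /t; move: m1 m2 m3; move: (Num.max _ _) => *; lra.
have ts : t < s by rewrite /t; move: m1 m2 m3; move: (Num.max _ _) => *; lra.
have mt : M * nr z / nr (g z) < t by rewrite /t; move: m1 m2 m3; move: (M * nr z / nr (g z)) => X; move: (Num.max _ _) => *; lra.
have := key z t zt ts; move: mt; rewrite ltr_pdivrMr// [t * _]mulrC ltNge => /negP h; exact: h.
Qed.

Lemma expr_small (r e : R) : 0 <= r < 1 -> 0 < e -> exists k, r ^+ k < e.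
Proof.
move=> /andP[r0 r1] e0.
have /cvgrPdist_lt/(_ e e0)[N _ hN] : (fun k => r ^+ k) @ \oo --> (0 : R).
  by apply: cvg_expr; rewrite ger0_norm.
exists N; have := hN N (leqnn N); rewrite /= sub0r normrN ger0_norm// exprn_ge0//.
Qed.

(** As [g] vanishes near [0], [g v / v ^+ k] is holomorphic for every [k], and the convention
    [0^-1 = 0] is harmless. The maximum principle gives [nr (g z) <= M * (nr z / t) ^+ k], which
    tends to zero. *)
Lemma identity_disc g (s e : R) : 0 < e ->
  (forall z, nr z < s -> differentiable g z) ->
  (forall z, nr z < e -> g z = 0) ->
  forall z, nr z < s -> g z = 0.
Proof.
move=> e0 dg g0 z zs.
have [ze|ez] := ltP (nr z) e; first exact: g0.
pose t := (nr z + s) / 2.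
have zp : 0 < nr z by apply: lt_le_trans ez.
have zt : nr z < t by rewrite /t; lra.
have ts : t < s by rewrite /t; lra.
have t0 : 0 < t by apply: lt_trans zt.
have [|M hM] := @disc_bounded R g 0 s t ts; first by move=> w; rewrite subr0; exact: dg.
have M0 : 0 <= M by apply: le_trans (nr_ge0 (g 0)) (hM 0 _); rewrite subrr nr0 ltW.
have dq k w : nr w < s -> differentiable (fun v => g v * (v^-1) ^+ k) w.
  move=> ws; have [->|w0] := eqVneq w 0.
    apply: (@diff_local _ _ _ (fun=> 0) _ _ e e0); last exact: differentiable_cst.
    by move=> y; rewrite subr0 => /g0 ->; rewrite mul0r.
  apply: differentiableM; first exact: dg.
  by apply: diff_exp; apply: differentiable_Rinv.
have key k : nr (g z) <= M * (nr z / t) ^+ k.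
  have := @max_principle (fun v => g v * (v^-1) ^+ k) 0 t (M * (t^-1) ^+ k) t0 _ _ _ _ z.
  rewrite subr0 nrM nrX nrV => h.
  have : nr (g z) * (nr z)^-1 ^+ k <= M * t^-1 ^+ k.
    apply: h; last exact: ltW.
    - by rewrite mulr_ge0// exprn_ge0// invr_ge0 ltW.
    - by move=> w; rewrite subr0 => wt; apply: diff_cont; apply: dq; apply: le_lt_trans ts.
    - by move=> w; rewrite subr0 => wt _; apply: dq; apply: lt_trans ts.
    - move=> w; rewrite subr0 => wt; rewrite nrM nrX nrV wt ler_wpM2r ?exprn_ge0 ?invr_ge0 ?(ltW t0)//.
      by apply: hM; rewrite subr0 wt.
  by rewrite exprVn ler_pdivrMr ?exprn_gt0// exprMn mulrA mulrAC.
apply/eqP; rewrite -nr_eq0 eq_le nr_ge0 andbT leNgt; apply/negP => gp.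
have r01 : 0 <= nr z / t < 1.
  by rewrite divr_ge0 ?nr_ge0 ?(ltW t0)//= ltr_pdivrMr// mul1r.
have M1 : 0 < M + 1 by rewrite ltr_wpDl.
have [k hk] := expr_small r01 (divr_gt0 gp M1).
have := key k; rewrite leNgt => /negP; apply.
rewrite ltr_pdivlMr// in hk; apply: le_lt_trans hk; rewrite mulrC ler_wpM2l ?lerDl//.
by rewrite exprn_ge0//; case/andP: r01.
Qed.

Lemma prod_seq_cont (L : seq C) (h : C -> C -> C) z :
  (forall w, w \in L -> {for z, continuous (h w)}) ->
  {for z, continuous (fun v => \prod_(w <- L) h w v)}.
Proof.
elim: L => [|w L IH] hh.
  have -> : (fun v => \prod_(w <- [::]) h w v) = (fun=> 1) by apply/funext => v; rewrite big_nil.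
  exact: cst_continuous.
have -> : (fun v => \prod_(w <- w :: L) h w v) = (fun v => h w v * \prod_(w <- L) h w v).
  by apply/funext => v; rewrite big_cons.
have h1 : {for z, continuous (h w)} by apply: hh; rewrite inE eqxx.
have h2 := IH (fun v vL => hh v (mem_behead (s:=w :: L) vL)).
exact: (cvgM h1 h2).
Qed.

Lemma prod_seq_diff (L : seq C) (h : C -> C -> C) z :
  (forall w, w \in L -> differentiable (h w) z) ->
  differentiable (fun v => \prod_(w <- L) h w v) z.
Proof.
elim: L => [|w L IH] hh.
  have -> : (fun v => \prod_(w <- [::]) h w v) = (fun=> 1) by apply/funext => v; rewrite big_nil.
  exact: differentiable_cst.
have -> : (fun v => \prod_(w <- w :: L) h w v) = (fun v => h w v * \prod_(w <- L) h w v).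
  by apply/funext => v; rewrite big_cons.
apply: differentiableM; first by apply: hh; rewrite inE eqxx.
by apply: IH => v vL; apply: hh; rewrite inE vL orbT.
Qed.

Lemma circle_net (e : R) : 0 < e -> exists L : seq C,
  (forall w, w \in L -> nr w = 1) /\
  (forall z : C, nr z = 1 -> exists2 w, w \in L & nr (z - w) < e).
Proof.
move=> e0.
have cS : compact [set z : C | nr (z - 0) = 1].
  apply: (subclosed_compact (@closed_nr_sphere R C 0 1) (@compact_disc R 0 1)).
  by move=> z /= ->.
move: cS; rewrite compact_cover => /(_ C [set z | nr z = 1] (fun w => [set z | nr (z - w) < e])).
case.
- move=> w _; apply: open_nr => z /= zw; exists (e - nr (z - w)); first by rewrite subr_gt0.
  by move=> y yz; have := nr_dist_tri z (y : C) w; lra.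
- move=> z /=; rewrite subr0 => z1; exists z => //=; by rewrite subrr nr0.
move=> D DS cov; exists (finmap.enum_fset D); split.
  by move=> w wD; have := DS w wD; rewrite inE.
by move=> z z1; have [|w /= wD zw] := cov z; [rewrite /= subr0|exists w].
Qed.

(* A weak form of Rado's theorem: the product of finitely many rotations of [h]
   vanishes on the whole unit circle, hence at the centre. *)
Lemma weak_rado (h : C -> C) (e : R) : 0 < e ->
  (forall z, nr z <= 1 -> {for z, continuous h}) ->
  (forall z, nr z < 1 -> h z != 0 -> differentiable h z) ->
  (forall z, nr (z - 1) < e -> h z = 0) ->
  h 0 = 0.
Proof.
move=> e0 ch dh h0; have [L [L1 Lnet]] := circle_net e0.
pose H z := \prod_(w <- L) h (0 + z *: w^-1).
have rot z w : nr w = 1 -> nr (0 + z *: w^-1) = nr z.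
  by move=> w1; rewrite add0r nrM nrV w1 invr1 mulr1.
have := @max_principle H 0 1 0 ltr01 (lexx 0) _ _ _ 0.
rewrite subrr nr0 => hM.
have : nr (H 0) <= 0.
  apply: hM; last exact: ler01.
  - move=> z; rewrite subr0 => z1; apply: (@prod_seq_cont L (fun w z => h (0 + z *: w^-1))) => w wL.
    apply: (@continuous_comp _ _ _ (fun z : C => 0 + z *: w^-1) h).
      by apply: diff_cont; exact: diff_affine.
    by apply: ch; rewrite rot// L1.
  - move=> z; rewrite subr0 => z1 Hz; apply: (@prod_seq_diff L (fun w z => h (0 + z *: w^-1))) => w wL.
    apply: diff_comp_affine; apply: dh; first by rewrite rot// L1.
    by move: Hz; rewrite /H prodf_seq_neq0 => /allP/(_ w wL).
  - move=> z; rewrite subr0 => z1; have [w wL zw] := Lnet z z1.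
    suff -> : H z = 0 by rewrite nr0.
    apply/eqP; rewrite /H prodf_seq_eq0; apply/hasP; exists w => //=.
    have w1 := L1 w wL; have w0 : w != 0 by rewrite -nr_gt0 w1.
    rewrite h0//; have -> : 0 + z *: w^-1 - 1 = (z - w) / w by rewrite /GRing.scale /=; field.
    by rewrite nrM nrV w1 invr1 mulr1.
move=> H0; have : H 0 == 0 by rewrite -nr_eq0 eq_le H0 nr_ge0.
rewrite /H prodf_seq_eq0 => /hasP[w _ /=].
by rewrite scale0r addr0 => /eqP.
Qed.

End MaximumPrinciple.

(** * Convex and balanced domains *)

Section Sublinear.
Variables (R : realType) (V : normedModType (Cplx R)).
Local Notation C := (Cplx R).
Implicit Types (q r : V -> R) (x y v w : V).

Definition sublinear q :=
  (forall x y, q (x + y) <= q x + q y) /\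
  (forall (t : R) x, 0 <= t -> q (cr t *: x) = t * q x).

Lemma sublinear0 q : sublinear q -> q 0 = 0.
Proof. by move=> [_ h]; have := h 0 0 (lexx 0); rewrite scaler0 mul0r. Qed.

Lemma sublinear_opp q x : sublinear q -> - q (- x) <= q x.
Proof.
move=> sq; have [h _] := sq; have := h x (- x).
by rewrite subrr sublinear0// addrC => ?; rewrite lerNl; lra.
Qed.

(* the largest sublinear minorant of [q] that is linear on the line of [v] *)
Definition straighten q v x : R :=
  inf [set q (x + cr t *: v) - t * q v | t in [set t : R | 0 <= t]].

Section Straighten.
Variables (q : V -> R) (v : V).
Hypothesis sq : sublinear q.

Let S x := [set q (x + cr t *: v) - t * q v | t in [set t : R | 0 <= t]].

Let S_lb x : lbound (S x) (- q (- x)).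
Proof.
move=> _ [t /= t0 <-]; have [h1 h2] := sq.
have := h1 (x + cr t *: v) (- x); rewrite [x + _]addrC addrK h2//; lra.
Qed.

Let S_ne x : S x !=set0.
Proof. by eexists; exists 0 => //=. Qed.

Let S_ge x t : 0 <= t -> straighten q v x <= q (x + cr t *: v) - t * q v.
Proof. by move=> t0; apply: ge_inf; [exists (- q (- x)); exact: S_lb|exists t]. Qed.

Let S_le x (a : R) : (forall t, 0 <= t -> a <= q (x + cr t *: v) - t * q v) -> a <= straighten q v x.
Proof. by move=> h; apply: lb_le_inf; [exact: S_ne|move=> _ [t /= t0 <-]; exact: h]. Qed.

Lemma straighten_le x : straighten q v x <= q x.
Proof. by have := @S_ge x 0 (lexx 0); rewrite cr0 scale0r addr0 mul0r subr0. Qed.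

Lemma straighten_opp : straighten q v (- v) <= - q v.
Proof. by have := @S_ge (- v) 1 ler01; rewrite cr1 scale1r addNr sublinear0// mul1r sub0r. Qed.

Lemma straighten_sublinear : sublinear (straighten q v).
Proof.
have [h1 h2] := sq.
have hom (k : R) x : 0 < k -> straighten q v (cr k *: x) <= k * straighten q v x.
  move=> k0; rewrite -ler_pdivrMl//; apply: S_le => t t0; rewrite ler_pdivrMl//.
  apply: le_trans (@S_ge (cr k *: x) (k * t) _) _; first by rewrite mulr_ge0// ltW.
  by rewrite crM -scalerA -scalerDr h2 ?(ltW k0)// mulrBr mulrA.
split.
  move=> x y; rewrite -lerBlDr; apply: S_le => s s0.
  suff : straighten q v (x + y) - (q (x + cr s *: v) - s * q v) <= straighten q v y by move=> ?; lra.
  apply: S_le => t t0.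
  have := @S_ge (x + y) (s + t) (addr_ge0 s0 t0).
  have -> : x + y + cr (s + t) *: v = (x + cr s *: v) + (y + cr t *: v).
    by rewrite crD scalerDl addrACA.
  have := h1 (x + cr s *: v) (y + cr t *: v); rewrite mulrDl => *; lra.
move=> t x t0; have [->|tn] := eqVneq t 0.
  rewrite cr0 scale0r mul0r; apply/eqP; rewrite eq_le; apply/andP; split.
    by have := straighten_le 0; rewrite (sublinear0 sq).
  by apply: S_le => s s0; rewrite add0r h2// subrr.
have tp : 0 < t by rewrite lt_neqAle eq_sym tn.
apply/eqP; rewrite eq_le hom//= mulrC -ler_pdivlMr// mulrC.
have := @hom (t^-1) (cr t *: x); rewrite invr_gt0 => /(_ tp).
by rewrite scalerA -crM mulVf// cr1 scale1r.
Qed.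
End Straighten.

(** Straightening along [v] gives [q' (- v) <= - q v], and any smaller sublinear function inherits
    this; so directions already treated stay linear and a finite list can be handled by
    induction. *)
Lemma sublinear_straight q (L : seq V) : sublinear q ->
  exists r, [/\ sublinear r, forall x, r x <= q x & forall v, v \in L -> r (- v) = - r v].
Proof.
elim: L q => [|v L IH] q sq; first by exists q.
have [r [sr rq rL]] := IH _ (straighten_sublinear v sq).
exists r; split=> //.
  by move=> x; apply: le_trans (rq x) _; exact: straighten_le.
move=> w; rewrite inE => /orP[/eqP ->|]; last exact: rL.
apply/eqP; rewrite eq_le; apply/andP; split.
  apply: le_trans (rq _) _; apply: le_trans (straighten_opp v sq) _.
  by rewrite lerN2; apply: le_trans (rq v) _; exact: straighten_le.
by rewrite lerNl; exact: sublinear_opp.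
Qed.

Lemma straight_add r x y : sublinear r -> r (- x) = - r x -> r (- y) = - r y ->
  r (x + y) = r x + r y /\ r (- (x + y)) = - r (x + y).
Proof.
move=> sr hx hy; have [h1 h2] := sr.
have a1 := h1 x y; have a2 := h1 (- x) (- y); rewrite -opprD hx hy in a2.
have a3 := sublinear_opp (x + y) sr.
by split; lra.
Qed.

End Sublinear.

(** * Hahn-Banach in finite dimension *)

Section HahnBanach.
Variables (R : realType) (n : nat).
Local Notation C := (Cplx R).
Local Notation V := 'rV[C]_n.

Definition cnorm (p : V -> R) := exists c M : R, [/\ 0 < c, 0 < M,
  forall x y, p (x + y) <= p x + p y,
  forall (k : C) x, p (k *: x) = nr k * p x &
  forall x, p x <= c * nr x /\ nr x <= M * p x].

Definition clinear (l : V -> C) :=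
  (forall x y, l (x + y) = l x + l y) /\ (forall (k : C) x, l (k *: x) = k * l x).

(** Straightening [p] first along [w] fixes the value at [w]; straightening then along the basis
    vectors and [i] times them makes it real linear. The complex functional is [r x - i r (i x)],
    and rotating [x] turns the bound on [r] into a bound on the modulus. *)
Lemma hahn_banach (p : V -> R) (w : V) : cnorm p ->
  exists l, [/\ clinear l, forall x, nr (l x) <= p x & l w = cr (p w)].
Proof.
move=> [c [M [c0 M0 pD pZ pb]]].
have sp : sublinear p.
  by split=> // t x t0; rewrite pZ nr_cr ger0_norm.
pose L := [seq delta_mx ord0 j | j <- enum 'I_n] ++ [seq ci R *: delta_mx ord0 j | j <- enum 'I_n] : seq V.
have [r [sr rq rL]] := sublinear_straight L (straighten_sublinear w sp).
have rp x : r x <= p x by apply: le_trans (rq x) _; exact: straighten_le.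
have rw : r w = p w.
  apply/eqP; rewrite eq_le rp /=.
  apply: le_trans (_ : - r (- w) <= _); last exact: sublinear_opp.
  by rewrite lerNr; apply: le_trans (rq _) _; exact: straighten_opp.
have [rD rZ] := sr.
have scal v (a : R) : r (- v) = - r v ->
    r (cr a *: v) = a * r v /\ r (- (cr a *: v)) = - r (cr a *: v).
  move=> hv; have [a0|a0] := lerP 0 a.
    by rewrite -scalerN !rZ// hv mulrN.
  have na0 : 0 <= - a by rewrite oppr_ge0 ltW.
  have e1 : - (cr a *: v) = cr (- a) *: v by rewrite crN scaleNr.
  have e2 : cr a *: v = cr (- a) *: - v by rewrite crN scaleNr scalerN opprK.
  by rewrite e1 e2 !rZ// hv; split; ring.
have odd x : r (- x) = - r x.
  rewrite (row_sum_delta x).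
  apply: (@big_ind _ (fun y : V => r (- y) = - r y)).
  - by rewrite oppr0 sublinear0// oppr0.
  - by move=> y z hy hz; have [_] := straight_add sr hy hz.
  - move=> j _; rewrite [x ord0 j]cE scalerDl.
    have h1 : delta_mx ord0 j \in L by rewrite mem_cat map_f// mem_enum.
    have h2 : ci R *: delta_mx ord0 j \in L.
      by rewrite mem_cat (map_f (fun j => ci R *: delta_mx ord0 j)) ?orbT// mem_enum.
    rewrite [ci R * _]mulrC -scalerA.
    have [_ k1] := scal _ (cre (x ord0 j)) (rL _ h1).
    have [_ k2] := scal _ (cim (x ord0 j)) (rL _ h2).
    by have [_] := straight_add sr k1 k2.
have addr' x y : r (x + y) = r x + r y by have [] := straight_add sr (odd x) (odd y).
have scalr (a : R) x : r (cr a *: x) = a * r x by have [] := scal x a (odd x).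
pose l x : C := cr (r x) - ci R * cr (r (ci R *: x)).
have lD x y : l (x + y) = l x + l y.
  by rewrite /l scalerDr !addr' !crD; ring.
have li x : l (ci R *: x) = ci R * l x.
  rewrite /l scalerA ci2 scaleN1r odd crN mulrBr mulrA ci2; ring.
have lr (a : R) x : l (cr a *: x) = cr a * l x.
  have e : ci R *: (cr a *: x) = cr a *: (ci R *: x) by rewrite !scalerA mulrC.
  by rewrite /l e !scalr !crM; ring.
have lZ (k : C) x : l (k *: x) = k * l x.
  rewrite {1}[k]cE scalerDl [ci R * _]mulrC -scalerA lD !lr li {3}[k]cE; ring.
have lre x : cre (l x) = r x.
  by rewrite /l creB creM cre_i cim_r mul0r mulr0 subrr subr0.
have lb x : nr (l x) <= p x.
  have [u u1 hu] := rotate_real (l x).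
  have <- : r (u *: x) = nr (l x) by rewrite -lre lZ hu.
  by apply: le_trans (rp _) _; rewrite pZ u1 mul1r.
exists l; split=> //.
(* The modulus of [l w] is at most [p w], already reached by the real part, so the imaginary part is
   zero. *)
have lw : cre (l w) = p w by rewrite lre.
have im0 : cim (l w) = 0.
  have := lb w; rewrite -(ler_pXn2r (n:=2)) ?nnegrE ?nr_ge0//; last first.
    by apply: le_trans (lb w); exact: nr_ge0.
  rewrite nrc_sqr lw gerDl => h; apply/eqP; rewrite -sqrf_eq0 eq_le h sqr_ge0 //.
by rewrite [l w]cE lw im0 cr0 mulr0 addr0.
Qed.

Lemma clinear_diff (l : V -> C) (k : R) x : clinear l -> (forall x, nr (l x) <= k * nr x) ->
  differentiable l x.
Proof.
move=> [lD lZ] lb.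
have slin : linear (l : V -> C) by move=> a y z; rewrite lD lZ.
pose LM := GRing.isLinear.Build _ _ _ _ _ slin.
pose f : {linear V -> C} := HB.pack l LM.
have fl : f = l :> (V -> C) by [].
have k1 : 0 < `|k| + 1 by rewrite ltr_wpDl.
have cf : continuous f.
  move=> y; apply/nr_cont => e e0; exists (e / (`|k| + 1)); first by rewrite divr_gt0.
  move=> z; rewrite ltr_pdivlMr// => h; rewrite -linearB fl; apply: le_lt_trans (lb _) _.
  apply: le_lt_trans h; rewrite mulrC; apply: ler_wpM2l; first exact: nr_ge0.
  by apply: le_trans (ler_norm k) _; rewrite lerDl.
have [] := @nr_diff R V C l x f cf; last by [].
move=> e e0; exists 1 => // h _.
by rewrite lD fl [l x + _]addrC addrK subrr nr0 mulr_ge0 ?nr_ge0// ltW.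
Qed.

End HahnBanach.

(** * The Minkowski function is a norm *)

Section Minkowski.
Variables (R : realType) (n : nat).
Local Notation C := (Cplx R).
Local Notation V := 'rV[C]_n.
Variable Omega : set V.
Hypotheses (Odom : domain Omega) (Obnd : bounded_set Omega) (Obal : balanced Omega)
  (Oconv : Defs.convex Omega).

Let rho : V -> R := Defs.minkowski Omega.
Let A (z : V) := [set t : R | 0 < t /\ Omega (cr (t^-1) *: z)].

Lemma Omega0 : Omega 0.
Proof.
have [[x Ox] _ _] := Odom; have := @Obal 0 x; rewrite scale0r; apply => //.
by rewrite normr0 ler01.
Qed.

Lemma Omega_ball0 : exists2 e : R, 0 < e & forall z : V, nr z < e -> Omega z.
Proof.
have [_ oO _] := Odom; have [e e0 he] := nr_open oO Omega0.
by exists e => // z ze; apply: he; rewrite subr0.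
Qed.

Lemma balanced_nr (k : C) z : nr k <= 1 -> Omega z -> Omega (k *: z).
Proof. by move=> k1; apply: Obal; rewrite normE_nr lecR. Qed.

Let A_ne z : A z !=set0.
Proof.
have [e e0 he] := Omega_ball0.
exists ((nr z + 1) / e); split; first by rewrite divr_gt0// ltr_wpDl ?nr_ge0.
apply: he; have p : 0 < nr z + 1 by rewrite ltr_wpDl ?nr_ge0.
rewrite nrZ nr_cr invf_div gtr0_norm ?divr_gt0// mulrAC ltr_pdivrMr// ltr_pM2l//.
by rewrite ltrDl.
Qed.

Let A_lb z : lbound (A z) 0.
Proof. by move=> t [/ltW]. Qed.

Let mk_ge z (a : R) : (forall t : R, 0 < t -> Omega (cr t^-1 *: z) -> a <= t) -> a <= rho z.
Proof. by move=> h; apply: lb_le_inf; [exact: A_ne|move=> t [t0 ht]; exact: h]. Qed.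

Lemma mk_ge0 z : 0 <= rho z.
Proof. by apply: mk_ge => t /ltW. Qed.

Let mk_le z t : 0 < t -> Omega (cr (t^-1) *: z) -> rho z <= t.
Proof. by move=> t0 h; apply: ge_inf; [exists 0; exact: (@A_lb z)|split]. Qed.

Let mk_lt z t : rho z < t -> Omega (cr (t^-1) *: z).
Proof.
move=> h; have [s [s0 hs] st] := inf_lt (A_ne z) h.
have t0 : 0 < t by apply: lt_trans st.
have -> : cr (t^-1) *: z = cr (s / t) *: (cr (s^-1) *: z).
  by rewrite scalerA -crM mulrAC mulfV ?mul1r// gt_eqF.
apply: balanced_nr => //; rewrite nr_cr gtr0_norm ?divr_gt0//.
by rewrite ler_pdivrMr// mul1r ltW.
Qed.

Lemma mk_Omega z : Omega z <-> rho z < 1.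
Proof.
split; last by move=> /mk_lt; rewrite invr1 cr1 scale1r.
move=> Oz; have [_ oO _] := Odom; have [e e0 he] := nr_open oO Oz.
have p : 0 < nr z + 1 by rewrite ltr_wpDl ?nr_ge0.
(* Chosen so that [(1 + k) z] is still within [e] of [z]: openness makes the inequality [rho z < 1]
   strict. *)
pose k := e / (nr z + 1) / 2.
have k0 : 0 < k by rewrite !divr_gt0.
have t1 : (1 + k)^-1 < 1 by rewrite invf_lt1 ?ltrDl// addr_gt0.
apply: le_lt_trans t1; apply: mk_le; first by rewrite invr_gt0 addr_gt0.
rewrite invrK; apply: he; have -> : cr (1 + k) *: z - z = cr k *: z.
  by rewrite crD cr1 scalerDl scale1r addrC addKr.
rewrite nrZ nr_cr gtr0_norm//.
have kE : k * (nr z + 1) = e / 2 by rewrite /k; field; rewrite gt_eqF.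
by move: kE k0; rewrite mulrDr mulr1; lra.
Qed.

Lemma mkZ (k : C) z : rho (k *: z) = nr k * rho z.
Proof.
have le (a : C) x : a != 0 -> rho (a *: x) <= nr a * rho x.
  move=> a0; have n0 : 0 < nr a by rewrite nr_gt0.
  rewrite -ler_pdivrMl//; apply: mk_ge => t t0 ht.
  rewrite ler_pdivrMl//; apply: mk_le; first by rewrite mulr_gt0.
  have -> : cr (nr a * t)^-1 *: (a *: x) = (a / cr (nr a)) *: (cr (t^-1) *: x).
    by rewrite !scalerA invfM crM !crV; congr (_ *: _); ring.
  by apply: balanced_nr => //; rewrite nrM nrV nr_cr gtr0_norm// mulfV ?gt_eqF.
have [->|k0] := eqVneq k 0.
  rewrite scale0r nr0 mul0r; apply/eqP; rewrite eq_le mk_ge0 andbT.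
  apply/ler_addgt0Pl => e e0; rewrite addr0; apply: mk_le => //.
  by rewrite scaler0; exact: Omega0.
apply/eqP; rewrite eq_le le//=.
have kV : k^-1 != 0 by rewrite invr_eq0.
have := le _ (k *: z) kV; rewrite scalerA mulVf// scale1r nrV.
by rewrite mulrC ler_pdivlMr ?nr_gt0// mulrC.
Qed.

(** If [x / s] and [y / t] lie in [Omega], their convex combination with weights [s / (s + t)] and
    [t / (s + t)] is [(x + y) / (s + t)]. *)
Lemma mkD x y : rho (x + y) <= rho x + rho y.
Proof.
rewrite -lerBlDr; apply: mk_ge => s s0 hs.
suff : rho (x + y) - s <= rho y by move=> ?; lra.
apply: mk_ge => t t0 ht.
suff : rho (x + y) <= s + t by move=> ?; lra.
apply: mk_le; first by rewrite addr_gt0.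
have st0 : 0 < s + t by rewrite addr_gt0.
have k0 : 0 <= cr (s / (s + t)) :> C by rewrite /cr ler0c divr_ge0// ltW.
have k1 : cr (s / (s + t)) <= 1 :> C.
  by rewrite -(cr1 R) /cr lecR ler_pdivrMr// mul1r lerDl ltW.
have := @Oconv (cr s^-1 *: x) (cr t^-1 *: y) (Itv01 k0 k1).
rewrite !inE => /(_ hs ht).
have -> : conv (Itv01 k0 k1) (cr s^-1 *: x : convex_lmodType V) (cr t^-1 *: y) =
  cr (s / (s + t)) *: (cr s^-1 *: x) + (1 - cr (s / (s + t))) *: (cr t^-1 *: y) by [].
rewrite !scalerA.
have e1 : cr (s / (s + t)) * cr s^-1 = cr ((s + t)^-1).
  by rewrite -crM mulrAC mulfV ?mul1r// gt_eqF.
have e2 : (1 - cr (s / (s + t))) * cr t^-1 = cr ((s + t)^-1).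
  rewrite -(cr1 R) -crB -crM; congr cr; field; apply/andP; split.
    by rewrite gt_eqF// addr_gt0.
  by rewrite gt_eqF.
by rewrite e1 e2 -scalerDr.
Qed.

Lemma mk_cnorm : cnorm rho.
Proof.
have [e e0 he] := Omega_ball0.
have [M0 [M0r hM]] := Obnd.
pose M := cre M0 + 1.
have hM' z : Omega z -> nr z <= M.
  move=> Oz; rewrite -lecR -normE_nr; apply: hM => //.
  rewrite /M -(RRe_real M0r) -[X in X < _]/(cr (cre M0)) ltcR ltrDl ltr01 //.
have M1 : 0 <= M by apply: le_trans (hM' 0 Omega0); exact: nr_ge0.
exists (2 / e), (M + 1); split.
- by rewrite divr_gt0.
- by rewrite ltr_wpDl.
- exact: mkD.
- exact: mkZ.
move=> x; split.
  have [->|x0] := eqVneq x 0.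
    have := mkZ 0 0; rewrite scale0r nr0 mul0r => ->; by rewrite nr0 mulr0.
  have n0 : 0 < nr x by rewrite nr_gt0.
  have := mk_Omega (cr (e / 2 / nr x) *: x); rewrite mkZ nr_cr gtr0_norm; last by rewrite !divr_gt0.
  move=> [+ _]; rewrite -ltr_pdivlMl ?divr_gt0// mulr1 invf_div => h.
  have -> : 2 / e * nr x = nr x / (e / 2) by field; rewrite gt_eqF.
  apply/ltW/h; apply: he; rewrite nrZ nr_cr gtr0_norm; last by rewrite !divr_gt0.
  by rewrite divfK ?gt_eqF// ltr_pdivrMr// ltr_pMr// ltr1n.
have Mp : 0 < M + 1 by rewrite ltr_wpDl.
rewrite mulrC -ler_pdivrMr//; apply: mk_ge => t t0 /hM'.
rewrite nrZ nr_cr gtr0_norm ?invr_gt0// mulrC ler_pdivrMr// => h.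
by rewrite ler_pdivrMr// mulrC; apply: le_trans h _; rewrite ler_wpM2r ?lerDl// ltW.
Qed.

End Minkowski.

(** * The Schwarz lemma in the complement of a compact set *)

Section Dimension.
Variables (R : realType) (n : nat).
Hypothesis hn : (2 <= n)%N.
Local Notation C := (Cplx R).
Local Notation V := 'rV[C]_n.

Let i0 : 'I_n := Ordinal (ltnW hn).
Let i1 : 'I_n := Ordinal hn.
Let e0 : V := delta_mx ord0 i0.
Let e1 : V := delta_mx ord0 i1.

(** Supplies the direction of a complex line on which a norming functional is constant, hence which
    avoids a ball. *)
Lemma clinear_kernel (l : V -> C) : clinear l -> exists2 b : V, b != 0 & l b = 0.
Proof.
move=> [lD lZ]; have [l0|l0] := eqVneq (l e0) 0.
  exists e0 => //; apply/eqP => /matrixP/(_ ord0 i0); rewrite !mxE !eqxx /= => /eqP.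
  by rewrite oner_eq0.
exists (l e1 *: e0 + (- l e0) *: e1).
  apply/eqP => /matrixP/(_ ord0 i1); rewrite !mxE !eqxx /= mulr0 add0r mulr1 => /eqP.
  by rewrite oppr_eq0 (negPf l0).
by rewrite lD !lZ; ring.
Qed.

Lemma exists_indep (b : V) : exists v : V, forall k : C, v != k *: b.
Proof.
have [[k ek]|h] := pselect (exists k : C, e0 = k *: b); last first.
  by exists e0 => k; apply/eqP => ek; apply: h; exists k.
exists e1 => k'; apply/eqP => ek'.
move: (ek) => /matrixP/(_ ord0 i0); rewrite !mxE !eqxx /= => h1.
move: (ek) => /matrixP/(_ ord0 i1); rewrite !mxE !eqxx /= => /esym/eqP h2.
move: (ek') => /matrixP/(_ ord0 i1); rewrite !mxE !eqxx /= => h3.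
move: h2; rewrite mulf_eq0 => /orP[/eqP k0|/eqP b0].
  by move: h1; rewrite k0 mul0r => /eqP; rewrite oner_eq0.
by move: h3; rewrite b0 mulr0 => /eqP; rewrite oner_eq0.
Qed.

(** Used to move a base point slightly so that the complex line from it to [b] misses the origin. *)
Lemma near_indep (y b : V) (e : R) : 0 < e ->
  exists2 y', nr (y' - y) < e & forall k : C, y' != k *: b.
Proof.
move=> ep; have [v hv] := exists_indep b.
have [[k ek]|h] := pselect (exists k : C, y = k *: b); last first.
  exists y; first by rewrite subrr nr0.
  by move=> k; apply/eqP => ek; apply: h; exists k.
have v1 : 0 < nr v + 1 by rewrite ltr_wpDl ?nr_ge0.
pose d := e / (nr v + 1).
have d0 : 0 < d by rewrite divr_gt0.
exists (y + cr d *: v).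
  rewrite [y + _]addrC addrK nrZ nr_cr gtr0_norm// /d -ltr_pdivlMl ?divr_gt0//.
  by rewrite invf_div divfK ?gt_eqF// ltrDl.
move=> k'; apply/eqP => e'.
have /eqP := hv ((cr d)^-1 * (k' - k)); apply.
rewrite -scalerA scalerBl -e' -ek addrC addKr scalerA mulVf ?scale1r//.
by rewrite cr_eq0 gt_eqF.
Qed.

End Dimension.

Section CNormFacts.
Variables (R : realType) (n : nat).
Local Notation C := (Cplx R).
Local Notation V := 'rV[C]_n.
Variable p : V -> R.
Hypothesis hp : cnorm p.

Lemma cnD x y : p (x + y) <= p x + p y.
Proof. by have [c [M [_ _ h _ _]]] := hp. Qed.
Lemma cnZ (k : C) x : p (k *: x) = nr k * p x.
Proof. by have [c [M [_ _ _ h _]]] := hp. Qed.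
Lemma cnN x : p (- x) = p x.
Proof. by rewrite -scaleN1r cnZ nrN nr1 mul1r. Qed.
Lemma cn_ge0 x : 0 <= p x.
Proof.
have [c [M [c0 M0 _ _ h]]] := hp; have [_ h2] := h x.
by rewrite -(pmulr_rge0 _ M0); apply: le_trans h2; exact: nr_ge0.
Qed.
Lemma cn_gt0 x : x != 0 -> 0 < p x.
Proof.
have [c [M [c0 M0 _ _ h]]] := hp; have [_ h2] := h x.
by move=> x0; rewrite -(pmulr_rgt0 _ M0); apply: lt_le_trans h2; rewrite nr_gt0.
Qed.
Lemma cn_dist x y : p x - p y <= p (x - y).
Proof. by rewrite lerBlDr; apply: le_trans (cnD _ _); rewrite subrK. Qed.
Lemma cn_lip : exists2 c : R, 0 < c & forall x y, `|p x - p y| <= c * nr (x - y).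
Proof.
have [c [M [c0 M0 _ _ h]]] := hp; exists c => // x y.
have [h2 _] := h (x - y); apply: le_trans h2.
rewrite ler_norml cn_dist andbT lerNl opprB -(cnN (x - y)) opprB; exact: cn_dist.
Qed.
Lemma cn_cont x (e : R) : 0 < e -> exists2 d : R, 0 < d &
  forall y, nr (y - x) < d -> `|p y - p x| < e.
Proof.
move=> e0; have [c c0 hc] := cn_lip; exists (e / c); first by rewrite divr_gt0.
by move=> y; rewrite ltr_pdivlMr// mulrC; exact: le_lt_trans.
Qed.
End CNormFacts.

(** * The Cauchy kernel with pole at 1 *)

Section CauchyKernel.
Variable R : realType.
Local Notation C := (Cplx R).

(** Circle means integrate against [dw / (2 pi i w)], so the factor [w] turns this into Cauchy's
    kernel at the point [1]; the means of [ckern] itself are winding numbers around [1]. *)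
Definition ckern (w : C) : C := w / (w - 1).

Lemma ckern_diff (w : C) : w != 1 -> differentiable ckern w.
Proof.
move=> w1; apply: differentiableM; first exact: diff_id.
apply: differentiableV; last by rewrite subr_eq0.
by apply: differentiableB; [exact: diff_id|exact: differentiable_cst].
Qed.

Lemma nr_neq1 (w : C) : nr w != 1 -> w != 1.
Proof. by apply: contra_neq => ->; rewrite nr1. Qed.

Lemma ckern_bounded (s : R) : 0 < s -> s != 1 -> cbounded (fun z => ckern (cr s * z)).
Proof.
move=> s0 s1; exists (s / `|s - 1|) => z z1; rewrite nrM nrV nrM z1 mulr1 nr_cr gtr0_norm//.
apply: ler_wpM2l; first exact: ltW.
have s1' : 0 < `|s - 1| by rewrite normr_gt0 subr_eq0.
have h : `|s - 1| <= nr (cr s * z - 1).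
  by have := nr_dist_dist (cr s * z) 1; rewrite nrM z1 mulr1 nr_cr nr1 (gtr0_norm s0).
by rewrite lef_pV2 ?posrE//; apply: lt_le_trans h.
Qed.

Lemma cmean_ckern_lt1 (s : R) : 0 < s -> s < 1 -> cmean (fun z => ckern (cr s * z)) = 0.
Proof.
move=> s0 s1; have d w : nr (w - 0) < 1 -> differentiable ckern w.
  by rewrite subr0 => w1; apply: ckern_diff; apply: nr_neq1; rewrite lt_eqF.
have s01 : 0 < s < 1 by rewrite s0.
have cont : {for 0, continuous ckern} by apply: diff_cont; apply: d; rewrite subrr nr0 ltr01.
have dpunct z : 0 < nr (z - 0) < 1 -> differentiable ckern z by move=> /andP[_]; exact: d.
have k0 : ckern 0 = 0 by rewrite /ckern mul0r.
have <- : (fun z : C => ckern (0 + cr s * z)) = (fun z => ckern (cr s * z)).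
  by apply/funext => z; rewrite add0r.
exact: etrans (cmean_value s01 cont dpunct) k0.
Qed.

(** On circles of large radius [T] the kernel differs from [1] by [1 / (w - 1)]; [T = s + 1 / e]
    makes this at most [e]. *)
Lemma cmean_ckern_gt1 (s : R) : 1 < s -> cmean (fun z => ckern (cr s * z)) = 1.
Proof.
move=> s1; have s0 : 0 < s by apply: lt_trans s1.
apply/eqP; rewrite -subr_eq0 -nr_eq0 eq_le nr_ge0 andbT.
apply/ler_addgt0Pl => e e0; rewrite addr0.
pose T := s + e^-1.
have T1 : e^-1 < T - 1 by rewrite /T; lra.
have ei : 0 < e^-1 by rewrite invr_gt0.
have Tp : 1 < T by lra.
have -> : cmean (fun z => ckern (cr s * z)) = cmean (fun z => ckern (cr T * z)).
  apply: (@cmean_annulus R ckern 1 (T + 1) s T ler01).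
  - by apply/andP; split=> //; rewrite /T; lra.
  - by apply/andP; split=> //; lra.
  - by move=> w /andP[w1 _]; apply: ckern_diff; apply: nr_neq1; rewrite gt_eqF.
have T0 : 0 < T by lra.
rewrite -[X in _ - X](@cmean_cst R 1) -cmeanB; last 2 first.
- by apply: ckern_bounded => //; rewrite gt_eqF.
- exact: cbounded_cst.
apply: cmean_bound => z z1.
have nz : T - 1 <= nr (cr T * z - 1).
  by have := nr_lb_dist (cr T * z) 1; rewrite nrM z1 mulr1 nr_cr nr1 gtr0_norm.
have z0 : cr T * z - 1 != 0 by rewrite -nr_gt0; lra.
have -> : ckern (cr T * z) - 1 = (cr T * z - 1)^-1 by rewrite /ckern; field.
rewrite nrV -[e]invrK lef_pV2 ?posrE//; [lra|lra].
Qed.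

End CauchyKernel.

(** * Hartogs extension and the Schwarz estimate *)

Section HartogsSchwarz.
Variables (R : realType) (n : nat).
Hypothesis hn : (2 <= n)%N.
Local Notation C := (Cplx R).
Local Notation V := 'rV[C]_n.
Variables (p : V -> R) (K : set V) (r0 : R) (g : V -> C).
Hypothesis hp : cnorm p.
Hypotheses (r00 : 0 <= r0) (r01 : r0 < 1) (Kr0 : forall x, K x -> p x <= r0).
Let D : set V := [set x | p x < 1] `\` K.
Hypotheses (oD : open D) (cD : connected D) (D0 : D 0).
Hypothesis dg : forall x, D x -> differentiable g x.
Hypothesis bg : forall x, D x -> nr (g x) <= 1.
Hypothesis g0 : g 0 = 0.

Let shellD x : r0 < p x -> p x < 1 -> D x.
Proof. by move=> h1 h2; split=> // /Kr0; rewrite leNgt h1. Qed.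

(* Cauchy integral of [g] on the circle of radius [s] of the complex line of [x]: with
   [s > 1] it extends [g] holomorphically across the hole, and the difference of two
   such integrals, with [s > 1 > t], is [g] itself. *)
Let Iint (s : R) x : C := cmean (fun z => g ((cr s * z) *: x) * ckern (cr s * z)).

Let circD (s : R) x (z : C) : 0 < s -> r0 < s * p x < 1 -> nr z = 1 -> D ((cr s * z) *: x).
Proof.
move=> s0 /andP[h1 h2] z1; apply: shellD;
  by rewrite (cnZ hp) nrM z1 mulr1 nr_cr gtr0_norm.
Qed.

Let ray_diff x w : D (w *: x) -> differentiable (fun v : C => g (v *: x)) w.
Proof.
move=> Dw; have -> : (fun v : C => g (v *: x)) = (fun v : C => g (0 + v *: x)).
  by apply/funext => v; rewrite add0r.
by apply: diff_comp_affine; rewrite add0r; exact: dg.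
Qed.

Let Iint_bounded s x : 0 < s -> s != 1 -> r0 < s * p x < 1 ->
  cbounded (fun z => g ((cr s * z) *: x) * ckern (cr s * z)).
Proof.
move=> s0 s1 h; apply: cboundedM; last exact: ckern_bounded.
by exists 1 => z z1; apply: bg; exact: circD.
Qed.

(** Both circles lie in an annulus whose image is in the shell; the two cases keep the pole [1] of
    the kernel out of this annulus. *)
Let Iint_indep s t x : 0 < p x -> r0 < s * p x < 1 -> r0 < t * p x < 1 ->
  (0 < s < 1 /\ 0 < t < 1) \/ (1 < s /\ 1 < t) -> Iint s x = Iint t x.
Proof.
move=> px hs ht h.
have dI w : r0 < nr w * p x < 1 -> nr w != 1 ->
    differentiable (fun v : C => g (v *: x) * ckern v) w.
  move=> /andP[h1 h2] w1; apply: differentiableM; last exact/ckern_diff/nr_neq1.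
  by apply: ray_diff; apply: shellD; rewrite (cnZ hp).
case: h => [[/andP[s0 s1] /andP[t0 t1]]|[s1 t1]].
  apply: (@cmean_annulus R (fun v => g (v *: x) * ckern v) (r0 / p x) (Num.min 1 (p x)^-1) s t).
  - by rewrite divr_ge0// ltW.
  - by move/andP: hs => [h1 h2]; rewrite lt_min s1 ltr_pdivrMr// h1 -div1r ltr_pdivlMr.
  - by move/andP: ht => [h1 h2]; rewrite lt_min t1 ltr_pdivrMr// h1 -div1r ltr_pdivlMr.
  - move=> w; rewrite lt_min (ltr_pdivrMr _ _ px) -div1r (ltr_pdivlMr _ _ px) => /and3P[h1 h2 h3].
    by apply: dI; rewrite ?h1 ?h3// lt_eqF.
apply: (@cmean_annulus R (fun v => g (v *: x) * ckern v) (Num.max 1 (r0 / p x)) ((p x)^-1) s t).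
- by rewrite le_max ler01.
- by move/andP: hs => [h1 h2]; rewrite gt_max s1 ltr_pdivrMr// h1 -div1r ltr_pdivlMr.
- by move/andP: ht => [h1 h2]; rewrite gt_max t1 ltr_pdivrMr// h1 -div1r ltr_pdivlMr.
- move=> w; rewrite gt_max (ltr_pdivrMr _ _ px) -div1r (ltr_pdivlMr _ _ px) => /andP[/andP[h1 h2] h3].
  by apply: dI; rewrite ?h2 ?h3// gt_eqF.
Qed.

(** With [s] fixed, the integral is holomorphic along complex lines as a mean depending on a
    parameter. The second part lets a radius that varies with the point be frozen locally. *)
Let Iint_line s (a b : V) (mu : C) : 0 < s -> s != 1 -> r0 < s * p (a + mu *: b) < 1 ->
  differentiable (fun w : C => Iint s (a + w *: b)) mu /\
  exists2 d : R, 0 < d & forall w : C, nr (w - mu) < d -> r0 < s * p (a + w *: b) < 1.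
Proof.
move=> s0 s1 /andP[h1 h2].
pose e := Num.min (s * p (a + mu *: b) - r0) (1 - s * p (a + mu *: b)) / s.
have e0 : 0 < e by rewrite divr_gt0// lt_min !subr_gt0 h1.
have [d d0 hd] := cn_cont hp (a + mu *: b) e0.
have b1 : 0 < nr b + 1 by rewrite ltr_wpDl ?nr_ge0.
pose d' := d / (nr b + 1).
have d'0 : 0 < d' by rewrite divr_gt0.
have near w : nr (w - mu) < d' -> r0 < s * p (a + w *: b) < 1.
  rewrite ltr_pdivlMr// => wd.
  have := hd (a + w *: b); rewrite opprD addrACA subrr add0r -scalerBl nrZ => h.
  have {}h : `|p (a + w *: b) - p (a + mu *: b)| < e.
    apply: h; apply: le_lt_trans wd; apply: ler_wpM2l; first exact: nr_ge0.
    by rewrite lerDl.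
  have : `|s * p (a + w *: b) - s * p (a + mu *: b)| < e * s.
    by rewrite -mulrBr normrM gtr0_norm// mulrC ltr_pM2r.
  rewrite divfK ?gt_eqF// lt_min !ltr_norml => /andP[/andP[k1 k2] /andP[k3 k4]].
  by rewrite opprB ltrD2r in k1; rewrite ltrD2r in k4; rewrite k1.
split; last by exists d'.
have [B hB] := ckern_bounded s0 s1.
apply: (@cmean_param_diff R (fun w z => g ((cr s * z) *: (a + w *: b)) * ckern (cr s * z)) mu d' B d'0).
- move=> z w z1 wd; apply: differentiableM; last exact: differentiable_cst.
  have -> : (fun v : C => g ((cr s * z) *: (a + v *: b))) =
      (fun v : C => g ((cr s * z) *: a + v *: ((cr s * z) *: b))).
    by apply/funext => v; rewrite scalerDr !scalerA [v * _]mulrC.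
  apply: diff_comp_affine; apply: dg.
  have -> : (cr s * z) *: a + w *: ((cr s * z) *: b) = (cr s * z) *: (a + w *: b).
    by rewrite scalerDr !scalerA [w * _]mulrC.
  by apply: circD => //; exact: near.
- move=> z w z1 wd; rewrite nrM -[B]mul1r; apply: ler_pM; rewrite ?nr_ge0//; last exact: hB.
  by apply: bg; apply: circD => //; exact: near.
Qed.

(** Cauchy's formula for an annulus: [w * slope G 1 w] is holomorphic even at [w = 1], so its means
    on both circles agree. They are the two integrals, minus [g x] times the winding numbers 1 and
    0. *)
Let shell_residue x s t : 0 < t < 1 -> 1 < s -> r0 < t * p x -> s * p x < 1 ->
  Iint s x - g x = Iint t x.
Proof.
move=> /andP[t0 t1] s1 h1 h2.
have s0 : 0 < s by apply: lt_trans s1.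
have px : 0 < p x by rewrite -(pmulr_rgt0 _ t0); apply: le_lt_trans h1.
have x1 : r0 < p x by apply: lt_trans h1 _; rewrite gtr_pMl.
have x2 : p x < 1 by apply: lt_trans h2; rewrite ltr_pMl.
have ht : r0 < t * p x < 1.
  by rewrite h1 /=; apply: lt_trans x2; rewrite gtr_pMl.
have hs : r0 < s * p x < 1.
  by rewrite h2 andbT; apply: lt_trans x1 _; rewrite ltr_pMl.
pose G (v : C) := g (v *: x).
have dG w : r0 / p x < nr w < (p x)^-1 -> differentiable G w.
  rewrite ltr_pdivrMr// -div1r ltr_pdivlMr// => /andP[w1 w2].
  by apply: ray_diff; apply: shellD; rewrite (cnZ hp).
have dS w : r0 / p x < nr w < (p x)^-1 -> differentiable (slope G 1) w.
  move=> hw; have [->|w1] := eqVneq w 1; last by apply: slope_diff => //; exact: dG.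
  pose d := Num.min (1 - r0 / p x) ((p x)^-1 - 1).
  have d0 : 0 < d.
    by rewrite lt_min !subr_gt0 ltr_pdivrMr// mul1r x1 -div1r ltr_pdivlMr// mul1r.
  apply: (@slope_diff_center R G 1 d d0) => z; rewrite lt_min => /andP[k1 k2]; apply: dG.
  have := nr_lb_dist z (1 : C); have := nr_lb_dist (1 : C) z; rewrite nr_distC nr1 => k3 k4.
  by apply/andP; split; lra.
have E := @cmean_annulus R (fun w => w * slope G 1 w) (r0 / p x) ((p x)^-1) s t.
have qE (r : R) : 0 < r -> r != 1 -> r0 < r * p x < 1 ->
    cmean (fun z => (cr r * z) * slope G 1 (cr r * z)) = Iint r x - g x * cmean (fun z => ckern (cr r * z)).
  move=> rp r1 hr; rewrite -cmeanZ; last exact: ckern_bounded.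
  rewrite -cmeanB; last 2 first.
  - exact: Iint_bounded.
  - by apply: cboundedM; [exact: cbounded_cst|exact: ckern_bounded].
  apply: cmean_ext => z z1.
  have z2 : cr r * z != 1 by apply: nr_neq1; rewrite nrM z1 mulr1 nr_cr gtr0_norm.
  by rewrite /slope (negPf z2) /G scale1r /ckern; ring.
rewrite (qE s s0 (negbT (gt_eqF s1)) hs) (qE t t0 (negbT (lt_eqF t1)) ht) in E.
rewrite (cmean_ckern_gt1 s1) (cmean_ckern_lt1 t0 t1) mulr1 mulr0 subr0 in E; apply: E.
- by rewrite divr_ge0// ltW.
- by move/andP: hs => [k1 k2]; rewrite ltr_pdivrMr// k1 -div1r ltr_pdivlMr.
- by move/andP: ht => [k1 k2]; rewrite ltr_pdivrMr// k1 -div1r ltr_pdivlMr.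
- by move=> z hz; apply: differentiableM; [exact: diff_id|exact: dS].
Qed.

(** An inner radius: [sig y * p y] is the midpoint of [r0] and [Num.min 1 (p y)]. It also serves for
    [p y >= 1], since the line used for Liouville's argument leaves the unit ball of [p]. *)
Let sig (y : V) : R := (r0 + Num.min 1 (p y)) / 2 / p y.

Let sigP y : r0 < p y -> [/\ 0 < sig y < 1, r0 < sig y * p y < 1 & sig y * p y < 1].
Proof.
move=> h; have py : 0 < p y by apply: le_lt_trans h.
have m : r0 < Num.min 1 (p y) by rewrite lt_min r01.
have m1 : Num.min 1 (p y) <= 1 by rewrite ge_min lexx.
have m2 : Num.min 1 (p y) <= p y by rewrite ge_min lexx orbT.
have e : sig y * p y = (r0 + Num.min 1 (p y)) / 2 by rewrite /sig divfK// gt_eqF.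
have h1 : r0 < sig y * p y < 1 by rewrite e; apply/andP; split; lra.
split=> //; last by case/andP: h1.
have r00' := r00; rewrite /sig divr_gt0 ?ltr_pdivrMr//; lra.
Qed.

(* Liouville on a complex line that avoids the ball [p <= r0]: such a line through
   [x] exists by Hahn-Banach and because the dimension is at least two. *)
Let inner_vanishes x t : 0 < t < 1 -> r0 < t * p x < 1 -> Iint t x = 0.
Proof.
move=> /andP[t0 t1] ht.
have px : r0 < p x.
  by case/andP: ht => h _; apply: lt_le_trans h _; rewrite ler_piMl ?cn_ge0// ltW.
have [l [ll lb lx]] := hahn_banach x hp.
have [b b0 lb0] := clinear_kernel hn ll.
pose y (mu : C) := x + mu *: b.
have py mu : p x <= p (y mu).
  apply: le_trans (lb _); have [lD lZ] := ll.
  by rewrite /y lD lZ lb0 mulr0 addr0 lx nr_cr ler_norm.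
have py0 mu : r0 < p (y mu) by apply: lt_le_trans (py mu).
pose J mu := Iint (sig (y mu)) (y mu).
have JE mu s : 0 < s < 1 -> r0 < s * p (y mu) < 1 -> J mu = Iint s (y mu).
  move=> s01 hs; have [k1 k2 _] := sigP (py0 mu).
  by apply: Iint_indep => //; [apply: le_lt_trans (py0 mu)|left].
have dJ mu : differentiable J mu.
  have [k1 k2 _] := sigP (py0 mu); have /andP[k3 k4] := k1.
  have [dI [d d0 hd]] := @Iint_line (sig (y mu)) x b mu k3 (negbT (lt_eqF k4)) k2.
  apply: (diff_local d0 _ dI) => w /hd hw; apply/esym; exact: JE.
have pb : 0 < p b by apply: cn_gt0.
have <- : J 0 = Iint t x by rewrite (JE 0 t) ?t0 ?t1// /y scale0r addr0.
apply/eqP; rewrite -nr_eq0 eq_le nr_ge0 andbT.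
apply/ler_addgt0Pl => e e0; rewrite addr0.
(* On the circle of radius [T] one has [p (y w) >= 1 + 1 / e]. There [sig < 1 / p (y w)], so the
   kernel is at most [sig / (1 - sig) <= e], while [g] is bounded by 1. *)
pose T := (p x + 1 + e^-1) / p b.
have ei : 0 < e^-1 by rewrite invr_gt0.
have T0 : 0 < T by rewrite divr_gt0//; have := cn_ge0 hp x; lra.
have := @cmean_value R J 0 (T + 1) T _ (diff_cont (dJ 0)) (fun z _ => dJ z).
rewrite T0 ltrDl ltr01 => <-//.
apply: cmean_bound => z z1; rewrite add0r.
set w := cr T * z; have [k1 k2 _] := sigP (py0 w); have /andP[k3 k4] := k1.
apply: cmean_bound => v v1.
have P : 1 + e^-1 <= p (y w).
  have := cn_dist hp (w *: b) (- x); rewrite opprK (cnN hp) [w *: b + x]addrC -/(y w) (cnZ hp).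
  have -> : nr w * p b = p x + 1 + e^-1.
    by rewrite /w nrM z1 mulr1 nr_cr (gtr0_norm T0) /T divfK// gt_eqF.
  by move=> ?; lra.
have pp : 0 < p (y w) by lra.
have sm : sig (y w) < (p (y w))^-1 by rewrite -div1r ltr_pdivlMr//; case/andP: k2.
rewrite nrM -[e]mul1r; apply: ler_pM; rewrite ?nr_ge0//.
  by apply: bg; exact: circD.
rewrite /ckern nrM nrV nrM v1 mulr1 nr_cr gtr0_norm//.
have n1 : 1 - sig (y w) <= nr (cr (sig (y w)) * v - 1).
  rewrite nr_distC; have := nr_lb_dist (1 : C) (cr (sig (y w)) * v).
  by rewrite nr1 nrM v1 mulr1 nr_cr gtr0_norm.
have n2 : 0 < nr (cr (sig (y w)) * v - 1) by lra.
rewrite ler_pdivrMr//; apply: le_trans (_ : e * (1 - sig (y w)) <= _); last first.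
  by apply: ler_wpM2l => //; exact: ltW.
have : sig (y w) * (1 + e) <= e; last by rewrite mulrDr mulr1; lra.
have e1 : 0 < 1 + e by lra.
rewrite -ler_pdivlMr//; apply: ltW; apply: lt_le_trans sm _.
have -> : e / (1 + e) = (1 + e^-1)^-1 by field; rewrite !gt_eqF//= ; lra.
by rewrite lef_pV2 ?posrE//; lra.
Qed.

(** An outer radius, with [tau y * p y] halfway between [Num.max r0 (p y)] and 1. It is meaningless
    at [y = 0], so the extension [F] is used off the origin only. *)
Let tau (y : V) : R := (Num.max r0 (p y) + 1) / 2 / p y.

Let tauP y : 0 < p y < 1 -> [/\ 1 < tau y, r0 < tau y * p y < 1 & tau y != 1].
Proof.
move=> /andP[py p1].
have m : Num.max r0 (p y) < 1 by rewrite gt_max r01.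
have m1 : r0 <= Num.max r0 (p y) by rewrite le_max lexx.
have m2 : p y <= Num.max r0 (p y) by rewrite le_max lexx orbT.
have e : tau y * p y = (Num.max r0 (p y) + 1) / 2 by rewrite /tau divfK// gt_eqF.
have t1 : 1 < tau y by rewrite /tau ltr_pdivlMr// mul1r; lra.
by split=> //; [rewrite e; apply/andP; split; lra|rewrite gt_eqF].
Qed.

Let F (y : V) : C := Iint (tau y) y.

Let F_shell x : r0 < p x -> p x < 1 -> F x = g x.
Proof.
move=> h1 h2; have px : 0 < p x by apply: le_lt_trans h1.
have [|t1 t2 t3] := @tauP x; first by rewrite px.
have [s1 s2 s3] := sigP h1.
have /andP[s4 _] := s2; have /andP[_ t4] := t2.
have := shell_residue s1 t1 s4 t4; rewrite (inner_vanishes s1 s2) => /eqP.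
by rewrite subr_eq0 => /eqP.
Qed.

Let F_line (a b : V) (mu : C) : 0 < p (a + mu *: b) < 1 ->
  differentiable (fun w : C => F (a + w *: b)) mu.
Proof.
move=> /tauP[t1 t2 t3]; have t0 : 0 < tau (a + mu *: b) by apply: lt_trans t1.
have [dI [d d0 hd]] := Iint_line t0 t3 t2.
apply: (diff_local d0 _ dI) => w /hd hw.
have pw : 0 < p (a + w *: b) < 1.
  case/andP: hw => h1 h2; rewrite -(pmulr_rgt0 _ t0) (le_lt_trans _ h1)//=.
  apply: le_lt_trans h2; rewrite ler_peMl ?cn_ge0//; exact: ltW.
have [k1 k2 k3] := tauP pw.
by apply: Iint_indep => //; [case/andP: pw|right].
Qed.

Let Dp y : D y -> y != 0 -> 0 < p y < 1.
Proof. by move=> [y1 _] y0; rewrite cn_gt0. Qed.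

(** Equality on a whole neighbourhood makes the set open at once; the work is in showing that it is
    closed in [D]. *)
Let Z := [set x | D x /\ exists2 e : R, 0 < e & forall y, nr (y - x) < e -> y != 0 -> g y = F y].

Let Z_closed x : D x -> closure Z x -> Z x.
Proof.
move=> Dx clx; split=> //; have [s s0 hs] := nr_open oD Dx.
have s4 : 0 < s / 4 by rewrite divr_gt0.
have [|y [[Dy [e e0 he]] yx]] := clx [set y | nr (y - x) < s / 4].
  by apply/nbhs_nr; exists (s / 4).
rewrite /= in yx; exists (s / 4) => // b bx b0.
(* [b] will be reached from [y'] along a complex line; independence from [b] keeps that line away
   from the origin. *)
have [|y' y'y ind] := near_indep hn y b (e := Num.min e (s / 4 - nr (y - x))).
  by rewrite lt_min e0 subr_gt0.
rewrite lt_min in y'y; case/andP: y'y => y'e y'x.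
have y'x4 : nr (y' - x) < s / 4 := nr_near y'x.
have by' : nr (b - y') < s / 2.
  apply: le_lt_trans (nr_dist_tri x b y') _; rewrite (nr_distC x y').
  by rewrite [ltRHS](_ : _ = s / 4 + s / 4); [exact: ltrD|field].
(* The disc of radius [3 / 2] contains [w = 1], where [gam] is [b], and stays in [D] because
   [s / 4 + 3 / 2 * (s / 2) = s]. *)
pose gam (w : C) := y' + w *: (b - y').
have gD w : nr w < 3 / 2 -> D (gam w).
  move=> w1; apply: hs; rewrite /gam addrAC.
  apply: le_lt_trans (nrD _ _) _; rewrite nrZ.
  have : nr w * nr (b - y') <= 3 / 2 * (s / 2) by apply: ler_pM; rewrite ?nr_ge0// ltW.
  by rewrite [ltRHS](_ : _ = s / 4 + 3 / 2 * (s / 2)); [exact: ltr_leD|field].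
have gam0 w : gam w != 0.
  apply/eqP => gw; have [w1|w1] := eqVneq w 1.
    by move: gw b0; rewrite /gam w1 scale1r addrC subrK => ->; rewrite eqxx.
  have w1' : 1 - w != 0 by rewrite subr_eq0 eq_sym.
  have /eqP := ind ((1 - w)^-1 * (- w)); apply.
  have e1 : (1 - w) *: y' = (- w) *: b.
    apply/eqP; rewrite -subr_eq0 -gw /gam scalerBr scalerBl scale1r scaleNr opprK.
    by rewrite addrAC addrA.
  by rewrite -scalerA -e1 scalerA mulVf// scale1r.
pose h (w : C) := g (gam w) - F (gam w).
have dh w : nr w < 3 / 2 -> differentiable h w.
  move=> w1; apply: differentiableB.
    by apply: diff_comp_affine; apply: dg; exact: gD.
  by apply: F_line; apply: Dp; [exact: gD|exact: gam0].
have b'1 : 0 < nr (b - y') + 1 by rewrite ltr_wpDl ?nr_ge0.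
have e1 : 0 < (e - nr (y' - y)) / (nr (b - y') + 1) by rewrite divr_gt0// subr_gt0.
have h0 w : nr w < (e - nr (y' - y)) / (nr (b - y') + 1) -> h w = 0.
  rewrite ltr_pdivlMr// => w1; apply/eqP; rewrite subr_eq0; apply/eqP; apply: he; last exact: gam0.
  rewrite /gam addrAC; apply: le_lt_trans (nrD _ _) _; rewrite nrZ.
  have : nr w * nr (b - y') <= nr w * (nr (b - y') + 1) by rewrite ler_wpM2l ?nr_ge0// lerDl.
  by rewrite -ltrBrDl => h1; exact: le_lt_trans w1.
have := identity_disc e1 dh h0 (z := 1); rewrite nr1 => h1.
have {}h1 : h 1 = 0 by apply: h1; rewrite ltr_pdivlMr// mul1r ltr_nat.
have g1 : gam 1 = b by rewrite /gam scale1r addrC subrK.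
by move: h1; rewrite /h g1 => /eqP; rewrite subr_eq0 => /eqP.
Qed.

(** The set [Z] contains a point of the shell and is open and closed in [D], which is connected. *)
Let gF y : D y -> y != 0 -> g y = F y.
Proof.
move=> Dy y0; suff ZD : Z = D.
  have [_ [e e0 he]] : Z y by rewrite ZD.
  by apply: he => //; rewrite subrr nr0.
apply: cD.
- have := y0; rewrite -nr_gt0 => ny; have py := cn_gt0 hp y0.
  pose r1 := (r0 + 1) / 2; pose x := cr (r1 / p y) *: y.
  have r00' := r00; have r01' := r01.
  have r1p : 0 < r1 by rewrite /r1; lra.
  have px : p x = r1 by rewrite /x (cnZ hp) nr_cr gtr0_norm; [rewrite divfK// gt_eqF|rewrite divr_gt0].
  exists x; split; first by apply: shellD; rewrite px /r1; lra.
  have e0 : 0 < (1 - r0) / 2 by rewrite divr_gt0// subr_gt0.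
  have [d d0 hd] := cn_cont hp x e0; exists d => // w /hd.
  rewrite px /r1 ltr_norml => /andP[h1 h2] _; apply/esym; apply: F_shell; lra.
- exists [set x | exists2 e : R, 0 < e & forall y, nr (y - x) < e -> y != 0 -> g y = F y]; last first.
    by apply/seteqP; split.
  apply: open_nr => x [e e0 he]; exists (e / 2); first by rewrite divr_gt0.
  move=> w wx; exists (e / 2); first by rewrite divr_gt0.
  by move=> v vw v0; apply: he => //; have := nr_dist_tri w v x; lra.
- exists (closure Z); first exact: closed_closure.
  apply/seteqP; split=> x; last by move=> [Dx clx]; exact: Z_closed.
  by move=> Zx; split; [case: Zx|exact: subset_closure].
Qed.

(** On a circle of the line of [x] in the shell, [F = g] is bounded by 1; the maximum principle and
    the Schwarz lemma then apply to [F] on the whole disc, including the part over the hole. *)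
Lemma hartogs_schwarz x : D x -> nr (g x) <= p x.
Proof.
move=> Dx; have [->|x0] := eqVneq x 0; first by rewrite g0 nr0 cn_ge0.
have /andP[px p1] := Dp Dx x0.
rewrite leNgt; apply/negP => lt.
have gp : 0 < nr (g x) by apply: lt_trans lt.
(* The circle of radius [s] has [p]-norm [r] in [(m, 1)]: [r > r0] puts it in the shell, [r > p x]
   puts [1] inside it, and [r > p x / nr (g x)] contradicts the resulting bound
   [nr (g x) <= p x / r]. *)
pose m := Num.max r0 (Num.max (p x) (p x / nr (g x))).
have m1 : m < 1 by rewrite !gt_max r01 p1 ltr_pdivrMr// mul1r.
have m2 : r0 <= m by rewrite le_max lexx.
have m3 : p x <= m by rewrite !le_max lexx orbT.
have m4 : p x / nr (g x) <= m by rewrite !le_max lexx !orbT.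
pose r := (m + 1) / 2; pose s := r / p x.
have [rm r1] : m < r /\ r < 1 by rewrite /r; split; lra.
have rp : 0 < r by lra.
have s0 : 0 < s by rewrite divr_gt0.
have s1 : 1 < s by rewrite /s ltr_pdivlMr// mul1r; lra.
have sp : s * p x = r by rewrite /s divfK// gt_eqF.
(* Near [w = 0] this is [g (w x)] by [gF] and [g 0 = 0], so it is holomorphic at the centre as
   well. *)
pose Q (w : C) := if w == 0 then 0 else F (0 + w *: x).
have [e e0 he] := nr_open oD D0.
have x1 : 0 < nr x + 1 by rewrite ltr_wpDl ?nr_ge0.
have dQ w : nr w * p x < 1 -> differentiable Q w.
  move=> w1; have [->|w0] := eqVneq w 0.
    have d0 : 0 < e / (nr x + 1) by rewrite divr_gt0.
    have dg0 : differentiable (fun w : C => g (w *: x)) 0 by apply: ray_diff; rewrite scale0r.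
    apply: (diff_local d0 _ dg0) => v; rewrite subr0 ltr_pdivlMr// => vd.
    rewrite /Q; have [->|v0] := eqVneq v 0; first by rewrite scale0r g0.
    rewrite add0r; apply: gF; last by rewrite scaler_eq0 negb_or v0.
    apply: he; rewrite subr0 nrZ; apply: le_lt_trans vd.
    by rewrite ler_wpM2l ?nr_ge0// lerDl.
  have n0 : 0 < nr w by rewrite nr_gt0.
  have dF : differentiable (fun v : C => F (0 + v *: x)) w.
    apply: F_line; rewrite add0r (cnZ hp) w1 andbT mulr_gt0//.
  apply: (diff_local n0 _ dF) => v; rewrite /Q; case: eqVneq => // ->.
  by rewrite sub0r nrN ltxx.
have ws (w : C) : nr w <= s -> nr w * p x < 1.
  by move=> h; apply: le_lt_trans r1; rewrite -sp; apply: ler_wpM2r => //; exact: ltW.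
have bQ w : nr w <= s -> nr (Q w) <= 1.
  have := @max_principle R Q 0 s 1 s0 ler01 _ _ _ w; rewrite subr0; apply.
  - by move=> z; rewrite subr0 => /ws/dQ; exact: diff_cont.
  - by move=> z; rewrite subr0 => /ltW/ws/dQ.
  - move=> z; rewrite subr0 => zs; have z0 : z != 0 by rewrite -nr_gt0 zs.
    rewrite /Q (negPf z0) add0r F_shell; last 2 first.
    + by rewrite (cnZ hp) zs sp; lra.
    + by rewrite (cnZ hp) zs sp; lra.
    by apply: bg; apply: shellD; rewrite (cnZ hp) zs sp; lra.
have Q0 : Q 0 = 0 by rewrite /Q eqxx.
have := @schwarz R Q s 1 s0 ler01 Q0 (fun z hz => dQ z (ws z (ltW hz))) (fun z hz => bQ z (ltW hz)) 1.
rewrite nr1 mulr1 => /(_ s1).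
rewrite /Q oner_eq0 scale1r add0r -gF// leNgt => /negP; apply.
by rewrite -ltr_pdivrMl// mulr1 /s ltr_pdivlMr// mulrC; lra.
Qed.

End HartogsSchwarz.

(** * Injective holomorphic maps are open *)

Section MatrixBounds.
Variables (R : realType) (n : nat).
Local Notation C := (Cplx R).
Local Notation V := 'rV[C]_n.

Lemma nr_sum (I : Type) (r : seq I) (F : I -> C) : nr (\sum_(i <- r) F i) <= \sum_(i <- r) nr (F i).
Proof.
elim: r => [|i r IH]; first by rewrite !big_nil nr0.
by rewrite !big_cons; apply: le_trans (nrD _ _) _; rewrite lerD2l.
Qed.

Lemma mulmx_bound_entry (B : 'M[C]_n) (e : R) (h : V) : 0 <= e -> (forall i j, nr (B i j) <= e) ->
  nr (h *m B) <= n%:R * e * nr h.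
Proof.
move=> e0 hB; apply: nr_rV_le; first by rewrite !mulr_ge0 ?nr_ge0// ler0n.
move=> j; rewrite mxE; apply: le_trans (nr_sum _ _) _.
apply: le_trans (_ : \sum_(k < n) nr h * e <= _).
  apply: ler_sum => k _; rewrite nrM; apply: ler_pM; rewrite ?nr_ge0//.
  exact: nr_coord.
rewrite sumr_const card_ord -[nr h * e *+ n]mulr_natl.
by have -> : n%:R * (nr h * e) = n%:R * e * nr h by ring.
Qed.

Lemma mulmx_bound (B : 'M[C]_n) : exists2 c : R, 0 < c & forall h : V, nr (h *m B) <= c * nr h.
Proof.
pose e := \sum_i \sum_j nr (B i j).
have e0 : 0 <= e by apply: sumr_ge0 => i _; apply: sumr_ge0 => j _; exact: nr_ge0.
exists (n%:R * e + 1); first by rewrite ltr_wpDl// mulr_ge0// ler0n.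
move=> h; apply: le_trans (_ : n%:R * e * nr h <= _).
  apply: mulmx_bound_entry => // i j; rewrite /e (bigD1 i)//= (bigD1 j)//= -addrA lerDl.
  apply: addr_ge0; apply: sumr_ge0 => k _; rewrite ?nr_ge0//.
  by apply: sumr_ge0 => l _; exact: nr_ge0.
by apply: ler_wpM2r; rewrite ?nr_ge0// lerDl.
Qed.

(* Transpose of the Jacobian matrix, as vectors are rows. *)
Definition dmat (f : V -> V) (x : V) : 'M[C]_n := lin1_mx ('d f x).

Lemma dmatE (f : V -> V) x v : v *m dmat f x = 'd f x v.
Proof. by rewrite /dmat mul_rV_lin1. Qed.

Lemma dmat_nr (f : V -> V) x : differentiable f x ->
  forall e : R, 0 < e -> exists2 d : R, 0 < d &
    forall h, nr h < d -> nr (f (x + h) - f x - h *m dmat f x) <= e * nr h.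
Proof.
move=> df e e0; have [d d0 hd] := diff_nr df e0.
by exists d => // h /hd; rewrite dmatE.
Qed.

Lemma nr_dmat (f : V -> V) x (B : 'M[C]_n) :
  (forall e : R, 0 < e -> exists2 d : R, 0 < d &
    forall h, nr h < d -> nr (f (x + h) - f x - h *m B) <= e * nr h) ->
  differentiable f x /\ dmat f x = B.
Proof.
move=> hf; pose L : {linear V -> V} := mulmxr B.
have cL : continuous L.
  have [c c0 hc] := mulmx_bound B.
  move=> y; apply/nr_cont => e e0; exists (e / c); first by rewrite divr_gt0.
  move=> z; rewrite ltr_pdivlMr// => h; rewrite -linearB /=; apply: le_lt_trans (hc _) _.
  by rewrite mulrC.
have [df dE] := @nr_diff R V V f x L cL hf.
split=> //; apply/row_matrixP => i; rewrite !rowE dmatE dE //.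
Qed.

Lemma dmat_line (f : V -> V) (x v : V) (w : C) j : differentiable f (x + w *: v) ->
  differentiable (fun u : C => f (x + u *: v) ord0 j) w /\
  der (fun u : C => f (x + u *: v) ord0 j) w = (v *m dmat f (x + w *: v)) ord0 j.
Proof.
move=> df; apply: nr_der => e e0.
have v1 : 0 < nr v + 1 by rewrite ltr_wpDl ?nr_ge0.
have [d d0 hd] := dmat_nr df (divr_gt0 e0 v1).
exists (d / (nr v + 1)); first by rewrite divr_gt0.
move=> h; rewrite ltr_pdivlMr// => hh.
have hv : nr (h *: v) <= nr h * (nr v + 1) by rewrite nrZ; apply: ler_wpM2l; rewrite ?nr_ge0// lerDl.
have := hd (h *: v) (le_lt_trans hv hh).
have -> : x + w *: v + h *: v = x + (w + h) *: v by rewrite scalerDl addrA.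
move=> k; apply: le_trans (_ : nr (f (x + (w + h) *: v) - f (x + w *: v) - (h *: v) *m dmat f (x + w *: v)) <= _).
  have := nr_coord (f (x + (w + h) *: v) - f (x + w *: v) - (h *: v) *m dmat f (x + w *: v)) j.
  by rewrite -scalemxAl !mxE.
apply: le_trans k _; rewrite nrZ.
have -> : e / (nr v + 1) * (nr h * nr v) = e * nr h * (nr v / (nr v + 1)) by ring.
by apply: ler_piMr; [rewrite mulr_ge0 ?nr_ge0// ltW|rewrite ler_pdivrMr// mul1r lerDl].
Qed.

Lemma local_bound (f : V -> V) a (s : R) : 0 < s -> differentiable f a ->
  exists t M : R, [/\ 0 < t, t <= s & forall x, nr (x - a) < t -> nr (f x) <= M].
Proof.
move=> s0 /(@diff_cont R V V f a)/nr_cont/(_ 1 ltr01)[d d0 hd].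
exists (Num.min s d), (1 + nr (f a)); split; first by rewrite lt_min s0.
  by rewrite ge_min lexx.
move=> x; rewrite lt_min => /andP[_ /hd h].
by have := nr_lb_dist (f x) (f a); lra.
Qed.

Section Regularity.
Variables (f : V -> V) (a : V) (s M : R).
Hypotheses (s0 : 0 < s) (df : forall x, nr (x - a) < s -> differentiable f x)
  (bf : forall x, nr (x - a) < s -> nr (f x) <= M).

Let M0 : 0 <= M.
Proof. by apply: le_trans (bf (x := a) _); rewrite ?nr_ge0// subrr nr0. Qed.

(** The Schwarz lemma for each coordinate along the complex line from [x] to [y], on the disc of
    radius [s / 2 / nr (y - x)], which contains [1]. *)
Lemma holo_lipschitz x y : nr (x - a) < s / 2 -> nr (y - x) < s / 2 ->
  nr (f y - f x) <= 4 * M / s * nr (y - x).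
Proof.
move=> xs yx; have s2 : 0 < s / 2 by rewrite divr_gt0.
have rhs0 : 0 <= 4 * M / s * nr (y - x).
  by apply: mulr_ge0; [apply: divr_ge0; [apply: mulr_ge0|exact: ltW]|exact: nr_ge0].
have [->|yx0] := eqVneq y x; first by rewrite !subrr !nr0 mulr0.
have n0 : 0 < nr (y - x) by rewrite nr_gt0 subr_eq0.
apply: nr_rV_le => // j.
pose r := s / 2 / nr (y - x).
have r0 : 0 < r by rewrite divr_gt0.
have inb (w : C) : nr w < r -> nr (x + w *: (y - x) - a) < s.
  move=> wr; rewrite addrAC; apply: le_lt_trans (nrD _ _) _; rewrite nrZ.
  by move: wr; rewrite /r ltr_pdivlMr//; lra.
pose phi (w : C) := f (x + w *: (y - x)) ord0 j.
have dphi (w : C) : nr w < r -> differentiable phi w.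
  by move=> /inb/df/(@dmat_line f x (y - x) w j)[].
(* The constant [phi 0] is written as an affine function to fit [der_subaffine]; subtracting it
   doubles the bound [M]. *)
pose psi (w : C) := phi w - (phi 0 + w * 0).
have psi0 : psi 0 = 0 by rewrite /psi mulr0 addr0 subrr.
have dpsi (w : C) : nr w < r -> differentiable psi w.
  by move=> wr; have [] := der_subaffine (phi 0) 0 (dphi w wr).
have bphi (w : C) : nr w < r -> nr (phi w) <= M.
  by move=> wr; apply: le_trans (nr_coord _ j) _; apply: bf; exact: inb.
have bpsi (w : C) : nr w < r -> nr (psi w) <= 2 * M.
  move=> wr; rewrite /psi mulr0 addr0; apply: le_trans (nrB _ _) _.
  apply: le_trans (lerD (bphi w wr) (bphi 0 _)) _; first by rewrite nr0.
  by rewrite mulr_natl mulr2n.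
have r1 : nr (1 : C) < r by rewrite nr1 /r ltr_pdivlMr// mul1r.
have := @schwarz R psi r (2 * M) r0 _ psi0 dpsi bpsi 1 r1.
rewrite mulr_ge0// => /(_ isT).
have -> : psi 1 = (f y - f x) ord0 j.
  have xy : x + (y - x) = y by rewrite addrC subrK.
  have p1 : phi 1 = f y ord0 j by rewrite /phi scale1r xy.
  have p0 : phi 0 + 1 * 0 = f x ord0 j by rewrite mulr0 addr0 /phi scale0r addr0.
  have -> : psi 1 = phi 1 - (phi 0 + 1 * 0) by [].
  by rewrite p1 p0 [RHS]mxE; congr (_ + _); rewrite [RHS]mxE.
rewrite nr1 mulr1 -ler_pdivlMr// => h; apply: le_trans h _.
have -> : 2 * M / r = 4 * M / s * nr (y - x) by rewrite /r; field; rewrite !gt_eqF.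
exact: lexx.
Qed.

Lemma dmat_entry x i j (t : R) : nr (x - a) < s / 2 -> 0 < t -> t < s / 2 ->
  dmat f x i j = cmean (fun z => f (x + (cr t * z) *: delta_mx ord0 i) ord0 j * (cr t * z)^-1).
Proof.
move=> xs t0 ts.
have de : nr (delta_mx ord0 i : V) <= 1.
  apply: nr_rV_le => // k; rewrite !mxE eqxx /=; case: (k == i) => /=; by rewrite ?nr1 ?nr0.
have inb (w : C) : nr w < s / 2 -> nr (x + w *: delta_mx ord0 i - a) < s.
  move=> ws; rewrite addrAC; apply: le_lt_trans (nrD _ _) _; rewrite nrZ.
  have : nr w * nr (delta_mx ord0 i : V) <= nr w * 1 by rewrite ler_wpM2l ?nr_ge0.
  lra.
pose phi (w : C) := f (x + w *: delta_mx ord0 i) ord0 j.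
have dphi w : nr (w - 0) < s / 2 -> differentiable phi w.
  by rewrite subr0 => /inb/df/(@dmat_line f x (delta_mx ord0 i) w j)[].
have -> : dmat f x i j = der phi 0.
  have df0 : differentiable f (x + 0 *: delta_mx ord0 i) by apply/df/inb; rewrite nr0 divr_gt0.
  have [_ ->] := dmat_line j df0.
  by rewrite scale0r addr0 -rowE [RHS]mxE.
have ts' : 0 < t < s / 2 by rewrite t0.
rewrite (der_cmean ts' dphi); apply: cmean_ext => z _.
by rewrite /phi add0r.
Qed.

Lemma dmat_cont_bounded i j (e : R) : 0 < e -> exists2 d : R, 0 < d &
  forall x, nr (x - a) < d -> nr (dmat f x i j - dmat f a i j) <= e.
Proof.
move=> e0; pose K := 4 * M / s / (s / 8).
have K0 : 0 <= K by apply: divr_ge0; [apply: divr_ge0; [exact: mulr_ge0|exact: ltW]|apply: divr_ge0 => //; exact: ltW].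
have K1 : 0 < K + 1 by rewrite ltr_wpDl.
exists (Num.min (s / 4) (e / (K + 1))); first by rewrite lt_min !divr_gt0.
move=> x; rewrite lt_min => /andP[xs xe].
have s8 : 0 < s / 8 by rewrite divr_gt0.
have s82 : s / 8 < s / 2 by lra.
have nx : nr (x - a) < s / 2 by lra.
have na : nr (a - a) < s / 2 by rewrite subrr nr0 divr_gt0.
have e1 := dmat_entry i j nx s8 s82; have e2 := dmat_entry i j na s8 s82.
have de : nr (delta_mx ord0 i : V) <= 1.
  apply: nr_rV_le => // k; rewrite !mxE eqxx /=; case: (k == i) => /=; by rewrite ?nr1 ?nr0.
have sz z : nr z = 1 -> nr ((cr (s / 8) * z) *: delta_mx ord0 i : V) <= s / 8.
  move=> z1; rewrite nrZ nrM z1 mulr1 nr_cr gtr0_norm//.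
  by rewrite -[leRHS]mulr1 ler_wpM2l// ltW.
have inb y z : nr z = 1 -> nr (y - a) < s / 4 -> nr (y + (cr (s / 8) * z) *: delta_mx ord0 i - a) < s / 2.
  move=> z1 ya; rewrite addrAC; apply: le_lt_trans (nrD _ _) _.
  rewrite [ltRHS](_ : _ = s / 4 + s / 4); last by field.
  by apply: ltr_leD ya (le_trans (sz z z1) _); rewrite ler_pM2l// lef_pV2 ?posrE// ler_nat.
have bi z : nr z = 1 -> nr ((cr (s / 8) * z)^-1) = (s / 8)^-1.
  by move=> z1; rewrite nrV nrM z1 mulr1 nr_cr gtr0_norm.
have B y : nr (y - a) < s / 4 ->
    cbounded (fun z => f (y + (cr (s / 8) * z) *: delta_mx ord0 i) ord0 j * (cr (s / 8) * z)^-1).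
  move=> ya; exists (M * (s / 8)^-1) => z z1; rewrite nrM bi//.
  apply: ler_wpM2r; first by rewrite invr_ge0 ltW.
  by apply: le_trans (nr_coord _ j) _; apply: bf; apply: lt_trans (inb y z z1 ya) _;
    rewrite ltr_pdivrMr// ltr_pMr// ltr1n.
have Ba := B a _; rewrite subrr nr0 divr_gt0// in Ba.
have -> := congr2 (fun u v : C => u - v) e1 e2; rewrite /=.
have <- := cmeanB (B x xs) (Ba isT).
apply: cmean_bound => z z1; rewrite -mulrBl nrM bi//.
have h : nr (f (x + (cr (s / 8) * z) *: delta_mx ord0 i) ord0 j - f (a + (cr (s / 8) * z) *: delta_mx ord0 i) ord0 j)
    <= 4 * M / s * nr (x - a).
  set y1 := x + _; set y2 := a + _.
  have e12 : y1 - y2 = x - a by rewrite /y1 /y2 opprD addrACA subrr addr0.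
  apply: le_trans (_ : nr (f y1 - f y2) <= _).
    by have := nr_coord (f y1 - f y2) j; rewrite !mxE.
  rewrite -e12; apply: holo_lipschitz; last first.
    by rewrite e12; apply: lt_le_trans xs _; rewrite ler_pM2l// lef_pV2 ?posrE// ler_nat.
  by apply: inb => //; rewrite subrr nr0 divr_gt0.
apply: le_trans (_ : K * nr (x - a) <= _).
  by rewrite /K [X in _ <= X]mulrAC; apply: ler_wpM2r; rewrite ?invr_ge0 ?(ltW s8).
rewrite ltr_pdivlMr// in xe; apply: ltW; apply: le_lt_trans xe; rewrite mulrC.
by apply: ler_wpM2l; rewrite ?nr_ge0// lerDl.
Qed.

(** Cauchy's formula [dmat_entry] holds with one fixed radius near [a], so the entry is a mean
    depending holomorphically on the parameter of the curve. *)
Lemma dmat_curve_diff (gam : C -> V) (w0 : C) (d : R) i j : 0 < d ->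
  (forall w, nr (w - w0) < d -> differentiable gam w) -> gam w0 = a ->
  differentiable (fun w => dmat f (gam w) i j) w0.
Proof.
move=> d0 dgam ga.
have s8 : 0 < s / 8 by rewrite divr_gt0.
have s82 : s / 8 < s / 2 by lra.
have /nr_cont/(_ _ s8)[d1 d10 hd1] : {for w0, continuous gam}.
  by apply: diff_cont; apply: dgam; rewrite subrr nr0.
pose d2 := Num.min d d1.
have d20 : 0 < d2 by rewrite lt_min d0.
have gs w : nr (w - w0) < d2 -> nr (gam w - a) < s / 8.
  by rewrite lt_min => /andP[_ /hd1]; rewrite ga.
have de : nr (delta_mx ord0 i : V) <= 1.
  apply: nr_rV_le => // k; rewrite !mxE eqxx /=; case: (k == i) => /=; by rewrite ?nr1 ?nr0.
have sz z : nr z = 1 -> nr ((cr (s / 8) * z) *: delta_mx ord0 i : V) <= s / 8.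
  move=> z1; rewrite nrZ nrM z1 mulr1 nr_cr gtr0_norm//.
  by rewrite -[leRHS]mulr1 ler_wpM2l// ltW.
pose phi w z := f (gam w + (cr (s / 8) * z) *: delta_mx ord0 i) ord0 j * (cr (s / 8) * z)^-1.
apply: (diff_local (f := fun w => cmean (phi w)) d20).
  move=> w /gs gw; apply/esym; apply: dmat_entry => //; lra.
have inb w z : nr z = 1 -> nr (w - w0) < d2 -> nr (gam w + (cr (s / 8) * z) *: delta_mx ord0 i - a) < s.
  move=> z1 /gs gw; rewrite addrAC; apply: le_lt_trans (nrD _ _) _.
  by have := sz z z1; lra.
apply: (@cmean_param_diff R phi w0 d2 (M * (s / 8)^-1) d20).
  move=> z w z1 ww; apply: differentiableM; last exact: differentiable_cst.
  apply: (@differentiable_comp _ _ _ _ (fun w => f (gam w + (cr (s / 8) * z) *: delta_mx ord0 i)) (fun N : V => N ord0 j)); last exact: differentiable_coord.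
  apply: (@differentiable_comp _ _ _ _ (fun w => gam w + (cr (s / 8) * z) *: delta_mx ord0 i) f); last exact/df/inb.
  apply: differentiableD; last exact: differentiable_cst.
  by apply: dgam; move: ww; rewrite lt_min => /andP[].
move=> z w z1 ww; rewrite nrM nrV nrM z1 mulr1 nr_cr gtr0_norm//.
apply: ler_wpM2r; first by rewrite invr_ge0 ltW.
by apply: le_trans (nr_coord _ j) _; apply: bf; exact: inb.
Qed.

End Regularity.

Section Regularity2.
Variables (f : V -> V) (a : V) (s : R).
Hypotheses (s0 : 0 < s) (df : forall x, nr (x - a) < s -> differentiable f x).

Let near_a : exists t M : R, [/\ 0 < t, forall x, nr (x - a) < t -> differentiable f x &
  forall x, nr (x - a) < t -> nr (f x) <= M].
Proof.
have [|t [M [t0 ts hM]]] := @local_bound f a s s0; first by apply: df; rewrite subrr nr0.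
by exists t, M; split=> // x xt; apply: df; apply: lt_le_trans ts.
Qed.

Lemma dmat_cont (e : R) : 0 < e -> exists2 d : R, 0 < d &
  forall x, nr (x - a) < d -> forall i j, nr (dmat f x i j - dmat f a i j) <= e.
Proof.
move=> e0; have [t [M [t0 dt bt]]] := near_a.
have h (i j : 'I_n) := dmat_cont_bounded t0 dt bt i j e0.
have {}h (ij : 'I_n * 'I_n) : exists d : R, 0 < d /\ forall x, nr (x - a) < d -> nr (dmat f x ij.1 ij.2 - dmat f a ij.1 ij.2) <= e.
  by have [d d0 hd] := h ij.1 ij.2; exists d.
have [D hD] := choice h.
exists (\big[Num.min/1]_ij D ij).
  by apply/bigmin_gtP; split=> [|ij _]; [exact: ltr01|case: (hD ij)].
move=> x /bigmin_gtP[_ hx] i j; have [_] := hD (i, j); apply.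
exact: hx (i, j) isT.
Qed.

Lemma dmat_curve (gam : C -> V) (w0 : C) (d : R) i j : 0 < d ->
  (forall w, nr (w - w0) < d -> differentiable gam w) -> gam w0 = a ->
  differentiable (fun w => dmat f (gam w) i j) w0.
Proof.
have [t [M [t0 dt bt]]] := near_a; exact: dmat_curve_diff t0 dt bt _ _ _ _ _.
Qed.

End Regularity2.

(** A determinant is a polynomial in its entries; this yields both its continuity and its
    holomorphy. *)
Lemma det_closed (T : Type) (P : (T -> C) -> Prop) (F : T -> 'M[C]_n) :
  (forall c, P (fun=> c)) ->
  (forall g h, P g -> P h -> P (fun t => g t + h t)) ->
  (forall g h, P g -> P h -> P (fun t => g t * h t)) ->
  (forall i j, P (fun t => F t i j)) -> P (fun t => \det (F t)).
Proof.
move=> Pc PD PM PF.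
have Psum (I : Type) (r : seq I) (G : I -> T -> C) : (forall i, P (G i)) -> P (fun t => \sum_(i <- r) G i t).
  move=> hG; elim: r => [|i r IH].
    by rewrite (_ : (fun t => _) = fun=> 0)//; apply/funext => t; rewrite big_nil.
  rewrite (_ : (fun t => _) = fun t => G i t + \sum_(i <- r) G i t); first exact: PD.
  by apply/funext => t; rewrite big_cons.
have Pprod (I : Type) (r : seq I) (G : I -> T -> C) : (forall i, P (G i)) -> P (fun t => \prod_(i <- r) G i t).
  move=> hG; elim: r => [|i r IH].
    by rewrite (_ : (fun t => _) = fun=> 1)//; apply/funext => t; rewrite big_nil.
  rewrite (_ : (fun t => _) = fun t => G i t * \prod_(i <- r) G i t); first exact: PM.
  by apply/funext => t; rewrite big_cons.
rewrite /determinant; apply: Psum => sg; apply: PM; first exact: Pc.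
by apply: Pprod => i; exact: PF.
Qed.

Lemma det_diff (F : C -> 'M[C]_n) w : (forall i j, differentiable (fun u => F u i j) w) ->
  differentiable (fun u => \det (F u)) w.
Proof.
move=> h; apply: (@det_closed C (fun g => differentiable g w)).
- by move=> c; exact: (@differentiable_cst C C C c w).
- by move=> g k; exact: differentiableD.
- by move=> g k; exact: differentiableM.
- exact: h.
Qed.

Lemma det_cont (F : V -> 'M[C]_n) x : (forall i j, {for x, continuous (fun y => F y i j)}) ->
  {for x, continuous (fun y => \det (F y))}.
Proof.
move=> h; apply: (@det_closed V (fun g => {for x, continuous g})).
- by move=> c; exact: cst_continuous.
- by move=> g k hg hk; exact: (cvgD hg hk).
- by move=> g k hg hk; exact: (cvgM hg hk).
- exact: h.
Qed.

Lemma det_dmat_cont (f : V -> V) a (s : R) : 0 < s ->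
  (forall x, nr (x - a) < s -> differentiable f x) ->
  {for a, continuous (fun x => \det (dmat f x))}.
Proof.
move=> s0 df; apply: det_cont => i j; apply/nr_cont => e e0.
have e2 : 0 < e / 2 by rewrite divr_gt0.
have [d d0 hd] := dmat_cont s0 df e2; exists d => // y /hd/(_ i j); lra.
Qed.

(* If [f] omits [q] then the minimum of [|f - q|] can be decreased by moving along
   a preimage of [q - f y] under the (invertible) derivative. *)
Lemma regular_surj (f : V -> V) (a q : V) (r : R) : 0 < r ->
  (forall y, nr (y - a) <= r -> differentiable f y) ->
  (forall y, nr (y - a) < r -> dmat f y \in unitmx) ->
  (forall y, nr (y - a) = r -> nr (f a - q) < nr (f y - q)) ->
  exists2 y, nr (y - a) < r & f y = q.
Proof.
move=> r0 df uf bf.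
have [||y yr hy] := @nr_EVT_min R V [set y : V | nr (y - a) <= r] (fun y => nr (f y - q)) _ (@compact_rV_ball R n a r).
- by exists a; rewrite /= subrr nr0 ltW.
- move=> x xr e e0; have /nr_cont/(_ e e0)[d d0 hd] := diff_cont (df x xr).
  exists d => // z _ /hd; apply: le_lt_trans; apply: le_trans (nr_dist_dist _ _) _.
  by rewrite opprB addrA subrK.
rewrite /= in yr; have yr' : nr (y - a) < r.
  rewrite lt_neqAle yr andbT; apply/eqP => /bf; rewrite ltNge hy//=.
  by rewrite subrr nr0 ltW.
exists y => //; apply/eqP; rewrite -subr_eq0 -nr_eq0; apply/negPn/negP => ne.
have n0 : 0 < nr (f y - q) by rewrite lt_neqAle eq_sym ne nr_ge0.
set W := f y - q in n0 *; have uy := uf y yr'.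
pose v := - W *m invmx (dmat f y).
have vE : v *m dmat f y = - W by rewrite /v mulmxKV.
have v1 : 0 < nr v + 1 by rewrite ltr_wpDl ?nr_ge0.
(* A step [t v] shortens [W] by [t * nr W], and this choice keeps the linearisation error below half
   of that. *)
pose e := nr W / (nr v + 1) / 2.
have e0 : 0 < e by rewrite !divr_gt0.
have [d d0 hd] := dmat_nr (df y yr) e0.
pose t := Num.min 1 (Num.min (d / 2 / (nr v + 1)) ((r - nr (y - a)) / (nr v + 1))).
have t0 : 0 < t by rewrite !lt_min ltr01 !divr_gt0// subr_gt0.
have t1 : t <= 1 by rewrite ge_min lexx.
have t2 : t * (nr v + 1) <= d / 2 by rewrite -ler_pdivlMr// /t !ge_min lexx !orbT.
have t3 : t * (nr v + 1) <= r - nr (y - a) by rewrite -ler_pdivlMr// /t !ge_min lexx !orbT.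
have tv : nr (cr t *: v) <= t * (nr v + 1).
  by rewrite nrZ nr_cr gtr0_norm//; apply: ler_wpM2l; [exact: ltW|rewrite lerDl].
have := hd (cr t *: v); rewrite -scalemxAl vE => /(_ _)h.
have {}h : nr (f (y + cr t *: v) - f y - cr t *: - W) <= e * nr (cr t *: v).
  by apply: h; apply: le_lt_trans (le_trans tv t2) _; rewrite ltr_pdivrMr// ltr_pMr// ltr1n.
have := hy (y + cr t *: v); rewrite /= => /(_ _) hmin.
have {}hmin : nr W <= nr (f (y + cr t *: v) - q).
  by apply: hmin; rewrite addrAC; apply: le_trans (nrD _ _) _;
    rewrite -lerBrDl; exact: le_trans tv t3.
have eq1 : f (y + cr t *: v) - q = cr (1 - t) *: W + (f (y + cr t *: v) - f y - cr t *: - W).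
  rewrite crB cr1 scalerBl scale1r scalerN opprK /W.
  by rewrite [in RHS]addrC -!addrA; congr (_ + _); rewrite [cr t *: _ + _]addrC !addrA addNr add0r subrK.
have := le_trans hmin _; rewrite eq1 => /(_ _ (nrD _ _)); rewrite nrZ nr_cr ger0_norm ?subr_ge0//.
rewrite mulrBl mul1r -addrA lerDl addrC subr_ge0 => hm.
have h1 : e * nr (cr t *: v) <= t * nr W / 2.
  apply: le_trans (_ : e * (t * (nr v + 1)) <= _); first by rewrite ler_wpM2l// ltW.
  have -> : e * (t * (nr v + 1)) = t * nr W / 2 by rewrite /e; field; rewrite gt_eqF.
  exact: lexx.
have tW : 0 < t * nr W by rewrite mulr_gt0.
by have := le_trans hm (le_trans h h1); rewrite leNgt ltr_pdivrMr// ltr_pMr// ltr1n.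
Qed.

Lemma inverse_diff (f g : V -> V) (y0 : V) (d0 : R) : 0 < d0 ->
  (forall y, nr (y - y0) < d0 -> f (g y) = y) -> {for y0, continuous g} ->
  differentiable f (g y0) -> dmat f (g y0) \in unitmx ->
  differentiable g y0 /\ dmat g y0 = invmx (dmat f (g y0)).
Proof.
move=> d00 fg cg df uf; set B := invmx _.
apply: nr_dmat => e e0; have [c c0 hc] := mulmx_bound B.
(* The first bound, [c * e' <= 1 / 2], lets [nr k] be absorbed to give [nr k <= 2 * c * nr h]; the
   second turns the final error into [e * nr h]. *)
pose e' := Num.min (2^-1) (e / (2 * c)) / c.
have e'0 : 0 < e' by rewrite divr_gt0// lt_min invr_gt0 ltr0n divr_gt0// mulr_gt0.
have e'1 : c * e' <= 2^-1 by rewrite /e' mulrC divfK ?gt_eqF// ge_min lexx.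
have e'2 : c * e' * (2 * c) <= e.
  by rewrite -ler_pdivlMr ?mulr_gt0// /e' mulrC divfK ?gt_eqF// ge_min lexx orbT.
have [d d_0 hd] := dmat_nr df e'0.
have /nr_cont/(_ _ d_0)[d1 d10 hd1] := cg.
exists (Num.min d0 d1); first by rewrite lt_min d00.
move=> h; rewrite lt_min => /andP[h1 h2].
pose k := g (y0 + h) - g y0.
have hk : nr k < d by apply: hd1; rewrite [y0 + h]addrC addrK.
have yy : nr (y0 - y0) < d0 by rewrite subrr nr0.
have := hd k hk; rewrite /k [g y0 + _]addrC subrK !fg//; last by rewrite [y0 + h]addrC addrK.
rewrite -/k [y0 + h]addrC addrK => hR.
have kB : k - h *m B = - ((h - k *m dmat f (g y0)) *m B).
  by rewrite mulmxBl -mulmxA mulmxV// mulmx1 opprB.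
have k1 : nr (k - h *m B) <= c * e' * nr k.
  by rewrite kB nrN; apply: le_trans (hc _) _; rewrite -mulrA ler_wpM2l// ltW.
have k2 : nr k <= 2 * c * nr h.
  have : nr k <= nr (k - h *m B) + nr (h *m B) by apply: le_trans (nrD _ _); rewrite subrK.
  have := hc h; have : c * e' * nr k <= 2^-1 * nr k by rewrite ler_wpM2r ?nr_ge0.
  by move: k1; move: (nr (k - _)) (nr (h *m B)) (c * e' * nr k) => *; lra.
apply: le_trans k1 _; apply: le_trans (_ : c * e' * (2 * c * nr h) <= _).
  by rewrite ler_wpM2l// mulr_ge0// ltW.
by rewrite mulrA ler_wpM2r ?nr_ge0.
Qed.

Lemma vector_const (gam : C -> V) (d : R) : 0 < d ->
  (forall w, nr w < d -> forall j, differentiable (fun u => gam u ord0 j) w /\ der (fun u => gam u ord0 j) w = 0) ->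
  forall w, nr w < d -> gam w = gam 0.
Proof.
move=> d0 h w wd; apply/rowP => j; apply/eqP; rewrite -subr_eq0 -nr_eq0 eq_le nr_ge0 andbT.
rewrite -(mul0r (nr w)); have := @mean_value_ineq R (fun u => gam u ord0 j) 0 w 0.
rewrite add0r; apply => t /andP[t0 t1].
have [|k1 k2] := h (0 + cr t * w) _ j; last by rewrite k2 nr0.
rewrite add0r nrM nr_cr ger0_norm//; apply: le_lt_trans wd.
by rewrite ler_piMl// nr_ge0.
Qed.

End MatrixBounds.

(** * Local inversion, constant rank, and openness *)

Section OpenMapping.
Variables (R : realType) (n : nat).
Local Notation C := (Cplx R).
Local Notation V := 'rV[C]_n.

Lemma cont_neq0 (g : V -> C) (a : V) : {for a, continuous g} -> g a != 0 ->
  exists2 d : R, 0 < d & forall y, nr (y - a) < d -> g y != 0.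
Proof.
move=> cg ga; have ga0 : 0 < nr (g a) by rewrite nr_gt0.
move/nr_cont/(_ _ ga0) : cg => [d d0 hd]; exists d => // y /hd; apply: contraTneq => ->.
by rewrite sub0r nrN ltxx.
Qed.

Lemma dmat_mulmxr_shift (f : V -> V) (N Q : 'M[C]_n) x : differentiable f x ->
  differentiable (fun y => f y *m N + y *m Q) x /\
  dmat (fun y => f y *m N + y *m Q) x = dmat f x *m N + Q.
Proof.
move=> df; apply: nr_dmat => e e0; have [c c0 hc] := mulmx_bound N.
have [d d0 hd] := dmat_nr df (divr_gt0 e0 c0); exists d => // h /hd hh.
have -> : f (x + h) *m N + (x + h) *m Q - (f x *m N + x *m Q) - h *m (dmat f x *m N + Q) =
  (f (x + h) - f x - h *m dmat f x) *m N.
  rewrite !mulmxBl mulmxDl mulmxDr mulmxA !opprD !addrA.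
  move: (f (x + h) *m N) (f x *m N) (h *m dmat f x *m N) (x *m Q) (h *m Q) => p1 p2 p3 p4 p5.
  by apply/rowP => j; rewrite !mxE; ring.
apply: le_trans (hc _) _; rewrite mulrC -ler_pdivlMr//; apply: le_trans hh _.
by rewrite mulrAC.
Qed.

Lemma dmat_comp (f g : V -> V) x : differentiable g x -> differentiable f (g x) ->
  dmat (f \o g) x = dmat g x *m dmat f (g x).
Proof.
move=> dg df; apply/row_matrixP => i.
rewrite rowE dmatE [RHS]rowE mulmxA dmatE dmatE.
exact: (congr1 (fun F : V -> V => F (delta_mx ord0 i)) (diff_comp dg df)).
Qed.

(** The mean value inequality along the segment from [y] to [x], for each coordinate of [f] minus
    the linear map [A]. *)
Lemma strict_differentiability (f : V -> V) (a : V) (A : 'M[C]_n) (d e : R) : 0 <= e ->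
  (forall x, nr (x - a) < d -> differentiable f x) ->
  (forall x, nr (x - a) < d -> forall i j, nr (dmat f x i j - A i j) <= e) ->
  forall x y, nr (x - a) < d -> nr (y - a) < d ->
  nr (f x - f y - (x - y) *m A) <= n%:R * e * nr (x - y).
Proof.
move=> e0 df hd x y xd yd.
apply: nr_rV_le => [|j]; first by rewrite !mulr_ge0 ?nr_ge0// ler0n.
pose b := ((x - y) *m A) ord0 j.
pose phi (w : C) := f (y + w *: (x - y)) ord0 j.
have inb (t : R) : 0 <= t <= 1 -> nr (y + cr t *: (x - y) - a) < d.
  move=> /andP[t0 t1].
  have -> : y + cr t *: (x - y) - a = cr t *: (x - a) + cr (1 - t) *: (y - a).
    rewrite crB cr1; move: (cr t : C) => u; rewrite !scalerBr !scalerBl !scale1r.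
    move: (u *: x) (u *: y) (u *: a) => p1 p2 p3; by apply/rowP => k; rewrite !mxE; ring.
  apply: le_lt_trans (nrD _ _) _; rewrite !nrZ !nr_cr !ger0_norm ?subr_ge0//.
  move: (nr (x - a)) (nr (y - a)) xd yd => p q pd qd; clear -t0 t1 pd qd.
  pose m := Num.max p q.
  have h1 : t * p <= t * m by rewrite ler_wpM2l// le_max lexx.
  have h2 : (1 - t) * q <= (1 - t) * m by rewrite ler_wpM2l ?subr_ge0// le_max lexx orbT.
  have md : m < d by rewrite gt_max pd qd.
  by move: h1 h2 md; move: m => m; rewrite !mulrBl !mul1r; move: (t * p) (t * m) (t * q) => *; lra.
have key (t : R) : 0 <= t <= 1 ->
    differentiable (fun w => phi w - (0 + w * b)) (0 + cr t * 1) /\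
    nr (der (fun w => phi w - (0 + w * b)) (0 + cr t * 1)) <= n%:R * e * nr (x - y).
  move=> /inb tb; rewrite add0r mulr1.
  have [d1 D1] := dmat_line j (df _ tb).
  have [d2 D2] := der_subaffine 0 b d1.
  split; first exact: d2.
  rewrite D2 D1 /b.
  have -> : ((x - y) *m dmat f (y + cr t *: (x - y))) ord0 j - ((x - y) *m A) ord0 j =
    ((x - y) *m (dmat f (y + cr t *: (x - y)) - A)) ord0 j.
    by rewrite mulmxBr [RHS]mxE; congr (_ + _); rewrite [RHS]mxE.
  apply: le_trans (nr_coord _ j) _; apply: mulmx_bound_entry => // i k.
  by have := hd _ tb i k; rewrite !mxE.
have := mean_value_ineq key; rewrite nr1 mulr1 add0r /phi scale1r scale0r.
have -> : y + (x - y) = x by rewrite addrC subrK.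
rewrite addr0 !add0r mul0r subr0 mul1r /b !mxE.
by congr (nr _ <= _); ring.
Qed.

(** A quantitative inverse function theorem: near [a] the map is close to its invertible linear
    part, hence expands distances by a definite factor, and [regular_surj] gives a ball of
    values. *)
Lemma local_inverse (f : V -> V) (a : V) (s : R) : 0 < s ->
  (forall x, nr (x - a) < s -> differentiable f x) -> dmat f a \in unitmx ->
  exists r c d : R, [/\ [/\ 0 < r, r < s, 0 < c & 0 < d],
    forall x y, nr (x - a) <= r -> nr (y - a) <= r -> nr (x - y) <= c * nr (f x - f y),
    forall x, nr (x - a) <= r -> dmat f x \in unitmx
  & forall q, nr (q - f a) < d -> exists2 y, nr (y - a) < r & f y = q].
Proof.
move=> s0 df uA; set A := dmat f a in uA.
have [c c0 hc] := mulmx_bound (invmx A).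
have N0 : 0 < 2 * c * n.+1%:R by rewrite !mulr_gt0// ltr0n.
(* Makes [c * (n * e) <= 1 / 2], so the error is absorbed and the Lipschitz constant becomes
   [2 * c]; [n.+1] keeps the denominator nonzero. *)
pose e : R := (2 * c * n.+1%:R)^-1.
have e0 : 0 < e by rewrite invr_gt0.
have ne : c * (n%:R * e) <= 2^-1.
  have -> : (2^-1 : R) = c * (n.+1%:R * e) by rewrite /e; field; rewrite !gt_eqF// ltr0n.
  by rewrite ler_wpM2l ?(ltW c0)// ler_wpM2r ?(ltW e0)// ler_nat.
have [d1 d10 hd1] := dmat_cont s0 df e0.
have dA : \det A != 0 by rewrite -unitfE -unitmxE.
have [d2 d20 hd2] := cont_neq0 (det_dmat_cont s0 df) dA.
pose d3 := Num.min s (Num.min d1 d2).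
have d30 : 0 < d3 by rewrite !lt_min s0 d10.
have [d3s d31 d32] : [/\ d3 <= s, d3 <= d1 & d3 <= d2] by rewrite /d3 !ge_min !lexx !orbT.
pose r := d3 / 2; have r0 : 0 < r by rewrite divr_gt0.
have rd3 : r < d3 by rewrite /r ltr_pdivrMr// ltr_pMr// ltr1n.
have lip x y : nr (x - a) <= r -> nr (y - a) <= r -> nr (x - y) <= 2 * c * nr (f x - f y).
  move=> xr yr; have xd := le_lt_trans xr rd3; have yd := le_lt_trans yr rd3.
  have df3 z : nr (z - a) < d3 -> differentiable f z by move=> zd; apply: df; apply: lt_le_trans d3s.
  have hd3 z : nr (z - a) < d3 -> forall i j, nr (dmat f z i j - A i j) <= e.
    by move=> zd; apply: hd1; apply: lt_le_trans d31.
  have h1 := strict_differentiability (ltW e0) df3 hd3 xd yd.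
  have h2 : nr (x - y) <= c * nr ((x - y) *m A) by have := hc ((x - y) *m A); rewrite mulmxK.
  have h3 : nr ((x - y) *m A) <= nr (f x - f y) + n%:R * e * nr (x - y).
    have -> : (x - y) *m A = (f x - f y) - (f x - f y - (x - y) *m A) by rewrite opprB [RHS]addrC subrK.
    by apply: le_trans (nrB _ _) _; rewrite lerD2l.
  have h4 : c * nr ((x - y) *m A) <= c * (nr (f x - f y) + n%:R * e * nr (x - y)).
    by rewrite ler_wpM2l// ltW.
  have h5 : c * (n%:R * e) * nr (x - y) <= 2^-1 * nr (x - y) by rewrite ler_wpM2r ?nr_ge0.
  move: h2 h4 h5; rewrite mulrDr !mulrA; move: (c * nr (_ *m _)) (c * _ * _ * _) => p q.
  rewrite -mulrA; move: (c * nr _) (nr (x - y)) => u v; clear; lra.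
have uf x : nr (x - a) <= r -> dmat f x \in unitmx.
  move=> xr; rewrite unitmxE unitfE; apply: hd2.
  by apply: le_lt_trans xr _; apply: lt_le_trans d32.
(* On the sphere of radius [r], [f y] is at least [r / (2 * c)] away from [f a]; a value [q] within
   half of that is closer to [f a], as [regular_surj] requires. *)
exists r, (2 * c), (r / (2 * c) / 2); split=> //.
  by split=> //; rewrite ?divr_gt0 ?mulr_gt0//; apply: lt_le_trans d3s.
move=> q qd; have aa : nr (a - a) <= r by rewrite subrr nr0 ltW.
apply: (regular_surj r0).
- by move=> y yr; apply: df; apply: le_lt_trans yr _; apply: lt_le_trans d3s.
- by move=> y /ltW; exact: uf.
- move=> y yr; have := lip y a; rewrite yr lexx => /(_ isT aa).
  rewrite mulrC -ler_pdivrMr ?mulr_gt0// => h.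
  have := nr_dist_tri q (f y) (f a); rewrite (nr_distC (f a)).
  move: h qd; rewrite (nr_distC q (f a)).
  move: (r / (2 * c)) (nr (f y - f a)) (nr (f a - q)) (nr (f y - q)) => u v w z; clear; lra.
Qed.

(** The kernel of [B] is contained in that of [B *m N], and equal ranks make them equal. *)
Lemma rank_kernel (B N : 'M[C]_n) (k : nat) (v : V) : (\rank B <= k)%N -> \rank (B *m N) = k ->
  v *m (B *m N) = 0 -> v *m B = 0.
Proof.
move=> rB rBN h; apply/sub_kermxP; have sub : (kermx B <= kermx (B *m N))%MS.
  by apply/sub_kermxP; rewrite mulmxA mulmx_ker mul0mx.
have rk : \rank B = k by apply/eqP; rewrite eqn_leq rB -rBN mxrankM_maxl.
have e1 := mxrank_ker B; have e2 := mxrank_ker (B *m N); rewrite rk in e1; rewrite rBN in e2.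
have /eqmxP e : (kermx B == kermx (B *m N))%MS.
  by rewrite -(mxrank_leqif_eq sub).2; apply/eqP; exact: etrans e1 (esym e2).
rewrite e; exact/sub_kermxP.
Qed.

(* Constant rank argument: where the rank of the derivative attains a maximum [k < n],
   [f] is constant along a curve in the direction of its kernel. *)
Lemma injective_regular_point (f : V -> V) (a0 : V) (s0 : R) : 0 < s0 ->
  (forall x, nr (x - a0) < s0 -> differentiable f x) ->
  (forall x y, nr (x - a0) < s0 -> nr (y - a0) < s0 -> f x = f y -> x = y) ->
  exists2 x, nr (x - a0) < s0 & dmat f x \in unitmx.
Proof.
move=> s00 df injf.
pose P k := `[< exists2 x, nr (x - a0) < s0 & \rank (dmat f x) = k >].
have exP : exists k, P k.
  by exists (\rank (dmat f a0)); apply/asboolP; exists a0 => //; rewrite subrr nr0.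
have ubP k : P k -> (k <= n)%N by move=> /asboolP[x _ <-]; exact: rank_leq_row.
have [k /asboolP[a aa rk] kmax] := ex_maxnP exP ubP.
have [kn|] := eqVneq k n; first by exists a => //; rewrite -row_free_unit /row_free rk kn.
rewrite neq_ltn => /orP[kn|]; last by rewrite ltnNge -rk rank_leq_row.
exfalso; set A := dmat f a in rk.
pose L := col_ebase A; pose U := row_ebase A.
have AE : L *m pid_mx k *m U = A by rewrite -rk mulmx_ebase.
have kn' : (k <= n)%N := ltnW kn.
(* In adapted bases the first [k] coordinates of [Phi] come from [f] and the others are linear; its
   derivative at [a] is [L *m (pid_mx k + copid_mx k) = L], which is invertible. *)
pose N := invmx U *m pid_mx k : 'M[C]_n; pose Q := L *m copid_mx k : 'M[C]_n.
have AN : A *m N = L *m pid_mx k.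
  by rewrite -AE /N mulmxA mulmxK ?row_ebase_unit// -mulmxA pid_mx_id.
pose s := s0 - nr (a - a0); have sp : 0 < s by rewrite subr_gt0.
have sub x : nr (x - a) < s -> nr (x - a0) < s0.
  by move=> /nr_near.
pose Phi x := f x *m N + x *m Q.
have dPhi x : nr (x - a) < s -> differentiable Phi x.
  by move=> /sub/df/(dmat_mulmxr_shift N Q)[].
have PhiE x : nr (x - a) < s -> dmat Phi x = dmat f x *m N + Q.
  by move=> /sub/df/(dmat_mulmxr_shift N Q)[].
have uPhi : dmat Phi a \in unitmx.
  rewrite PhiE ?subrr ?nr0// -/A AN /Q -mulmxDr /copid_mx addrC subrK mulmx1.
  exact: col_ebase_unit.
have [r [c [d [[r0 rs c0 d0] lip uf surj]]]] := local_inverse sp dPhi uPhi.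
have [Psi hPsi] : exists Psi : V -> V, forall q, nr (q - Phi a) < d -> nr (Psi q - a) < r /\ Phi (Psi q) = q.
  have h q : exists y, nr (q - Phi a) < d -> nr (y - a) < r /\ Phi y = q.
    have [/surj[y y1 y2]|] := boolP (nr (q - Phi a) < d); first by exists y.
    by move=> _; exists a.
  by have [Psi hP] := choice h; exists Psi.
have dPsi q : nr (q - Phi a) < d -> differentiable Psi q /\ dmat Psi q = invmx (dmat Phi (Psi q)).
  move=> qd; have [h1 h2] := hPsi q qd; have qd' : 0 < d - nr (q - Phi a) by rewrite subr_gt0.
  have near y : nr (y - q) < d - nr (q - Phi a) -> nr (y - Phi a) < d.
    exact: nr_near.
  apply: (inverse_diff qd').
  - by move=> y /near/hPsi[].
  - apply/nr_cont => e e0; exists (Num.min (d - nr (q - Phi a)) (e / c)).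
      by rewrite lt_min qd' divr_gt0.
    move=> y; rewrite lt_min => /andP[/near/hPsi[y1 y2]]; rewrite ltr_pdivlMr// mulrC => ye.
    by apply: le_lt_trans ye; rewrite -{2}y2 -{2}h2; apply: lip; exact: ltW.
  - by apply: dPhi; apply: lt_trans rs.
  - by apply: uf; exact: ltW.
(* Indices start at 0, so [v] is the first basis vector killed by [pid_mx k]. Moving along it leaves
   the coordinates of [Phi] that come from [f] fixed to first order; as the rank of [dmat f] nowhere
   exceeds [k], [rank_kernel] shows that all of [f] is stationary. *)
pose v : V := delta_mx ord0 (Ordinal kn).
have kerf q : nr (q - Phi a) < d -> v *m dmat (f \o Psi) q = 0.
  move=> qd; have [h1 h2] := hPsi q qd; have [e1 e2] := dPsi q qd.
  have xs : nr (Psi q - a) < s by apply: lt_trans rs.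
  have ux : dmat Phi (Psi q) \in unitmx by apply: uf; exact: ltW.
  rewrite (dmat_comp e1 (df _ (sub _ xs))) mulmxA e2.
  set x := Psi q in xs ux *; set u := v *m _.
  have pidE : dmat Phi x *m pid_mx k = dmat f x *m N.
    by rewrite PhiE// mulmxDl /Q -[L *m _ *m _]mulmxA mul_copid_mx_pid// mulmx0 addr0 /N -!mulmxA pid_mx_id.
  have uv : u *m dmat Phi x = v by rewrite /u mulmxKV.
  apply: (@rank_kernel _ N k).
  - by apply: kmax; apply/asboolP; exists x => //; exact: sub.
  - rewrite -pidE eqmxMfull ?row_full_unit//; exact: rank_pid_mx.
  - rewrite -pidE mulmxA uv; apply/rowP => j; rewrite /v -rowE !mxE /=.
    by rewrite ltnn andbF.
pose gam (w : C) := (f \o Psi) (Phi a + w *: v).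
have v1 : nr v <= 1.
  by apply: nr_rV_le => // i; rewrite !mxE eqxx /=; case: (i == _) => /=; rewrite ?nr1 ?nr0.
have near (w : C) : nr w < d -> nr (Phi a + w *: v - Phi a) < d.
  move=> wd; rewrite addrC addKr nrZ; apply: le_lt_trans wd.
  by rewrite -[leRHS]mulr1 ler_wpM2l ?nr_ge0.
have dgam (w : C) : nr w < d -> forall j, differentiable (fun u => gam u ord0 j) w /\ der (fun u => gam u ord0 j) w = 0.
  move=> /near wd j; have [e1 e2] := dPsi _ wd; have [h1 h2] := hPsi _ wd.
  have dfP : differentiable (f \o Psi) (Phi a + w *: v).
    apply: (differentiable_comp e1); apply/df/sub; exact: lt_trans rs.
  have [k1 k2] := dmat_line j dfP; split; first exact: k1.
  by rewrite k2 kerf// mxE.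
have d2 : nr (cr (d / 2) : C) < d.
  by rewrite nr_cr gtr0_norm ?divr_gt0// ltr_pdivrMr// ltr_pMr// ltr1n.
have cd0 : nr (cr (d / 2) : C) <> 0 by rewrite nr_cr gtr0_norm ?divr_gt0//; apply/eqP; rewrite gt_eqF ?divr_gt0.
have n0d : nr (0 : C) < d by rewrite nr0.
have /= eqf := vector_const d0 dgam d2.
have [p1 p2] := hPsi _ (near _ d2); have [p3 p4] := hPsi _ (near _ n0d).
have ePsi : Psi (Phi a + cr (d / 2) *: v) = Psi (Phi a + 0 *: v).
  exact: (injf _ _ (sub _ (lt_trans p1 rs)) (sub _ (lt_trans p3 rs)) eqf).
have : Phi a + cr (d / 2) *: v = Phi a + 0 *: v by exact: etrans (esym p2) (etrans (congr1 Phi ePsi) p4).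
move/addrI/rowP/(_ (Ordinal kn)); rewrite !mxE !eqxx /= !mulr1 => cd.
by apply: cd0; rewrite cd nr0.
Qed.

Section Openness.
Variables (f : V -> V) (u0 : V) (s : R).
Hypotheses (s0 : 0 < s) (df : forall x, nr (x - u0) < s -> differentiable f x)
  (injf : forall x y, nr (x - u0) < s -> nr (y - u0) < s -> f x = f y -> x = y).

Let E := [set x : V | nr (x - u0) <= s / 2].

Let s2 : s / 2 < s.
Proof. by rewrite ltr_pdivrMr// ltr_pMr// ltr1n. Qed.

Let Es x : E x -> nr (x - u0) < s.
Proof. by move=> xE; exact: le_lt_trans s2. Qed.

Let Eu0 : E u0.
Proof. by rewrite /E /= subrr nr0 divr_ge0// ltW. Qed.

Let dist_attained (A : set V) (q : V) : A `<=` E -> A !=set0 -> closed A ->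
  exists2 c, A c & forall t, A t -> nr (f c - q) <= nr (f t - q).
Proof.
move=> AE A0 cA; apply: nr_EVT_min => //.
  exact: (subclosed_compact cA (@compact_rV_ball R n u0 (s / 2)) AE).
move=> x /AE/Es/df/(@diff_cont R V V)/nr_cont cx e /cx[d d0 hd]; exists d => // y _ /hd.
by apply: le_lt_trans; apply: le_trans (nr_dist_dist _ _) _; rewrite opprB addrA subrK.
Qed.

(** Injectivity keeps [f x] at positive distance from the image of the compact set of points of [E]
    at distance at least [e] from [x]. *)
Let inv_cont x (e : R) : E x -> 0 < e -> exists2 d : R, 0 < d &
  forall y, E y -> nr (f y - f x) < d -> nr (y - x) < e.
Proof.
move=> xE e0; pose A := E `&` ~` [set y | nr (y - x) < e].
have cA : closed A.
  apply: closedI; first exact: closed_nr_ball.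
  rewrite closedC; apply: open_nr => y /= ye; exists (e - nr (y - x)); first by rewrite subr_gt0.
  by move=> z /nr_near.
have [A0|/set0P/negP/negPn/eqP A0] := pselect (A !=set0); last first.
  exists 1 => // y yE _; apply: contrapT => ye.
  by have : A y by []; rewrite A0.
have [c [cE cx] hc] := @dist_attained A (f x) (@subIsetl _ _ _) A0 cA.
have p0 : 0 < nr (f c - f x).
  rewrite nr_gt0 subr_eq0; apply/negP => /eqP /(injf (Es cE) (Es xE)) ecx.
  by apply: cx; rewrite /= ecx subrr nr0.
exists (nr (f c - f x)) => // y yE yc; apply: contrapT => ye.
by have := hc y (conj yE ye); rewrite leNgt yc.
Qed.

Let image_closed q : ~ (f @` E) q -> exists2 d : R, 0 < d & forall y, nr (y - q) < d -> ~ (f @` E) y.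
Proof.
move=> qE; have [|c cE hc] := @dist_attained E q (fun x => id) (ex_intro _ _ Eu0).
  exact: closed_nr_ball.
exists (nr (f c - q)).
  by rewrite nr_gt0 subr_eq0; apply/negP => /eqP e; apply: qE; exists c.
move=> y yq [x xE xy]; have := hc x xE; rewrite xy leNgt nr_distC.
by rewrite (nr_distC q) yq.
Qed.

(* The Jacobian determinant of [f], transported to the image and extended by [0], is
   continuous, and holomorphic where it does not vanish; by Rado's theorem it cannot
   vanish near a point of the target unless it vanishes identically. *)
Lemma open_mapping : exists2 d : R, 0 < d &
  forall q, nr (q - f u0) < d -> exists2 x, nr (x - u0) < s & f x = q.
Proof.
have s20 : 0 < s / 2 by rewrite divr_gt0.
have [d0 d00 hd0] := inv_cont Eu0 s20.
pose J x := \det (dmat f x).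
have dballs x : nr (x - u0) < s -> 0 < s - nr (x - u0) by rewrite subr_gt0.
have dnear x y : nr (y - x) < s - nr (x - u0) -> nr (y - u0) < s.
  exact: nr_near.
have cJ x : nr (x - u0) < s -> {for x, continuous J}.
  by move=> xs; apply: (det_dmat_cont (dballs x xs)) => y /dnear/df.
have [h [hE hN]] : exists h : V -> C, (forall x, E x -> h (f x) = J x) /\ (forall q, ~ (f @` E) q -> h q = 0).
  have ex q : exists z : C, (forall x, E x -> f x = q -> z = J x) /\ (~ (f @` E) q -> z = 0).
    have [[x xE xq]|qE] := pselect ((f @` E) q).
      exists (J x); split=> [y yE|[]]; last by exists x.
      by rewrite -xq => /(injf (Es yE) (Es xE)) ->.
    by exists 0; split=> // x xE xq; case: qE; exists x.
  have [h hh] := choice ex; exists h; split=> [x xE|q]; last by have [] := hh q.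
  by have [e1 _] := hh (f x); exact: e1.
have inner x : E x -> nr (f x - f u0) < d0 -> nr (x - u0) < s / 2.
  by move=> xE /(hd0 x xE).
have regular x : nr (x - u0) < s / 2 -> J x != 0 ->
    exists d : R, [/\ 0 < d & exists g : V -> V, forall y, nr (y - f x) < d ->
      [/\ nr (g y - u0) < s / 2, f (g y) = y, differentiable g y & dmat f (g y) \in unitmx]].
  move=> xs Jx; have sx : 0 < s / 2 - nr (x - u0) by rewrite subr_gt0.
  have xnear y : nr (y - x) < s / 2 - nr (x - u0) -> nr (y - u0) < s / 2.
    exact: nr_near.
  have df' y : nr (y - x) < s / 2 - nr (x - u0) -> differentiable f y.
    by move=> /xnear y2; apply: df; apply: lt_trans s2.
  have ux : dmat f x \in unitmx by rewrite unitmxE unitfE.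
  have [r [c [d [[r0 rs c0 d_0] lip uf surj]]]] := local_inverse sx df' ux.
  exists d; split=> //.
  have [g hg] : exists g : V -> V, forall q, nr (q - f x) < d -> nr (g q - x) < r /\ f (g q) = q.
    have ex q : exists y, nr (q - f x) < d -> nr (y - x) < r /\ f y = q.
      have [/surj[y y1 y2]|] := boolP (nr (q - f x) < d); first by exists y.
      by move=> _; exists x.
    by have [g hg] := choice ex; exists g.
  exists g => q qd; have [h1 h2] := hg q qd; have qd' : 0 < d - nr (q - f x) by rewrite subr_gt0.
  have near y : nr (y - q) < d - nr (q - f x) -> nr (y - f x) < d.
    exact: nr_near.
  have uq : dmat f (g q) \in unitmx by apply: uf; exact: ltW.
  split=> //; first by apply: xnear; exact: lt_trans rs.
  have dq : differentiable f (g q) by apply: df'; exact: lt_trans rs.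
  apply: (inverse_diff qd' _ _ dq uq).1 => [y /near/hg[]//|].
  apply/nr_cont => e e0; exists (Num.min (d - nr (q - f x)) (e / c)).
    by rewrite lt_min qd' divr_gt0.
  move=> y; rewrite lt_min => /andP[/near/hg[y1 y2]]; rewrite ltr_pdivlMr// mulrC => ye.
  by apply: le_lt_trans ye; rewrite -{2}y2 -{2}h2; apply: lip; exact: ltW.
have ch q : nr (q - f u0) < d0 -> {for q, continuous h}.
  move=> qd; apply/nr_cont => e e0.
  have [[x xE xq]|/image_closed[d d_0 hd]] := pselect ((f @` E) q); last first.
    exists d => // y /hd/hN ->; rewrite hN ?subrr ?nr0//.
    by apply: hd; rewrite subrr nr0.
  have xs : nr (x - u0) < s / 2 by apply: inner => //; rewrite xq.
  have /nr_cont/(_ _ e0)[e1 e10 he1] := cJ x (Es xE).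
  have [d1 d10 hd1] := inv_cont xE e10.
  have close x' : E x' -> nr (f x' - q) < d1 -> nr (h (f x') - h q) < e.
    by rewrite -xq => x'E /(hd1 _ x'E)/he1; rewrite !hE.
  (* If [J x = 0], the value [0] off the image fits continuously; otherwise [f] is locally onto, and
     all nearby points belong to the image. *)
  have [Jx|Jx] := eqVneq (J x) 0.
    exists d1 => // y yq; have [[x' x'E x'y]|/hN ->] := pselect ((f @` E) y).
      by rewrite -x'y; apply: close => //; rewrite x'y.
    by rewrite -xq hE// Jx subrr nr0.
  have [d2 [d20 [g hg]]] := regular x xs Jx.
  exists (Num.min d1 d2); first by rewrite lt_min d10.
  move=> y; rewrite lt_min => /andP[y1 y2]; move: (y2); rewrite -{1}xq => /hg[g1 g2 _ _].
  by rewrite -g2; apply: close; rewrite ?g2//; exact: ltW.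
exists (d0 / 3); first by rewrite divr_gt0.
move=> q qd; apply: contrapT => nq.
have d03 : d0 / 3 < d0 by rewrite ltr_pdivrMr// ltr_pMr// ltr1n.
have qE : ~ (f @` E) q by move=> [x xE xq]; apply: nq; exists x => //; exact: Es.
have [dq dq0 hdq] := image_closed qE.
have d030 : 0 < d0 / 3 by rewrite divr_gt0.
have cf : {for u0, continuous f} by apply/diff_cont/df; rewrite subrr nr0.
move/nr_cont/(_ _ d030) : cf => [t t0 ht].
pose t' := Num.min t (s / 2); have t'0 : 0 < t' by rewrite lt_min t0.
have t's : t' <= s / 2 by rewrite ge_min lexx orbT.
have t't : t' <= t by rewrite ge_min lexx.
have [||x1 x1t ux1] := @injective_regular_point f u0 t' t'0.
- by move=> x xt; apply: df; apply: lt_trans s2; exact: lt_le_trans t's.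
- by move=> x y xt yt; apply: injf; apply: lt_trans s2; exact: lt_le_trans t's.
have x1E : E x1 by apply/ltW; exact: lt_le_trans t's.
have cd : nr (f x1 - f u0) < d0 / 3 by apply: ht; exact: lt_le_trans t't.
(* The disc is centred at a regular value [c] and has the omitted point [q] at [w = 1], near which
   [h] vanishes. With [c] and [q] within [d0 / 3] of [f u0], it stays in the ball of radius [d0];
   Rado gives [h c = 0], against regularity. *)
pose c := f x1; pose line (w : C) := c + w *: (q - c).
have qc : nr (q - c) < d0 / 3 + d0 / 3.
  by apply: le_lt_trans (nr_dist_tri (f u0) q c) _; rewrite (nr_distC (f u0)); exact: ltrD.
have lined w : nr w <= 1 -> nr (line w - f u0) < d0.
  move=> w1; rewrite /line addrAC; apply: le_lt_trans (nrD _ _) _; rewrite nrZ.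
  have : nr w * nr (q - c) <= 1 * nr (q - c) by rewrite ler_wpM2r ?nr_ge0.
  move: qc cd; rewrite -/c mul1r; move: (nr (q - c)) (nr (c - f u0)) (nr w * _) => *; lra.
have dline w : differentiable line w by exact: diff_affine.
have qc1 : 0 < nr (q - c) + 1 by rewrite ltr_wpDl ?nr_ge0.
have h0 : h (line 0) = 0.
  apply: (@weak_rado R (h \o line) (dq / (nr (q - c) + 1))); first by rewrite divr_gt0.
  - move=> z z1; apply: continuous_comp; first exact/diff_cont/dline.
    exact/ch/lined.
  - move=> z z1 hz.
    have zd := lined z (ltW z1).
    have [[x xE xq]|/hN e] := pselect ((f @` E) (line z)); last by rewrite /= e eqxx in hz.
    have xs : nr (x - u0) < s / 2 by apply: inner => //; rewrite xq.
    have Jx : J x != 0 by rewrite -hE// xq.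
    have [d2 [d20 [g hg]]] := regular x xs Jx.
    have /nr_cont/(_ _ d20)[d3 d30 hd3] := diff_cont (dline z).
    apply: (@diff_local R C C (fun w => \det (dmat f (g (line w)))) (h \o line) z d3 d30).
      move=> w /hd3; rewrite -xq => /hg[g1 g2 _ _].
      by rewrite /= -{2}g2 hE//; exact: ltW.
    have gx : nr (line z - f x) < d2 by rewrite xq subrr nr0.
    have [g1 g2 g3 g4] := hg _ gx; apply: det_diff => i j.
    have sg : 0 < s - nr (g (line z) - u0) by rewrite subr_gt0; apply: lt_trans s2.
    have dfg y : nr (y - g (line z)) < s - nr (g (line z) - u0) -> differentiable f y by move=> /dnear/df.
    have dgl w : nr (w - z) < d3 -> differentiable (fun u => g (line u)) w.
      move=> /hd3; rewrite -xq => /hg[_ _ gw _].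
      exact: (differentiable_comp (dline w) gw).
    exact: (@dmat_curve R n f (g (line z)) _ sg dfg (fun u => g (line u)) z d3 i j d30 dgl erefl).
  - move=> z; rewrite ltr_pdivlMr// => zq; apply/hN/hdq.
    have -> : line z - q = (z - 1) *: (q - c).
      by rewrite /line scalerBl scale1r opprB addrA [z *: _ + _]addrC addrAC.
    rewrite nrZ; apply: le_lt_trans zq; rewrite ler_wpM2l ?nr_ge0// lerDl.
    exact: ler01.
move: h0; rewrite /line scale0r addr0 /c hE// => Jx.
by move: ux1; rewrite unitmxE unitfE -/(J x1) Jx eqxx.
Qed.

End Openness.

End OpenMapping.

(** * The squeezing function *)

Section HyperbolicTangent.
Variable R : realType.

Lemma artanhK (x : R) : 0 <= x < 1 -> tanh (artanh x) = x.
Proof.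
move=> /andP[x0 x1]; rewrite /tanh /artanh.
have q0 : 0 < (1 + x) / (1 - x) by rewrite divr_gt0 ?subr_gt0// ltr_wpDr.
set y := ln _ / 2; have yy : y + y = ln ((1 + x) / (1 - x)) by rewrite /y; field.
have := lnK (q0 : _ \is Num.pos); rewrite -yy expRD expRN.
have a0 := expR_gt0 y; move: (expR y) a0 => a a0 aq.
have -> : (a - a^-1) / (a + a^-1) = (a * a - 1) / (a * a + 1).
  by field; rewrite !gt_eqF// ?addr_gt0// mulr_gt0.
rewrite aq; field; rewrite !gt_eqF ?subr_gt0//.
have -> : 1 + x + (1 - x) = 2 by ring.
by rewrite ltr0n.
Qed.

Lemma artanh_le (x y : R) : 0 <= x -> x <= y -> y < 1 -> artanh x <= artanh y.
Proof.
move=> x0 xy y1; have x1 := le_lt_trans xy y1; have y0 := le_trans x0 xy.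
rewrite /artanh ler_pM2r ?invr_gt0// ler_ln ?posrE ?divr_gt0 ?subr_gt0 ?ltr_wpDr//.
rewrite ler_pdivrMr ?subr_gt0// mulrAC ler_pdivlMr ?subr_gt0//; nra.
Qed.

Lemma sup_max (A : set R) (m : R) : A m -> ubound A m -> sup A = m.
Proof.
move=> Am hm; apply/eqP; rewrite eq_le; apply/andP; split.
  by apply: ge_sup => //; exists m.
by apply: ub_le_sup => //; exists m.
Qed.

End HyperbolicTangent.

(** * Schwarz estimates and the upper bound for the squeezing radius *)

Section Squeezing.
Variables (R : realType) (n : nat).
Hypothesis hn : (2 <= n)%N.
Local Notation C := (Cplx R).
Local Notation V := 'rV[C]_n.
Variable Omega : set V.
Hypotheses (Odom : domain Omega) (Obnd : bounded_set Omega) (Obal : balanced Omega)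
  (Oconv : Defs.convex Omega).
Local Notation rho := (Defs.minkowski Omega).

Let rhoN : cnorm rho := mk_cnorm Odom Obnd Obal Oconv.

Let OE (x : V) : Omega x <-> rho x < 1.
Proof. exact: mk_Omega. Qed.

Let OmegaE : [set x : V | rho x < 1] = Omega.
Proof. by apply/seteqP; split=> x /OE. Qed.

(* Hartogs--Schwarz composed with norming functionals. *)
Lemma schwarz_minus_compact (K : set V) (f : V -> V) : compact K -> K `<=` Omega -> ~ K 0 ->
  connected (Omega `\` K) -> holomorphic_map (Omega `\` K) Omega f -> f 0 = 0 ->
  forall x, (Omega `\` K) x -> rho (f x) <= rho x.
Proof.
move=> cK KO K0 cD [df fO] f0 x Dx.
have clK : closed K by apply: compact_closed => //; exact: norm_hausdorff.
have [r0 [r00 r01 Kr0]] : exists r0 : R, [/\ 0 <= r0, r0 < 1 & forall y, K y -> rho y <= r0].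
  have [Kne|/set0P/negP/negPn/eqP Ke] := pselect (K !=set0); last first.
    by exists 0; split=> // y; rewrite Ke.
  have [|c Kc hc] := @nr_EVT_max R V K rho Kne cK.
    move=> y _ e e0; have [d d0 hd] := cn_cont rhoN y e0; exists d => // z _; exact: hd.
  by exists (rho c); split; [exact: cn_ge0|exact/OE/KO|].
have [l [lC lb le]] := hahn_banach (f x) rhoN.
have [c [M [c0 M0 _ _ hcM]]] := rhoN.
have dl y : differentiable l y.
  by apply: (clinear_diff _ lC) => z; apply: le_trans (lb z) (hcM z).1.
have oD : open (Omega `\` K) by rewrite setDE; apply: openI; [case: Odom|exact: closed_openC].
have := @hartogs_schwarz R n hn rho K r0 (l \o f) rhoN r00 r01 Kr0; rewrite OmegaE.
move=> /(_ oD cD); have -> : rho (f x) = nr ((l \o f) x).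
  by rewrite /= le nr_cr ger0_norm// cn_ge0.
apply.
- by split=> //; exact: Omega0.
- by move=> y /df dfy; exact: (differentiable_comp dfy (dl (f y))).
- by move=> y /fO/OE fy; apply: le_trans (lb _) (ltW fy).
- by rewrite /= f0; have [_ lZ] := lC; rewrite -(scale0r 0) lZ mul0r.
- exact: Dx.
Qed.

(** The case of an empty hole, with [r0 = 0]. *)
Lemma schwarz_Omega (g : V -> C) : holomorphic_map Omega (@unit_disk R) g -> g 0 = 0 ->
  forall x, Omega x -> nr (g x) <= rho x.
Proof.
move=> [dg gb] g0 x Ox; have [_ oO cO] := Odom.
have K0 (y : V) : set0 y -> rho y <= 0 by [].
have := @hartogs_schwarz R n hn rho set0 0 g rhoN (lexx 0) ltr01 K0.
rewrite OmegaE setD0 => /(_ oO cO (Omega0 Odom Obal) dg); apply => //.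
by move=> y /gb; rewrite /unit_disk /= normE_nr ltcR => /ltW.
Qed.

Section Automorphism.
Variables (z : V) (phi psi : V -> V).
Hypotheses (Oz : Omega z) (hphi : holomorphic_map Omega Omega phi)
  (hpsi : holomorphic_map Omega Omega psi)
  (phiK : forall x, Omega x -> psi (phi x) = x) (psiK : forall x, Omega x -> phi (psi x) = x)
  (phiz : phi z = 0).

Lemma caratheodory_automorphism w : Omega w -> tanh (caratheodory Omega z w) = rho (phi w).
Proof.
move=> Ow; have Opw : Omega (phi w) by case: hphi => _; apply.
have pw1 : rho (phi w) < 1 by apply/OE.
rewrite /caratheodory (@sup_max _ _ (artanh (rho (phi w)))).
- by apply: artanhK; rewrite cn_ge0.
- have [l [lC lb le]] := hahn_banach (phi w) rhoN.
  have [c [M [c0 M0 _ _ hcM]]] := rhoN.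
  have dl y : differentiable l y.
    by apply: (clinear_diff _ lC) => y'; apply: le_trans (lb y') (hcM y').1.
  have [dphi phiO] := hphi.
  exists (l \o phi), (l (phi w)); split=> //.
  + split=> [x /dphi dx|x /phiO/OE px]; first exact: (differentiable_comp dx (dl _)).
    by rewrite /unit_disk /= normE_nr ltcR; apply: le_lt_trans (lb _) px.
  + by rewrite /= phiz; have [_ lZ] := lC; rewrite -(scale0r 0) lZ mul0r.
  + rewrite -[ComplexField.Normc.normc _]/(nr (l (phi w))) le nr_cr ger0_norm//.
    exact: cn_ge0.
- move=> _ [f [lam [[df fb] fz fw ->]]].
  rewrite -[ComplexField.Normc.normc _]/(nr lam) -fw.
  apply: artanh_le => //; first exact: nr_ge0.
  have [dpsi psiO] := hpsi.
  have := @schwarz_Omega (f \o psi) _ _ _ Opw; rewrite /= phiK//; apply.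
  + split=> [x Ox|x Ox]; last exact/fb/psiO.
    exact: (differentiable_comp (dpsi x Ox) (df _ (psiO x Ox))).
  + by rewrite -phiz phiK.
Qed.

End Automorphism.

(* [f] does not increase [rho], so [f (t w0)] clusters, as [t -> 1], at a point of the
   ball, which would be a value [f u]; by openness of [f] at [u] this contradicts
   injectivity. *)
Lemma squeezing_radius_le (K : set V) (f : V -> V) (r : R) (w0 : V) :
  compact K -> K `<=` Omega -> ~ K 0 -> connected (Omega `\` K) ->
  holomorphic_map (Omega `\` K) Omega f ->
  (forall x y, (Omega `\` K) x -> (Omega `\` K) y -> f x = f y -> x = y) -> f 0 = 0 ->
  [set w | rho w < r] `<=` f @` (Omega `\` K) ->
  K w0 -> (forall w, K w -> rho w0 <= rho w) -> r <= rho w0.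
Proof.
move=> cK KO K0 cD hf injf f0 Br Kw0 minw0; rewrite leNgt; apply/negP => mr.
have w00 : w0 != 0 by apply/eqP => e; apply: K0; rewrite -e.
have m0 : 0 < rho w0 by exact: (cn_gt0 rhoN).
have w01 : rho w0 < 1 by apply/OE/KO.
have clK : closed K by apply: compact_closed => //; exact: norm_hausdorff.
have oD : open (Omega `\` K) by rewrite setDE; apply: openI; [case: Odom|exact: closed_openC].
have Dt (t : R) : 0 < t -> t < 1 -> (Omega `\` K) (cr t *: w0).
  move=> t0 t1; have tm : rho (cr t *: w0) < rho w0.
    by rewrite (cnZ rhoN) nr_cr gtr0_norm// gtr_pMl.
  split; first by apply/OE; exact: lt_trans w01.
  by move=> /minw0; rewrite leNgt tm.
pose u (t : R) := f (cr t *: w0).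
have ub (t : R) : 0 < t -> t < 1 -> rho (u t) <= rho w0.
  move=> t0 t1; apply: le_trans (schwarz_minus_compact cK KO K0 cD hf f0 (Dt t t0 t1)) _.
  by rewrite (cnZ rhoN) nr_cr gtr0_norm// ler_piMl// ltW.
have [c [M [c0 M0 _ _ hcM]]] := rhoN.
pose F := u @ 1^'-.
have FF : ProperFilter F by exact: fmap_proper_filter.
have near1 (e : R) : e < 1 -> \forall t \near 1^'-, e < t /\ t < 1.
  move=> e1; near=> t; split; near: t; [exact: nbhs_left_gt|exact: nbhs_left_lt].
have FB : F [set y : V | nr (y - 0) <= M * rho w0].
  have := near1 0 ltr01; rewrite /F /= => h; apply: filterS h => t [t0 t1] /=.
  by rewrite subr0; apply: le_trans (hcM _).2 _; rewrite ler_wpM2l ?(ltW M0)// ub.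
have [p [_ pcl]] := @compact_rV_ball R n 0 (M * rho w0) F FF FB.
have cl (e s : R) : 0 < e -> s < 1 -> exists t : R, [/\ s < t, 0 < t, t < 1 & nr (u t - p) < e].
  move=> e0 s1; have ss1 : Num.max 0 s < 1 by rewrite gt_max ltr01 s1.
  have [] := pcl (u @` [set t | Num.max 0 s < t /\ t < 1]) [set y | nr (y - p) < e].
  - have := near1 _ ss1; rewrite /F /= => h; apply: filterS h => t tt /=; by exists t.
  - by apply/nbhs_nr; exists e.
  by move=> _ [[t [ht t1] <-] /= hp]; exists t; move: ht; rewrite gt_max => /andP[].
have pr : rho p < r.
  have rm : 0 < r - rho w0 by rewrite subr_gt0.
  have [d d0 hd] := cn_cont rhoN p rm.
  have [t [_ t0 t1 /hd]] := cl d 0 d0 ltr01.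
  have h := ub t t0 t1; rewrite ltr_norml => /andP[h1 _]; lra.
have [x0 Dx0 fx0] := Br p pr.
have [s1 s10 hs1] := nr_open oD Dx0.
have xw : 0 < nr (x0 - w0).
  by rewrite nr_gt0 subr_eq0; apply/eqP => e; case: Dx0 => _; rewrite e.
(* At most half the distance to [w0], so that the balls of radius [s] around [x0] and [w0] are
   disjoint. *)
have [s [s0 sw sD]] : exists s : R, [/\ 0 < s, s <= nr (x0 - w0) / 2 &
    forall x, nr (x - x0) < s -> (Omega `\` K) x].
  exists (Num.min s1 (nr (x0 - w0) / 2)); split.
  - by rewrite lt_min s10 divr_gt0.
  - by rewrite ge_min lexx orbT.
  - by move=> x; rewrite lt_min => /andP[/hs1].
have [||d d0 hd] := @open_mapping R n f x0 s s0.
- by move=> x /sD; case: hf => + _; apply.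
- by move=> x y /sD hx /sD hy; exact: injf.
have nw : 0 < nr w0 by rewrite nr_gt0.
(* For [t] above this bound, [t w0] is within [s] of [w0]. *)
have lt1 : 1 - s / nr w0 < 1 by rewrite ltrBlDr ltrDl divr_gt0.
have [t [st t0 t1 ht]] := cl d (1 - s / nr w0) d0 lt1.
have [|x xs fx] := hd (u t); first by rewrite fx0.
have xt : x = cr t *: w0 by apply: injf => //; [exact: sD|exact: Dt].
have tw : nr (cr t *: w0 - w0) < s.
  have -> : cr t *: w0 - w0 = cr (t - 1) *: w0 by rewrite crB cr1 scalerBl scale1r.
  rewrite nrZ nr_cr ltr0_norm ?subr_lt0// opprB -ltr_pdivlMr//; lra.
rewrite -xt in tw; have := nr_dist_tri x x0 w0; rewrite (nr_distC x0 x).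
by apply/negP; rewrite -ltNge; apply: lt_le_trans (ltrD xs tw) _; rewrite [leRHS]splitr lerD.
Unshelve. all: by end_near. Qed.

End Squeezing.

(** * Transport by an automorphism sending z to the origin *)

Section Main.
Variables (R : realType) (n : nat).
Hypothesis hn : (2 <= n)%N.
Local Notation C := (Cplx R).
Local Notation V := 'rV[C]_n.
Variables (Omega K : set V).
Hypotheses (Odom : domain Omega) (Obnd : bounded_set Omega) (Obal : balanced Omega)
  (Oconv : Defs.convex Omega).
Hypotheses (Kne : K !=set0) (cK : compact K) (KO : K `<=` Omega)
  (cD : connected (Omega `\` K)).
Variables (z : V) (phi psi : V -> V).
Hypotheses (Dz : (Omega `\` K) z) (hphi : holomorphic_map Omega Omega phi)
  (hpsi : holomorphic_map Omega Omega psi)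
  (phiK : forall x, Omega x -> psi (phi x) = x) (psiK : forall x, Omega x -> phi (psi x) = x)
  (phiz : phi z = 0).
Local Notation rho := (Defs.minkowski Omega).

Let rhoN : cnorm rho := mk_cnorm Odom Obnd Obal Oconv.

Let phiO x : Omega x -> Omega (phi x). Proof. by case: hphi => _; apply. Qed.
Let psiO x : Omega x -> Omega (psi x). Proof. by case: hpsi => _; apply. Qed.
Let dphi x : Omega x -> differentiable phi x. Proof. by case: hphi => + _; apply. Qed.
Let dpsi x : Omega x -> differentiable psi x. Proof. by case: hpsi => + _; apply. Qed.

Let OE (x : V) : Omega x <-> rho x < 1.
Proof. exact: mk_Omega. Qed.

Let phi_within (A : set V) : A `<=` Omega -> {within A, continuous phi}.
Proof.
move=> AO; apply/nr_within_cont => x /AO/dphi/(@diff_cont R V V)/nr_cont h e /h[d d0 hd].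
by exists d => // y _ /hd.
Qed.

Let cK' : compact (phi @` K).
Proof. by apply: continuous_compact => //; exact: phi_within. Qed.

Let K'O : phi @` K `<=` Omega.
Proof. by move=> _ [x /KO Ox <-]; exact: phiO. Qed.

Let phi_inj x y : Omega x -> Omega y -> phi x = phi y -> x = y.
Proof. by move=> Ox Oy e; rewrite -(phiK Ox) e phiK. Qed.

Let D'E : phi @` (Omega `\` K) = Omega `\` phi @` K.
Proof.
apply/seteqP; split=> [_ [x [Ox Kx] <-]|x [Ox Kx]].
  by split; [exact: phiO|move=> [y Ky /(phi_inj (KO Ky) Ox) e]; apply: Kx; rewrite -e].
exists (psi x); last exact: psiK.
by split; [exact: psiO|move=> Kp; apply: Kx; exists (psi x) => //; exact: psiK].
Qed.

Let cD' : connected (Omega `\` phi @` K).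
Proof.
rewrite -D'E; apply: connected_continuous_connected => //.
by apply: phi_within => x [].
Qed.

Let Oz : Omega z. Proof. by case: Dz. Qed.

Let K'0 : ~ (phi @` K) 0.
Proof.
move=> [x Kx]; rewrite -phiz => /(phi_inj (KO Kx) Oz) e; case: Dz => _; apply.
by rewrite -e.
Qed.

Let attained : exists2 w0, K w0 & forall w, K w -> rho (phi w0) <= rho (phi w).
Proof.
have [||w Kw hw] := @nr_EVT_min R V (phi @` K) rho _ cK'.
- by case: Kne => x Kx; exists (phi x), x.
- move=> y _ e e0; have [d d0 hd] := cn_cont rhoN y e0; exists d => // x _; exact: hd.
have [w0 Kw0 e] := Kw; exists w0; [exact: Kw0|move=> y Ky].
have h := hw _ (imageP phi Ky); by rewrite -e in h.
Qed.

Lemma squeezing_eq w0 : K w0 -> (forall w, K w -> rho (phi w0) <= rho (phi w)) ->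
  squeezing Omega (Omega `\` K) z = rho (phi w0).
Proof.
move=> Kw0 minw0; apply: sup_max.
  split.
    apply: (cn_gt0 rhoN); apply/eqP => e; apply: K'0; by exists w0.
  (* The automorphism itself is extremal: its image omits only the transported hole, which misses
     the ball by minimality. *)
  exists phi; split=> //.
  - by split=> x [Ox _]; [exact: dphi|exact: phiO].
  - by move=> x y; rewrite !inE => -[Ox _] [Oy _]; exact: phi_inj.
  - move=> x /= xr; have Ox : Omega x by apply/OE; apply: lt_trans xr _; apply/OE/phiO/KO.
    suff : (phi @` (Omega `\` K)) x by [].
    rewrite D'E; split=> // -[w Kw wx]; have := minw0 w Kw; by rewrite wx leNgt xr.
move=> r [r0 [f [[df fO] injf fz Bf]]].
apply: (@squeezing_radius_le R n hn Omega Odom Obnd Obal Oconv (phi @` K) (f \o psi)) => //.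
- split=> x Dx.
  + have [Ox _] := Dx; move: Dx; rewrite -D'E => -[y Dy yx]; rewrite -yx.
    apply: differentiable_comp; rewrite ?phiK; last by case: Dy.
      by rewrite yx; exact: dpsi.
    exact: df.
  + by move: Dx; rewrite -D'E => -[y Dy <-] /=; rewrite phiK; [exact: fO|case: Dy].
- move=> x y; rewrite -D'E => -[x' Dx' <-] [y' Dy' <-] /=.
  rewrite !phiK; [|by case: Dy'|by case: Dx'].
  by move=> e; congr phi; apply: injf => //; rewrite inE.
- by have := phiK Oz; rewrite phiz /= => ->.
- move=> x /Bf[y Dy <-]; exists (phi y); first by rewrite -D'E; exists y.
  by rewrite /= phiK//; case: Dy.
- by move=> _ [w Kw <-]; exact: minw0.
Qed.

(** If [w0] were interior, shrinking [phi w0] slightly towards [0] and pulling back by [psi] would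
    give a point of [K] with a smaller value. *)
Let boundary_min w0 : K w0 -> (forall w, K w -> rho (phi w0) <= rho (phi w)) -> boundary K w0.
Proof.
move=> Kw0 minw0; split; first exact: subset_closure.
rewrite /interior /= => /nbhs_nr[e e0 he].
have m0 : 0 < rho (phi w0) by apply: (cn_gt0 rhoN); apply/eqP => p0; apply: K'0; exists w0.
have /(@diff_cont R V V)/nr_cont/(_ _ e0)[d d0 hd] := dpsi (phiO (KO Kw0)).
have nw : 0 < nr (phi w0) + 1 by rewrite ltr_wpDl ?nr_ge0.
pose t := Num.min (2^-1) (d / (nr (phi w0) + 1)).
have t0 : 0 < t by rewrite lt_min invr_gt0 ltr0n divr_gt0.
have t1 : t < 1 by rewrite gt_min invf_lt1// ltr1n.
pose y := cr (1 - t) *: phi w0.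
have my : rho y < rho (phi w0).
  by rewrite (cnZ rhoN) nr_cr gtr0_norm ?subr_gt0// gtr_pMl// ltrBlDr ltrDl.
have Oy : Omega y by apply/OE; apply: lt_trans my _; apply/OE/phiO/KO.
have Ky : K (psi y).
  apply: he; rewrite -(phiK (KO Kw0)); apply: hd.
  have -> : y - phi w0 = - (cr t *: phi w0) by rewrite /y crB cr1 scalerBl scale1r addrC addKr.
  rewrite nrN nrZ nr_cr gtr0_norm//.
  apply: lt_le_trans (_ : t * (nr (phi w0) + 1) <= _); first by rewrite ltr_pM2l// ltrDl.
  by rewrite -ler_pdivlMr// ge_min lexx orbT.
by have := minw0 _ Ky; rewrite psiK// leNgt my.
Qed.

(** The minimum over [K] is reached on the boundary, so every set between the two has the same
    minimum; this yields both equalities of the theorem. *)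
Lemma squeezing_caratheodory_dist (S : set V) : boundary K `<=` S -> S `<=` K ->
  is_caratheodory_dist Omega S z (squeezing Omega (Omega `\` K) z).
Proof.
move=> bS SK; have [w0 Kw0 minw0] := attained; rewrite (squeezing_eq Kw0 minw0).
have ce w : K w -> tanh (caratheodory Omega z w) = rho (phi w).
  move=> Kw.
  exact: (caratheodory_automorphism hn Odom Obnd Obal Oconv Oz hphi hpsi phiK phiz (KO Kw)).
split; first by exists w0; [exact/bS/boundary_min|exact: ce].
by move=> _ [w /SK Kw <-]; rewrite (ce w Kw); exact: minw0 w Kw.
Qed.

End Main.
Unset Implicit Arguments.

Theorem theorem2p1 (R : realType) (n : nat) (hn : (2 <= n)%N)
    (Omega K : set 'rV[Cplx R]_n)
    (Omega_domain : domain Omega)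
    (Omega_bounded : bounded_set Omega)
    (Omega_balanced : balanced Omega)
    (Omega_convex : convex Omega)
    (Omega_homogeneous : homogeneous Omega)
    (K_nonempty : K !=set0)
    (K_compact : compact K)
    (K_sub : K `<=` Omega)
    (OmegaK_connected : connected (Omega `\` K)) :
  forall z, (Omega `\` K) z ->
    is_caratheodory_dist Omega (boundary K) z (squeezing Omega (Omega `\` K) z)
    /\ is_caratheodory_dist Omega K z (squeezing Omega (Omega `\` K) z).
Proof.
move=> z Dz; have Oz : Omega z by case: Dz.
have [phi [hphi [psi [hpsi phiK psiK]]] phiz] :=
  Omega_homogeneous z 0 Oz (Omega0 Omega_domain Omega_balanced).
have key S : boundary K `<=` S -> S `<=` K ->
  is_caratheodory_dist Omega S z (squeezing Omega (Omega `\` K) z).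
  exact: (squeezing_caratheodory_dist hn Omega_domain Omega_bounded Omega_balanced Omega_convex
    K_nonempty K_compact K_sub OmegaK_connected Dz hphi hpsi phiK psiK phiz).
have bK : boundary K `<=` K.
  by move=> x [clx _]; apply: compact_closed clx => //; exact: norm_hausdorff.
by split; apply: key.
Qed.
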